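(* Let $w,w'$ be row strict tableaux of type $(i_1,\dots,i_m)$ with $\widetilde Y_w\cap\widetilde Y_{w'}\ne\emptyset$. Then the analytic spaces $(\widetilde Y_w)^{an}$ and $(\widetilde Y_w\cap\widetilde Y_{w'})^{an}$ are iterated fibre bundles of base type $(\mathbb{CP}^1,\dots,\mathbb{CP}^1)$, where the number of terms equals the number of independent nodes of the associated dependence graph $D(w)$, respectively $D(w,w')$.
   Context: Setting: $n\ge2k\ge0$; $V$ has basis $e_1,\dots,e_{n-k},f_1,\dots,f_k$; $Ne_i=e_{i-1}$, $Nf_i=f_{i-1}$, $e_0=f_0=0$. For $0<i_1<\dots<i_m=n$, $\widetilde Y=\mathrm{Sp}(i_1,\dots,i_m)$ is the projective variety of partial flags $F_{i_1}\subset\dots\subset F_{i_m}$ ($\dim F_{i_l}=i_l$) with $NF_{i_l}\subset F_{i_{l-1}}$ ($F_{i_0}=\{0\}$). For a complex projective variety $X$, $X^{an}$ is the associated analytic (Hausdorff) space. A row strict tableau of type $(i_1,\dots,i_m)$: two rows (top $n-k$ boxes, bottom $k$), $i_l$ occurring $i_l-i_{l-1}$ times, strictly decreasing rows; double entries: $i_l$ with $i_l-i_{l-1}=2$; $w_\wedge,w_\vee,w_\times$: top entries, bottom entries, double entries. $\mathcal F_{i_l}(w)=\langle e_j,f_r:j\le t_{i_l},r\le b_{i_l}\rangle$ with $t_s$ ($b_s$) the number of entries $\le s$ in the top (bottom) row. With $P=\langle e_1,\dots,e_{n-k}\rangle$, $Q=\langle f_1,\dots,f_k\rangle$, $\rho:V\to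 Q$ the projection along $P$ and $F'_{i_l}=(F_{i_l}\cap P)+\rho(F_{i_l})$, $\widetilde Y_w$ is the Zariski closure of $\{F\in\widetilde Y: F'=\mathcal F(w)\}$. $eC(w)$: weight sequence $a_1\dots a_n$ ($a_{i-1}=a_i=\times$ for $i\in w_\times$, else $\wedge$/$\vee$ for $i\in w_\wedge$/$w_\vee$) with $n-k$ points $\vee$ prepended at positions $-(n-k)+1,\dots,0$ and $k$ points $\wedge$ appended at $n+1,\dots,n+k$; repeatedly join by cups $\vee\wedge$ pairs adjacent after ignoring $\times$'s and joined points until all non-$\times$ points of $1,\dots,n$ are joined; delete unused added points; cups with an endpoint at an added point are green, others black. $D(w)$: nodes $i_1,\dots,i_m$, $0,-1,\dots,-L$ ($L$ = number of points of $eC(w)$ left of $1$), $n+1,\dots,n+R+1$ ($R$ = number right of $n$); arcs: black $i_s-2\to i_s$ for each double entry $i_s$; for each cup $i<j\le n$ an arc of the same colour $i-1\to j$; for each cup $i\le n<j$ a green arc $i\to j+1$. $D(w,w')$ has as arcs the union of the arcs of $D(w)$ and $D(w')$. An independent node of such a graph is a node $j>0$ which is the leftmost node of a connected component all of whose arcs are black (isolated nodes count as components). An iterated fibre bundle of base type $(B_1,\dots,B_l)$ is a space $X_1$ together with spaces $X_2,\dots,X_l,X_{l+1}=\mathrm{pt}$ and maps $p_j:X_j\to B_j$ which are (topological) fibre bundles with typical fibre $X_{j+1}$, $j=1,\dots,l$.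
   Formalization: Independent nodes are counted only for 0 < j ≤ n: as literally defined, node n+1 is always isolated and would add one to every count (for n=1, k=0 the variety is a point but the literal count is 1). *)

(* Defs.v *)
From HB Require Import structures.
From mathcomp Require Import all_boot all_order all_algebra.
From mathcomp Require Import all_classical all_reals topology normedtype function_spaces.
From mathcomp Require Import complex.

Set Implicit Arguments.
Unset Strict Implicit.
Unset Printing Implicit Defensive.

Import Order.TTheory GRing.Theory Num.Theory.
Import numFieldNormedType.Exports.
Local Open Scope classical_set_scope.

Definition valid_type (n : nat) (ii : seq nat) : Prop :=
  [/\ sorted ltn ii, (0 < head 0 ii)%N & last 0 ii = n].

(* i_l (l is 0-based here) and i_{l-1} (with i_0 = 0) *)
Definition ityp (ii : seq nat) (l : nat) : nat := nth 0 ii l.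
Definition iprev (ii : seq nat) (l : nat) : nat :=
  if l is l'.+1 then nth 0 ii l' else 0.
Definition step (ii : seq nat) (l : nat) : nat := ityp ii l - iprev ii l.

(* A row strict tableau of type ii is encoded by w : seq (bool * bool), where
   the l-th entry (t, b) records whether i_l occurs in the top row (t) and in
   the bottom row (b).  Rows are strictly decreasing, so a row is determined by
   the set of its entries. *)
Definition row_strict (n k : nat) (ii : seq nat) (w : seq (bool * bool)) : Prop :=
  [/\ size w = size ii,
      (forall l, (l < size ii)%N ->
         let e := nth (false, false) w l in
         ((step ii l == 1%N) && (e.1 != e.2)) || [&& step ii l == 2%N, e.1 & e.2]),
      count fst w = (n - k)%N & count snd w = k].

Definition tcount (ii : seq nat) (w : seq (bool * bool)) (s : nat) : nat :=
  count (fun p => (p.1 <= s)%N && p.2.1) (zip ii w).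
Definition bcount (ii : seq nat) (w : seq (bool * bool)) (s : nat) : nat :=
  count (fun p => (p.1 <= s)%N && p.2.2) (zip ii w).

(* Cup diagram eC(w).  Labels: Some true = \vee, Some false = \wedge,       *)
(* None = \times.                                                           *)

Definition weight (ii : seq nat) (w : seq (bool * bool)) (p : nat) : option bool :=
  let l := index p ii in
  if (l < size ii)%N then
    let e := nth (false, false) w l in
    if e.1 && e.2 then None else Some (~~ e.1)
  else None.

Local Open Scope ring_scope.

Definition ext_seq (n k : nat) (ii : seq nat) (w : seq (bool * bool)) :
    seq (int * option bool) :=
  [seq ((j%:Z - (n - k)%N%:Z + 1), Some true) | j <- iota 0 (n - k)]
  ++ [seq (p%:Z, weight ii w p) | p <- iota 1 n]
  ++ [seq ((n + 1 + j)%N%:Z, Some false) | j <- iota 0 k].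

(* repeatedly joining adjacent (ignoring x's and joined points) \vee\wedge
   pairs = bracket matching with a stack *)
Fixpoint match_aux (s : seq (int * option bool)) (stack : seq int) :
    seq (int * int) :=
  match s with
  | [::] => [::]
  | (p, Some true) :: s' => match_aux s' (p :: stack)
  | (p, Some false) :: s' =>
      match stack with
      | q :: st => (q, p) :: match_aux s' st
      | [::] => match_aux s' [::]
      end
  | (p, None) :: s' => match_aux s' stack
  end.

Definition inmid (n : nat) (p : int) : bool := (1 <= p) && (p <= n%:Z).

(* the cups of eC(w): the joining stops once all non-x points of 1..n are
   joined, so cups between two added points are not part of eC(w) *)
Definition cups (n k : nat) (ii : seq nat) (w : seq (bool * bool)) : seq (int * int) :=
  [seq c <- match_aux (ext_seq n k ii w) [::] | inmid n c.1 || inmid n c.2].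

Definition Lnum n k ii w : nat := count (fun c : int * int => c.1 <= 0) (cups n k ii w).
Definition Rnum n k ii w : nat := count (fun c : int * int => n%:Z < c.2) (cups n k ii w).

(* graphs: a list of nodes and a list of arcs (source, target, is_black) *)
Definition graph := (seq int * seq (int * int * bool))%type.

Definition Dgraph (n k : nat) (ii : seq nat) (w : seq (bool * bool)) : graph :=
  let C := cups n k ii w in
  ([seq p%:Z | p <- ii]
     ++ [seq - (j%:Z) | j <- iota 0 (Lnum n k ii w).+1]
     ++ [seq (n + 1 + j)%N%:Z | j <- iota 0 (Rnum n k ii w).+1],
   [seq (p.1%:Z - 2, p.1%:Z, true) | p <- zip ii w & p.2.1 && p.2.2]
     ++ [seq (if c.2 <= n%:Z then (c.1 - 1, c.2, 1 <= c.1)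
              else (c.1, c.2 + 1, false)) | c <- C]).

Definition Dgraph2 (n k : nat) (ii : seq nat) (w w' : seq (bool * bool)) : graph :=
  (undup ((Dgraph n k ii w).1 ++ (Dgraph n k ii w').1),
   (Dgraph n k ii w).2 ++ (Dgraph n k ii w').2).

Definition nbrs (A : seq (int * int * bool)) (v : int) : seq int :=
  [seq a.1.2 | a <- A & a.1.1 == v] ++ [seq a.1.1 | a <- A & a.1.2 == v].
Definition grow (A : seq (int * int * bool)) (S : seq int) : seq int :=
  undup (S ++ flatten (map (nbrs A) S)).
Definition comp (G : graph) (v : int) : seq int :=
  iter (size G.1 + 2 * size G.2)%N (grow G.2) [:: v].

Definition independent (n : nat) (G : graph) (j : int) : bool :=
  [&& j \in G.1, 0 < j, j <= n%:Z, all (fun u => j <= u) (comp G j)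
    & all (fun a => (a.1.1 \in comp G j) ==> a.2) G.2].

Definition n_indep (n : nat) (G : graph) : nat := count (independent n G) (undup G.1).

(* Geometry.  V = C^n with C = R[i]; vectors are row vectors; coordinate a  *)
(* (0-based) is e_{a+1} for a < n-k and f_{a-(n-k)+1} for a >= n-k.         *)

Section Geometry.
Variable R : realType.
Local Notation C := R[i].

(* v *m Nmx n k = N v *)
Definition Nmx (n k : nat) : 'M[C]_n :=
  \matrix_(a, b) ((a == b.+1 :> nat) && (a != (n - k)%N :> nat))%:R.

Definition diagmx (n : nat) (P : 'I_n -> bool) : 'M[C]_n :=
  \matrix_(a, b) ((a == b) && P a)%:R.

Variables (n k : nat) (ii : seq nat).

(* real coordinates of a lift: a tuple (M_l)_l of complex n x n matrices,
   stored through real and imaginary parts *)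
Definition Ix := ('I_(size ii) * 'I_n * 'I_n * bool)%type.
Local Notation Lift := {ptws Ix -> R}.

Definition cmat (x : Lift) (l : 'I_(size ii)) : 'M[C]_n :=
  \matrix_(a, b) (x (l, a, b, false) +i* x (l, a, b, true))%C.

Definition cvec (x : Lift) : 'I_(size ii) * 'I_n * 'I_n -> C :=
  fun t => (x (t, false) +i* x (t, true))%C.

(* a lift of a flag: M_l has rows of index >= i_l zero and rank i_l, so its
   first i_l rows form a basis of F_{i_l} (Stiefel coordinates) *)
Definition is_lift (x : Lift) : Prop :=
  forall l : 'I_(size ii),
    (forall (a b : 'I_n) c, (ityp ii l <= a)%N -> x (l, a, b, c) = 0)
    /\ \rank (cmat x l) = ityp ii l.

(* tuples of subspaces, each represented by its canonical matrix <<A>> *)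
Definition flagsp := {ffun 'I_(size ii) -> 'M[C]_n}.
HB.instance Definition _ := Choice.on flagsp.

Definition flagof (x : Lift) : flagsp := [ffun l => <<cmat x l>>%MS].

(* analytic topology: quotient topology from the Stiefel coordinates *)
Definition flag_open (U : set flagsp) : Prop :=
  @open (subspace is_lift) (flagof @^-1` U).

Lemma flag_openT : flag_open setT.
Proof. by rewrite /flag_open preimage_setT; exact: openT. Qed.

Lemma flag_openI (A B : set flagsp) : flag_open A -> flag_open B -> flag_open (A `&` B).
Proof. by rewrite /flag_open preimage_setI; exact: openI. Qed.

Lemma flag_open_bigU (I : Type) (f : I -> set flagsp) :
  (forall i, flag_open (f i)) -> flag_open (\bigcup_i f i).
Proof.
by move=> fo; rewrite /flag_open preimage_bigcup; apply: bigcup_open => i _; exact: fo.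
Qed.

HB.instance Definition _ :=
  isOpenTopological.Build flagsp flag_openT flag_openI flag_open_bigU.

Inductive polyfun (J : Type) : ((J -> C) -> C) -> Prop :=
| pf_const (c : C) : polyfun (fun _ => c)
| pf_var (j : J) : polyfun (fun z => z j)
| pf_add p q : polyfun p -> polyfun q -> polyfun (fun z => p z + q z)
| pf_mul p q : polyfun p -> polyfun q -> polyfun (fun z => p z * q z).

(* Zariski closure in the product of Grassmannians (computed on the Stiefel
   coordinates, of which the Grassmannians are the quotient) *)
Definition zclosure (A : set flagsp) : set flagsp :=
  [set F | exists x, [/\ is_lift x, flagof x = F &
     forall p, polyfun p ->
       (forall y, is_lift y -> A (flagof y) -> p (cvec y) = 0) -> p (cvec x) = 0]].


Definition springer_lift (x : Lift) : Prop :=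
  [/\ is_lift x,
      (forall l : 'I_(size ii), l = 0%N :> nat -> cmat x l *m Nmx n k = 0)
    & (forall l1 l2 : 'I_(size ii), l2 = l1.+1 :> nat ->
         (cmat x l1 <= cmat x l2)%MS /\ (cmat x l2 *m Nmx n k <= cmat x l1)%MS)].

Definition Ytilde : set flagsp :=
  [set F | exists x, springer_lift x /\ flagof x = F].

Definition Pmx : 'M[C]_n := diagmx (fun a => (a < n - k)%N).
Definition Qproj : 'M[C]_n := diagmx (fun a => (n - k <= a)%N).

Definition Fprime (A : 'M[C]_n) : 'M[C]_n := (A :&: Pmx + A *m Qproj)%MS.

Definition Fw (w : seq (bool * bool)) (l : 'I_(size ii)) : 'M[C]_n :=
  diagmx (fun a => (a < tcount ii w (ityp ii l))%N
                   || ((n - k <= a)%N && (a < n - k + bcount ii w (ityp ii l))%N)).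

Definition Ycirc (w : seq (bool * bool)) : set flagsp :=
  [set F | exists x, [/\ springer_lift x, flagof x = F &
     forall l, (Fprime (cmat x l) == Fw w l)%MS]].

Definition Ytil (w : seq (bool * bool)) : set flagsp := zclosure (Ycirc w).

End Geometry.

Arguments Ytil : clear implicits.
Arguments Ytilde : clear implicits.
Arguments Ycirc : clear implicits.
Arguments zclosure : clear implicits.

(* CP^1 = Gr(1, C^2) with its analytic topology *)
Definition CP1 (R : realType) : set (flagsp R 2 [:: 1%N]) :=
  [set F | exists x, @is_lift R 2 [:: 1%N] x /\ flagof x = F].
Arguments CP1 : clear implicits.

Definition homeo_on (S T : topologicalType) (A : set S) (B : set T) (f : S -> T) : Prop :=
  exists g : T -> S,
    [/\ (forall a, A a -> B (f a)), (forall b, B b -> A (g b)),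
        (forall a, A a -> g (f a) = a), (forall b, B b -> f (g b) = b)
      & {within A, continuous f} /\ {within B, continuous g}].

(* p : X -> B is a fibre bundle with typical fibre F (spaces are subsets of
   topological types with the subspace topology) *)
Definition fibre_bundle (E B F : topologicalType) (X : set E) (Bs : set B) (Fs : set F)
    (p : E -> B) : Prop :=
  [/\ (forall x, X x -> Bs (p x)), {within X, continuous p} &
      forall b, Bs b -> exists U : set B, [/\ open U, U b &
        exists phi : E -> B * F,
          homeo_on (X `&` p @^-1` U) ((U `&` Bs) `*` Fs) phi
          /\ (forall x, X x -> U (p x) -> (phi x).1 = p x)]].

Fixpoint iter_bundle (R : realType) (l : nat) (T : topologicalType) (X : set T) : Prop :=
  match l with
  | 0%N => exists x, X = [set x]
  | l'.+1 => exists (T' : topologicalType) (X' : set T') (p : T -> flagsp R 2 [:: 1%N]),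
      fibre_bundle X (CP1 R) X' p /\ iter_bundle R l' X'
  end.

Goal n_indep 2 (Dgraph 2 1 [:: 1%N; 2%N] [:: (false, true); (true, false)]) = 1%N. Proof. by []. Qed.
Goal n_indep 2 (Dgraph 2 1 [:: 1%N; 2%N] [:: (true, false); (false, true)]) = 0%N. Proof. by []. Qed.
Goal n_indep 3 (Dgraph 3 1 [:: 1%N; 2%N; 3%N] [:: (true, false); (false, true); (true, false)]) = 1%N. Proof. by []. Qed.
Goal n_indep 2 (Dgraph 2 1 [:: 2%N] [:: (true, true)]) = 0%N. Proof. by []. Qed.
Goal n_indep 2 (Dgraph2 2 1 [:: 1%N; 2%N] [:: (false, true); (true, false)] [:: (true, false); (false, true)]) = 0%N. Proof. by []. Qed.

(* Main.v *)
Require Import Defs.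
From HB Require Import structures.
From mathcomp Require Import all_boot all_order all_algebra.
From mathcomp Require Import all_classical all_reals topology normedtype function_spaces.
From mathcomp Require Import complex.
From mathcomp Require Import ring zify.
Set Implicit Arguments.
Unset Strict Implicit.
Unset Printing Implicit Defensive.
Import Order.TTheory GRing.Theory Num.Theory.
Import numFieldNormedType.Exports.

(* After prepending n - k forced steps, a flag of Y~ becomes a chain of
   N-stable spaces, each of which is the kernel of a product of linear factors
   (1 - pi_q) + N pi_q, where the pi_q are rank one Hermitian projectors of C^2;
   normalized in this way, the pi_q are uniquely determined by the flag.  In
   these coordinates Y~_w is given by pi_j = 1 - pi_i for every cup i < j of w,
   with pi_i fixed at the prepended positions, the double entries and the
   unmatched positions: the cell satisfies these closed conditions, and a small
   change of finitely many of the projectors moves any solution into the cell.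
   Hence the intersection of Y~_w and Y~_w' is a product of copies of CP^1, one
   for each circle formed by the cups of w and w' that avoids the fixed
   positions.
   To count, note that an independent node is the leading position of some 0/1
   function on the nodes that is constant along the arcs and vanishes on the
   components with a green arc, while the least position on a free circle is the
   leading position of some 0/1 function on the positions that is constant along
   the cups and vanishes at the fixed positions.  Partial sums modulo 2 turn
   functions of the second kind into functions of the first kind. *)

(** * Matching of brackets *)

(** The identity behind the coordinates is (p + N (1 - p)) ((1 - p) + N p) = N. The factors at the
    two ends of a cup thus cancel up to N, and all factors of a cup together compose to a power of
    N. A cup therefore amounts to an inclusion of N^s F_b in an earlier space, and this is how pi_j
    = 1 - pi_i arises. The projectors are not polynomial functions of the flag; hence these
    inclusions, and not the projectors, are used to pass to the Zariski closure, while density is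
    shown by moving along real curves and using that polynomials are continuous. The m = n - k
    prepended positions give every wedge a partner to its left; the price is m additional vectors f,
    placed below those of V. A double entry is treated as a cup between neighbouring positions with
    a projector fixed by convention, so crosses need no separate treatment. Cups join positions of
    opposite parity, so going round a circle never leads to pi = 1 - pi, and every free circle
    contributes a full CP^1. *)

Section Stack.
Variable lab : nat -> bool.

(** A label is [true] for a vee and [false] for a wedge. The stack before position [p] lists the
    vees still open there, innermost first. Popping an empty stack leaves it empty; [no_underflow]
    excludes this case below [N]. *)
Fixpoint bstack (p : nat) : seq nat :=
  if p is q.+1 then if lab q then q :: bstack q else behead (bstack q) else [::].
(** The gap after the innermost open vee, or 0: from here to [p] all positions are joined among
    themselves, provided that no wedge underflows. *)
Definition btop p := if bstack p is q :: _ then q.+1 else 0.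
Definition matched i j := ~~ lab j && (ohead (bstack j) == Some i).
Definition no_underflow N := forall j, j < N -> ~~ lab j -> bstack j <> [::].

Lemma bstack_cons p q st : bstack p = q :: st -> [/\ q < p, lab q & bstack q = st].
Proof.
elim/ltn_ind: p q st => -[//|p] IH q st /=.
case: ifP => [lp [<- <-]//|_]; case E: (bstack p) => [//|r s'] /= Es.
have [rp _ Er] := IH p (ltnSn p) _ _ E.
have [qr lq <-] := IH r (ltnW rp) q st (etrans Er Es).
by split=> //; lia.
Qed.

Lemma mem_bstack p x : x \in bstack p -> x < p /\ lab x.
Proof.
elim/ltn_ind: p => p IH; case E: (bstack p) => [//|q st].
have [qp lq Eq] := bstack_cons E; rewrite inE => /orP[/eqP -> //|].
by rewrite -Eq => /(IH q qp)[xq lx]; split=> //; apply: ltn_trans qp.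
Qed.

Lemma matchedP i j : matched i j -> [/\ i < j, lab i, ~~ lab j, bstack j = i :: bstack i & bstack j.+1 = bstack i].
Proof.
move=> /andP[lj]; case E: (bstack j) => [//|q st] /= /eqP[qi].
have [qj lq Eq] := bstack_cons E; rewrite -qi Eq E (negbTE lj) /=.
by split.
Qed.

Lemma bstack_subset x p r : p <= r -> x < p -> x \in bstack r -> x \in bstack p.
Proof.
move=> pr xp; elim: r pr => [|r IH]; first by rewrite leqn0 => /eqP <-.
rewrite leq_eqVlt => /orP[/eqP -> //|]; rewrite ltnS => pr /= h.
apply: IH => //; case: ifP h => _; last exact: mem_behead.
by rewrite inE => /orP[/eqP E|//]; move: xp; rewrite E ltnNge pr.
Qed.

Lemma bstack_split i p : i \in bstack p -> exists pre, bstack p = pre ++ i :: bstack i.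
Proof.
elim/ltn_ind: p => p IH; case E: (bstack p) => [//|q st].
have [qp _ Eq] := bstack_cons E; rewrite inE => /orP[/eqP ->|].
  by exists [::]; rewrite Eq.
rewrite -Eq => /(IH q qp)[pre ->]; by exists (q :: pre).
Qed.

(** If [i] were open at some later [p], it would be open right after [j]; but the stack there is
    [bstack i], whose entries are below [i]. *)
Lemma matched_notin i j p : matched i j -> j < p -> i \notin bstack p.
Proof.
move=> c jp; apply/negP => h.
have [ij _ _ _ E] := matchedP c.
have := bstack_subset jp (ltnW ij) h.
by rewrite E => /mem_bstack[]; rewrite ltnn.
Qed.

Lemma matched_injr i j j' : matched i j -> matched i j' -> j = j'.
Proof.
suff H a b : matched i a -> matched i b -> a < b -> False.
  by move=> c c'; case: (ltngtP j j') => // /H[].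
move=> ca cb /(matched_notin ca); have [_ _ _ -> _] := matchedP cb.
by rewrite mem_head.
Qed.

Lemma matched_injl i i' j : matched i j -> matched i' j -> i = i'.
Proof. by move=> /andP[_ /eqP E] /andP[_]; rewrite E => /eqP[]. Qed.

Lemma matched_exists N i : i < N -> lab i -> i \notin bstack N -> exists2 j, j < N & matched i j.
Proof.
move=> + li; elim: N => // N IH; rewrite ltnS leq_eqVlt => /orP[/eqP <-|iN].
  by rewrite /= li mem_head.
case: (boolP (i \in bstack N)) => [|/(IH iN)[j jN c] _]; last by exists j => //; apply: ltnW.
rewrite /=; case E: (lab N); first by rewrite inE negb_or => -> /andP[].
case Es: (bstack N) => [//|r st] /=; rewrite inE => /orP[/eqP ir _|-> //].
by exists N => //; rewrite /matched E Es ir /=.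
Qed.

Lemma bstack_ind N (Rel : nat -> nat -> Prop) :
  no_underflow N -> (forall a, Rel a a) ->
  (forall a b c, Rel a b -> Rel b c -> Rel a c) ->
  (forall i j, j < N -> matched i j -> Rel i.+1 j -> Rel i j.+1) ->
  forall p, p <= N -> Rel (btop p) p.
Proof.
move=> nu rf tr st; elim/ltn_ind => -[_ _|p IH pN]; first exact: rf.
case: (boolP (lab p)) => lp; first by rewrite /btop /= lp; apply: rf.
have := nu p pN lp; case E: (bstack p) => [//|i s'] _.
have c : matched i p by rewrite /matched lp E /=.
have [ip _ _ _ Ep] := matchedP c.
have hip : Rel i.+1 p by have := IH p (ltnSn _) (ltnW pN); rewrite /btop E.
have := IH i (ltnW ip) (ltnW (ltn_trans ip pN)).
rewrite /btop Ep => h; apply: tr h _; exact: st.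
Qed.

Lemma bstack_ind_matched N (Rel : nat -> nat -> Prop) :
  no_underflow N -> (forall a, Rel a a) ->
  (forall a b c, Rel a b -> Rel b c -> Rel a c) ->
  (forall i j, j < N -> matched i j -> Rel i.+1 j -> Rel i j.+1) ->
  forall i j, j < N -> matched i j -> Rel i.+1 j.
Proof.
move=> nu rf tr st i j jN c; have := bstack_ind nu rf tr st (ltnW jN).
by rewrite /btop; have [_ _ _ -> _] := matchedP c.
Qed.

Lemma matched_parity N i j : no_underflow N -> j < N -> matched i j -> odd j = ~~ odd i.
Proof.
move=> nu jN c.
have := @bstack_ind_matched N (fun a b => odd a = odd b) nu (fun=> erefl) _ _ i j jN c.
move=> H; rewrite -H //= ?negbK //; first by move=> a b c' -> ->.
by move=> i' j' _ _ <-; rewrite negbK.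
Qed.

Lemma size_bstack N p : no_underflow N -> p <= N ->
  size (bstack p) + count (predC lab) (iota 0 p) = count lab (iota 0 p).
Proof.
move=> nu; elim: p => // p IH pN.
rewrite -addn1 iotaD !count_cat /= add0n addn0 addn1.
have := IH (ltnW pN); rewrite /=; case: ifP => lp /=; rewrite ?lp /=; first by lia.
have := nu p pN (negbT lp); case: (bstack p) => //= a st _ <-; lia.
Qed.

(** The size of the stack is the excess of vees over wedges. At the first wedge that meets an empty
    stack this excess is 0, so the count just after that wedge violates the hypothesis. *)
Lemma no_underflowP N :
  (forall p, p <= N -> count (predC lab) (iota 0 p) <= count lab (iota 0 p)) ->
  no_underflow N.
Proof.
move=> h j; elim/ltn_ind: j => j IH jN lj sj.
have nu : no_underflow j by move=> q qj; apply: IH => //; apply: ltn_trans jN.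
have := size_bstack nu (leqnn j); have := h j.+1 jN.
rewrite sj -addn1 iotaD !count_cat /= add0n (negbTE lj) /=; lia.
Qed.

Definition wedges p := count (predC lab) (iota 0 p).
Definition vees p := count lab (iota 0 p).

Lemma wedgesS p : wedges p.+1 = (wedges p + ~~ lab p)%N.
Proof. by rewrite /wedges -addn1 iotaD count_cat /= add0n addn0. Qed.
Lemma veesS p : vees p.+1 = (vees p + lab p)%N.
Proof. by rewrite /vees -addn1 iotaD count_cat /= add0n addn0. Qed.

(** * Double entries as cups between neighbouring positions *)

Section Doubles.
Variable dbl : nat -> bool.
Hypothesis dblP : forall q, dbl q -> lab q /\ ~~ lab q.+1.

Definition second_of (p : nat) := if p is q.+1 then dbl q else false.
Lemma double_matched q : dbl q -> matched q q.+1.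
Proof. by move=> /dblP[lq lq1]; rewrite /matched lq1 /= lq /=. Qed.

Lemma matched_second i j : matched i j -> second_of j -> j = i.+1 /\ dbl i.
Proof.
case: j => [//|q] c dq; have := matched_injl c (double_matched dq).
by move=> ->.
Qed.

End Doubles.

End Stack.

(** * The weight sequence of a tableau *)

Section Tableau.
Variables (n k : nat) (ii : seq nat).
Local Notation m := (n - k)%N.
Local Notation prv := (iprev ii).
Local Notation typ := (ityp ii).

(** Position [m + p] stands for the point p + 1 of the weight sequence, positions below [m] for the
    prepended vees. As the steps of the type are 1 or 2, a value missing in [ii] is the first of the
    two points of a double entry. *)
Definition double_first (P : nat) := [&& m <= P, P < m + n & (P - m).+1 \notin ii].
(** A double entry is labelled vee, wedge instead of by two crosses, which makes it a cup of its
    own. [weight] is [None] at both of its points, and membership in [ii] tells the second from the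
    first. All positions from [m + n] on are wedges; the appended points are the first [k] of
    them. *)
Definition labw (w : seq (bool * bool)) (P : nat) : bool :=
  if P < m then true
  else if P < m + n then
    if weight ii w (P - m).+1 is Some b then b else (P - m).+1 \notin ii
  else false.

Hypothesis hv : valid_type n ii.

Lemma size_ii : 0 < size ii.
Proof. by case: hv => _; case: ii. Qed.

Lemma typ_lt l l' : l < l' -> l' < size ii -> typ l < typ l'.
Proof.
case: hv => hs _ _ h h'.
by apply: (sorted_ltn_nth ltn_trans 0 hs); rewrite ?inE //; apply: ltn_trans h'.
Qed.

Lemma typ_inj l l' : l < size ii -> l' < size ii -> typ l = typ l' -> l = l'.
Proof.
move=> h h' E; case: (ltngtP l l') => // a.
  by have := typ_lt a h'; rewrite E ltnn.
by have := typ_lt a h; rewrite E ltnn.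
Qed.

Lemma index_typ l : l < size ii -> index (typ l) ii = l.
Proof.
move=> h; have hi : typ l \in ii by apply: mem_nth.
have := nth_index 0 hi; apply: typ_inj => //; by rewrite index_mem.
Qed.

Lemma prv_lt l : l < size ii -> prv l < typ l.
Proof.
case: l => [|l] h; last exact: typ_lt.
by case: hv => _; rewrite /ityp /=; case: ii.
Qed.

Lemma prv_size : prv (size ii) = n.
Proof. by case: hv => _; case: ii => [//|a s] _ <-; apply: (nth_last 0 (a :: s)). Qed.

Lemma typ_le l : l < size ii -> typ l <= n.
Proof.
move=> h; rewrite -prv_size; have := size_ii; case E: (size ii) h => [//|s].
rewrite ltnS leq_eqVlt => /orP[/eqP -> //|h] _ /=.
by apply/ltnW/typ_lt => //; rewrite E.
Qed.

Lemma prv_le l : l < size ii -> prv l < n.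
Proof. by move=> h; apply: leq_trans (prv_lt h) (typ_le h). Qed.

Lemma between_notin l p : l < size ii -> prv l < p -> p < typ l -> p \notin ii.
Proof.
move=> h h1 h2; apply/negP => /(nthP 0)[l' hl' E].
case: (ltngtP l' l) => a.
- case: l h h1 h2 a => // l h h1 h2; rewrite ltnS leq_eqVlt => /orP[/eqP b|b].
    by move: h1; rewrite -E b /= ltnn.
  by have := typ_lt b (ltnW h); rewrite /ityp E; move: h1 => /=; lia.
- by have := typ_lt a hl'; rewrite /ityp E; move: h2; rewrite /ityp; lia.
- by move: h2; rewrite -E a /ityp ltnn.
Qed.

Hypothesis h12 : forall l, l < size ii -> typ l = (prv l).+1 \/ typ l = (prv l).+2.

Lemma pos_cases P : m <= P -> P < m + n -> exists2 l, l < size ii &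
  P = m + prv l \/ P = m + (prv l).+1 /\ typ l = (prv l).+2.
Proof.
move=> h1 h2; set p := P - m; have -> : P = m + p by rewrite /p; lia.
have pn : p < n by rewrite /p; lia.
have [l hl [a b]] : exists2 l, l < size ii & prv l <= p /\ p < typ l.
  have : exists l, (l < size ii) && (p < typ l).
    exists (size ii).-1; rewrite prednK ?size_ii // leqnn /=.
    by have := prv_size; have := size_ii; case: (size ii) => //= s _; rewrite /ityp => ->.
  case/ex_minnP => l /andP[hl pl] hm; exists l => //; split=> //.
  case: l hl pl hm => // l hl pl hm /=; rewrite leqNgt; apply/negP => h.
  by have := hm l; rewrite h (ltnW hl) => /(_ isT); rewrite ltnn.
exists l => //; have [E|E] := h12 hl; rewrite E in b; first by left; lia.
have [E'|E'] : p = prv l \/ p = (prv l).+1 by lia.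
  by left; rewrite E'.
by right; rewrite E'.
Qed.

Lemma double_first_prv l : l < size ii -> double_first (m + prv l) = (typ l == (prv l).+2).
Proof.
move=> hl; have := prv_le hl => h.
rewrite /double_first leq_addr ltn_add2l h addKn /=.
have [E|E] := h12 hl; first by rewrite -E mem_nth // E eqn_leq ltnn andbF.
by rewrite E eqxx; apply: (between_notin hl) => //; rewrite E.
Qed.

Lemma double_first_prvS l : l < size ii -> typ l = (prv l).+2 -> double_first (m + (prv l).+1) = false.
Proof.
move=> hl E; rewrite /double_first addKn -E mem_nth // !andbF //.
Qed.

Lemma double_firstP P : double_first P -> exists2 l, l < size ii &
  P = m + prv l /\ typ l = (prv l).+2.
Proof.
move=> h; have /and3P[h1 h2 _] := h.
have [l hl [E|[E E2]]] := pos_cases h1 h2; exists l => //.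
  by split => //; move: h; rewrite E double_first_prv // => /eqP.
by move: h; rewrite E double_first_prvS.
Qed.

Lemma second_of_prv l : l <= size ii -> second_of double_first (m + prv l) = false.
Proof.
move=> hl; apply/negP; case E: (m + prv l) => [//|q] /= /double_firstP[l' hl' [E1 E2]].
have E3 : prv l = (prv l').+1 by lia.
case: l hl E E3 => [//|l] hl E /= E3.
have := between_notin hl' (ltnSn _); rewrite E2 ltnSn => /(_ isT).
by rewrite -E3 mem_nth.
Qed.

Section OneTableau.
Variable w : seq (bool * bool).
Hypothesis hw : row_strict n k ii w.
Local Notation lab := (labw w).
Local Notation e l := (nth (false, false) w l).

Lemma row_strict_cases l : l < size ii ->
  (typ l = (prv l).+1 /\ (e l).1 = ~~ (e l).2) \/
  (typ l = (prv l).+2 /\ (e l).1 && (e l).2).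
Proof.
case: hw => _ h _ _ hl; have := h l hl; have := prv_lt hl; rewrite /step /=.
case/orP: (h l hl) => [/andP[/eqP s1 h1] | /and3P[/eqP s1 h1 h2]] h0 _.
  by left; split; [move: s1; rewrite /step; lia|case: (e l) h1 => -[] []].
by right; rewrite h1 h2; split => //; move: s1; rewrite /step; lia.
Qed.

Lemma lab_left P : P < m -> lab P.
Proof. by rewrite /labw => ->. Qed.

Lemma lab_mid p : p < n ->
  lab (m + p) = if weight ii w p.+1 is Some b then b else p.+1 \notin ii.
Proof. by move=> pn; rewrite /labw ltnNge leq_addr ltn_add2l pn addKn. Qed.

Lemma lab_single l : l < size ii -> typ l = (prv l).+1 ->
  lab (m + prv l) = ~~ (e l).1.
Proof.
move=> hl E; rewrite lab_mid ?prv_le // /weight -E index_typ // hl.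
have [[_ h]|[E' _]] := row_strict_cases hl; last by rewrite E in E'; lia.
by rewrite h; case: (e l).2.
Qed.

Lemma lab_double1 l : l < size ii -> typ l = (prv l).+2 -> lab (m + prv l).
Proof.
move=> hl E; rewrite lab_mid ?prv_le //.
have hn : (prv l).+1 \notin ii by apply: (between_notin hl) => //; rewrite E.
by rewrite /weight index_mem (negbTE hn).
Qed.

Lemma lab_double2 l : l < size ii -> typ l = (prv l).+2 -> lab (m + (prv l).+1) = false.
Proof.
move=> hl E; have h := typ_le hl; rewrite lab_mid -?E // /weight index_typ // hl.
have [[E' _]|[_ ->]] := row_strict_cases hl; first by rewrite E in E'; lia.
by rewrite mem_nth.
Qed.

Lemma double_first_lab q : double_first q -> lab q /\ ~~ lab q.+1.
Proof.
move=> /double_firstP[l hl [-> E]]; rewrite lab_double1 //; split => //.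
by rewrite -addnS lab_double2.
Qed.

Lemma counts_left P : P <= m -> wedges lab P = 0 /\ vees lab P = P.
Proof.
elim: P => // P IH h; have [h1 h2] := IH (ltnW h).
by rewrite wedgesS veesS h1 h2 lab_left //= addn1.
Qed.

Lemma counts_prv l : l <= size ii ->
  wedges lab (m + prv l) = count fst (take l w) /\
  vees lab (m + prv l) = m + count snd (take l w).
Proof.
elim: l => [|l IH] hl.
  rewrite /= addn0 take0 /= addn0; exact: counts_left.
have [IH1 IH2] := IH (ltnW hl); have hs : size w = size ii by case: hw.
rewrite (take_nth (false, false)) ?hs // -cats1 !count_cat /= !addn0.
have [[E h]|[E h]] := row_strict_cases hl; rewrite /ityp in E; rewrite E.
  rewrite addnS wedgesS veesS lab_single // IH1 IH2 h !negbK -addnA.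
  by split.
rewrite !addnS wedgesS veesS -addnS lab_double2 // addnS wedgesS veesS lab_double1 // IH1 IH2.
by case/andP: h => -> ->; rewrite /= !addn0 -!addnA.
Qed.

Lemma count_zip_typ (a : pred (bool * bool)) l : l < size ii ->
  count (fun p => (p.1 <= typ l) && a p.2) (zip ii w) = count a (take l.+1 w).
Proof.
move=> hl; have hs : size w = size ii by case: hw.
have -> : count a (take l.+1 w) = count (fun p => a p.2) (zip (take l.+1 ii) (take l.+1 w)).
  rewrite -[in LHS](@unzip2_zip _ _ (take l.+1 ii) (take l.+1 w)) ?count_map //.
  by rewrite !size_take hs.
have -> : zip ii w = zip (take l.+1 ii) (take l.+1 w) ++ zip (drop l.+1 ii) (drop l.+1 w).
  by rewrite -zip_cat ?cat_take_drop // !size_take hs.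
rewrite count_cat -[RHS]addn0; congr (_ + _).
  apply/eq_in_count => x /(nthP (0, (false, false)))[j].
  rewrite size_zip !size_take hs minnn => hj <-.
  have hj' : j < l.+1 by move: hj; case: ifP => // *; lia.
  rewrite nth_zip /= ?size_take ?hs // !nth_take //.
  suff -> : nth 0 ii j <= typ l by [].
  move: hj'; rewrite ltnS leq_eqVlt => /orP[/eqP -> //|b]; exact/ltnW/typ_lt.
apply/eqP; rewrite -leqn0 leqNgt -has_count; apply/hasP => -[x].
move=> /(nthP (0, (false, false)))[j]; rewrite size_zip !size_drop hs minnn => hj <-.
rewrite nth_zip /= ?size_drop ?hs // !nth_drop => /andP[+ _].
have hj2 : l.+1 + j < size ii by rewrite -ltn_subRL.
have : typ l < typ (l.+1 + j) by apply: typ_lt hj2; rewrite addSn ltnS leq_addr.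
by move=> h h'; move: h; rewrite ltnNge h'.
Qed.

Lemma wedges_typ l : l < size ii -> wedges lab (m + typ l) = tcount ii w (typ l).
Proof.
move=> hl; have [h _] := counts_prv hl.
by rewrite /tcount (@count_zip_typ fst) // -h.
Qed.

Lemma vees_typ l : l < size ii -> vees lab (m + typ l) = m + bcount ii w (typ l).
Proof.
move=> hl; have [_ h] := counts_prv hl.
by rewrite /bcount (@count_zip_typ snd) // -h.
Qed.

Lemma counts_total : wedges lab (m + n) = m /\ vees lab (m + n) = m + k.
Proof.
have := counts_prv (leqnn _); rewrite prv_size.
by case: hw => <- _ ct cb; rewrite take_size ct cb.
Qed.

Lemma counts_mono p q : p <= q -> wedges lab p <= wedges lab q /\ vees lab p <= vees lab q.
Proof.
move=> /subnK <-; elim: (q - p) => // d [h1 h2].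
by rewrite addSn wedgesS veesS !(leq_trans _ (leq_addr _ _)).
Qed.

(** The prepended vees alone suffice: there are [m] of them, and the wedges up to [m + n] number n -
    k = m in total, one for each box of the top row. *)
Lemma labw_no_underflow : no_underflow lab (m + n).
Proof.
apply: no_underflowP => p pN; rewrite -/(wedges lab p) -/(vees lab p).
case: (leqP p m) => pm; first by have [-> _] := counts_left pm.
have [h1 _] := counts_mono pN; have [_ h2] := counts_mono (ltnW pm).
have [h3 _] := counts_total; have [_ h4] := counts_left (leqnn m).
by rewrite h3 in h1; rewrite h4 in h2; apply: leq_trans h2.
Qed.

Lemma size_bstack_total : size (bstack lab (m + n)) = k.
Proof.
have := size_bstack labw_no_underflow (leqnn _); rewrite -/(wedges lab _) -/(vees lab _).
by have [-> ->] := counts_total; lia.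
Qed.

Lemma typ12 l : l < size ii -> typ l = (prv l).+1 \/ typ l = (prv l).+2.
Proof. by move=> hl; have [[]|[]] := row_strict_cases hl; [left|right]. Qed.

End OneTableau.
End Tableau.

(** * Circles formed by two matchings *)

Section Components.
Variables (N : nat) (lab lab' : nat -> bool) (fx : nat -> bool).
Hypothesis nu : no_underflow lab N.

Definition circle_edge : rel 'I_N := fun i j =>
  [|| matched lab i j, matched lab j i, matched lab' i j | matched lab' j i].

Lemma circle_edge_sym : connect_sym circle_edge.
Proof.
apply: sym_connect_sym => i j; rewrite /circle_edge.
by case: (matched lab i j); case: (matched lab j i); case: (matched lab' i j); case: (matched lab' j i).
Qed.

Definition free_circle (q : 'I_N) := [forall i, connect circle_edge q i ==> ~~ fx i].
Definition circle_min (q : 'I_N) : 'I_N := [arg min_(i < q | connect circle_edge q i) i].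
Definition free_leading (q : 'I_N) := free_circle q && (circle_min q == q).

Lemma circle_minP q : connect circle_edge q (circle_min q) /\ forall i, connect circle_edge q i -> circle_min q <= i.
Proof. by rewrite /circle_min; case: arg_minnP => [|i c h]; rewrite ?connect0. Qed.

Lemma free_circle_connect q r : connect circle_edge q r -> free_circle q = free_circle r.
Proof.
move=> c; apply/forallP/forallP => h i; apply/implyP => ci; apply: (implyP (h i)).
  exact: connect_trans c ci.
by apply: connect_trans ci; rewrite circle_edge_sym.
Qed.

Lemma circle_min_connect q r : connect circle_edge q r -> circle_min q = circle_min r.
Proof.
move=> c; have [c1 h1] := circle_minP q; have [c2 h2] := circle_minP r.
apply: val_inj; apply/eqP; rewrite eqn_leq h1 ?h2 //.
  by apply: connect_trans c1; rewrite circle_edge_sym.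
exact: connect_trans c c2.
Qed.

Lemma circle_min_leading q : free_circle q -> free_leading (circle_min q).
Proof.
have [c _] := circle_minP q; rewrite /free_leading -(free_circle_connect c) => ->.
by rewrite -(circle_min_connect c) eqxx.
Qed.

Definition pos_solution (d : nat -> bool) :=
  [/\ (forall i j, j < N -> matched lab i j -> d i = d j),
      (forall i j, j < N -> matched lab' i j -> d i = d j) &
      forall q, q < N -> fx q -> d q = false].

Lemma pos_solution_connect d (q r : 'I_N) : pos_solution d -> connect circle_edge q r -> d q = d r.
Proof.
move=> [h1 h2 _] /connectP[p + ->]; elim: p q => //= a p IH q /andP[e /IH <-].
by case/or4P: e => c; [apply: h1 c|symmetry; apply: h1 c|apply: h2 c|symmetry; apply: h2 c].
Qed.

(** In one direction the indicator function of the circle of [q] is a solution. Conversely, a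
    solution is constant on circles, so it is false on those with a fixed position, and its first
    true position is the least one of its circle. *)
Lemma free_leadingP (q : 'I_N) : free_leading q <->
  exists2 d, pos_solution d & d q /\ forall i, i < q -> d i = false.
Proof.
split=> [/andP[fq /eqP lq]|[d hd [dq d0]]].
  pose d i := if insub i is Some a then connect circle_edge q a else false.
  have dE (a : 'I_N) : d a = connect circle_edge q a by rewrite /d valK.
  exists d.
    have H i j : j < N -> i < j -> (forall a b : 'I_N, a = i :> nat -> b = j :> nat -> circle_edge a b) -> d i = d j.
      move=> jN ij h; have iN := ltn_trans ij jN.
      rewrite (dE (Ordinal iN)) (dE (Ordinal jN)).
      have c : connect circle_edge (Ordinal iN) (Ordinal jN) by apply/connect1/h.
      apply/idP/idP => h'; apply: connect_trans h' _; rewrite // circle_edge_sym //.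
    split.
    - move=> i j jN c; have [ij _ _ _ _] := matchedP c; apply: H => // a b Ea Eb.
      by rewrite /circle_edge Ea Eb c.
    - move=> i j jN c; have [ij _ _ _ _] := matchedP c; apply: H => // a b Ea Eb.
      by rewrite /circle_edge Ea Eb c !orbT.
    - move=> r rN frow; rewrite (dE (Ordinal rN)); apply/negP => c.
      by have := forallP fq (Ordinal rN); rewrite c frow.
  split; first by rewrite dE connect0.
  move=> i iq; have iN := ltn_trans iq (ltn_ord q).
  rewrite (dE (Ordinal iN)); apply/negP => c.
  by have [_ /(_ _ c)] := circle_minP q; rewrite lq leqNgt iq.
have [c1 h1] := circle_minP q.
have fq : free_circle q.
  apply/forallP => i; apply/implyP => c; apply/negP => fi.
  by have [_ _ h] := hd; move: dq; rewrite (pos_solution_connect hd c) h.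
rewrite /free_leading fq; apply/eqP/val_inj/eqP; rewrite eqn_leq h1 ?connect0 // leqNgt.
by apply/negP => h; move: dq; rewrite (pos_solution_connect hd c1) d0.
Qed.

End Components.

Local Open Scope ring_scope.

(** * Independent nodes *)

Section Comp.
Variable G : graph.
Local Notation A := G.2.

Lemma mem_nbrs u v : v \in nbrs A u <->
  exists2 a, a \in A & (a.1.1 = u /\ a.1.2 = v) \/ (a.1.2 = u /\ a.1.1 = v).
Proof.
rewrite /nbrs mem_cat; split.
  case/orP => /mapP[a]; rewrite mem_filter => /andP[/eqP h aA] ->; exists a => //.
    by left.
  by right.
move=> [a aA [[<- <-]|[<- <-]]]; apply/orP; [left|right]; apply/mapP; exists a => //.
  by rewrite mem_filter eqxx.
by rewrite mem_filter eqxx.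
Qed.

Lemma mem_grow S v : v \in grow A S <-> v \in S \/ exists2 u, u \in S & v \in nbrs A u.
Proof.
rewrite /grow mem_undup mem_cat; split.
  case/orP => [->|/flattenP[s /mapP[u uS ->] vs]]; first by left.
  by right; exists u.
case=> [-> //|[u uS vu]]; apply/orP; right; apply/flattenP.
by exists (nbrs A u) => //; apply/mapP; exists u.
Qed.

Variable v : int.
Let S t := iter t (grow A) [:: v].

Let closedS (T : seq int) := forall u x, u \in T -> x \in nbrs A u -> x \in T.

Let S_uniq t : uniq (S t).
Proof. by case: t => //= t; apply: undup_uniq. Qed.

Let S_sub t : {subset S t <= S t.+1}.
Proof. by move=> x xS; apply/mem_grow; left. Qed.

Let S_bound t : {subset S t <= v :: [seq a.1.1 | a <- A] ++ [seq a.1.2 | a <- A]}.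
Proof.
elim: t => [|t IH] x; first by rewrite !inE => ->.
move/mem_grow => [/IH //|[u _ /mem_nbrs[a aA [[_ <-]|[_ <-]]]]].
  by rewrite inE mem_cat (map_f (fun a => a.1.2)) // !orbT.
by rewrite inE mem_cat (map_f (fun a => a.1.1)) // !orbT.
Qed.

Let closed_next t : closedS (S t) -> closedS (S t.+1).
Proof.
move=> h u x /mem_grow H xu; apply/mem_grow; left.
by case: H => [uS|[y yS uy]]; [apply: h xu|apply: (h _ _ (h _ _ yS uy) xu)].
Qed.

Let not_closed_size t : ~ closedS (S t) -> (size (S t) < size (S t.+1))%N.
Proof.
move=> h; apply: contrapT => hs; apply: h => u x uS xu; apply: contrapT => xS; apply: hs.
have : {subset x :: S t <= S t.+1}.
  move=> y; rewrite inE => /orP[/eqP ->|]; last exact: S_sub.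
  by apply/mem_grow; right; exists u.
by move/(uniq_leq_size _); apply; rewrite /= S_uniq andbT; apply/negP.
Qed.

(** Closedness persists under [grow]. If it failed after [k] rounds, it failed in every round
    before, and each of them added a node, which yields more than k + 1 nodes. But only [v] and the
    endpoints of arcs can occur, at most 1 + 2 [size G.2] of them. *)
Lemma comp_closed : closedS (Defs.comp G v).
Proof.
rewrite /Defs.comp; set k := (_ + _)%N; apply: contrapT => hk.
have H t : (t <= k)%N -> ~ closedS (S (k - t)).
  elim: t => [|t IH] tk; first by rewrite subn0.
  move=> h; apply: (IH (ltnW tk)).
  have Ek : (k - t = (k - t.+1).+1)%N by lia.
  by move: (closed_next h); rewrite -Ek.
have H2 t : (t <= k.+1)%N -> (t < size (S t))%N.
  elim: t => [//|t IH] tk; apply: leq_ltn_trans (IH (ltnW tk)) _.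
  by apply: not_closed_size; have := H (k - t)%N (leq_subr _ _); rewrite subKn.
have := uniq_leq_size (S_uniq k.+1) (@S_bound k.+1).
rewrite /= size_cat !size_map leqNgt => /negP; apply.
by apply: leq_trans (H2 _ (leqnn _)); rewrite /k; lia.
Qed.

Lemma comp_self : v \in Defs.comp G v.
Proof.
rewrite /Defs.comp; elim: (_ + _)%N => [|t IH]; first by rewrite /= inE.
by apply/mem_grow; left.
Qed.

Lemma comp_sound (h : int -> bool) : (forall a, a \in A -> h a.1.1 = h a.1.2) ->
  forall u, u \in Defs.comp G v -> h u = h v.
Proof.
move=> ha; rewrite /Defs.comp; elim: (_ + _)%N => [|t IH] u; first by rewrite inE => /eqP ->.
move/mem_grow => [/IH //|[y /IH <- /mem_nbrs[a aA [[<- <-]|[<- <-]]]]] //; last exact: ha.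
by rewrite ha.
Qed.

End Comp.

(** The condition at [u <= 0] expresses that a component whose leftmost node is positive contains no
    other nodes. *)
Definition node_solution (G : graph) (h : int -> bool) :=
  [/\ (forall a, a \in G.2 -> h a.1.1 = h a.1.2),
      (forall a, a \in G.2 -> ~~ a.2 -> h a.1.1 = false) &
      forall u, u <= 0 -> h u = false].

Lemma independentP n G j : independent n G j <->
  [/\ j \in G.1, 0 < j, j <= n%:Z &
    exists2 h, node_solution G h & h j /\ forall u, u < j -> h u = false].
Proof.
split=> [/and5P[jG j0 jn /allP hl /allP hb]|[jG j0 jn [h [h1 h2 h3] [hj hu]]]].
  split=> //; exists (fun u => u \in Defs.comp G j).
    split.
    - move=> a aA; apply/idP/idP => ca; apply: (comp_closed ca); apply/mem_nbrs.
        by exists a => //; left.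
      by exists a => //; right.
    - move=> a aA na; apply/negP => ca; have := hb a aA; by rewrite ca (negbTE na).
    - by move=> u u0; apply/negP => /hl; lia.
  split; first exact: comp_self.
  by move=> u uj; apply/negP => /hl; lia.
have hc u : u \in Defs.comp G j -> h u by move=> /(comp_sound h1) ->.
apply/and5P; split=> //; apply/allP.
  by move=> u /hc hu'; rewrite leNgt; apply/negP => /hu; rewrite hu'.
move=> a aA; apply/implyP => /hc ha; apply: contraT => na.
by rewrite (h2 a aA na) in ha.
Qed.

(** * Arcs of the dependence graph *)

Section Arcs.
Variables (n k : nat) (ii : seq nat).
Local Notation m := (n - k)%N.
Local Notation N := (m + n)%N.
Local Notation prv := (iprev ii).
Local Notation typ := (ityp ii).
Local Notation dblpos := (double_first n k ii).
Hypothesis hv : valid_type n ii.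
Hypothesis h12 : forall l, (l < size ii)%N -> typ l = (prv l).+1 \/ typ l = (prv l).+2.

(* [gap_node g] is the node of the gap g, i.e. the gap to the left of position g *)
Definition gap_node (g : nat) : int := g%:Z - m%:Z.

Lemma gap_node_inj : injective gap_node.
Proof. by move=> a b; rewrite /gap_node => h; lia. Qed.

Section One.
Variable w : seq (bool * bool).
Hypothesis hw : row_strict n k ii w.
Local Notation lab := (labw n k ii w).
Local Notation cup := (matched lab).
Local Notation stk := (bstack lab).
Local Notation M := (N + k)%N.

(** The label in the original sense, with [None] at both points of a double entry, in contrast to
    [labw]. *)
Definition lab0 (P : nat) : option bool :=
  if (P < m)%N then Some true else if (P < N)%N then weight ii w (P - m).+1 else Some false.

Lemma ext_seqE : ext_seq n k ii w = [seq (gap_node P.+1, lab0 P) | P <- iota 0 M].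
Proof.
rewrite /ext_seq !iotaD !map_cat !add0n -catA; congr (_ ++ (_ ++ _)).
- apply/eq_in_map => P; rewrite mem_iota add0n => /andP[_ Pm].
  by rewrite /lab0 Pm /gap_node; congr pair; lia.
- have -> : iota m n = [seq (m + p)%N | p <- iota 0 n] by rewrite -iotaDl addn0.
  have -> : iota 1 n = [seq (1 + p)%N | p <- iota 0 n] by rewrite -iotaDl addn0.
  rewrite -!map_comp.
  apply/eq_in_map => p; rewrite mem_iota add0n /= => pn.
  rewrite /lab0 ltnNge leq_addr ltn_add2l pn addKn /gap_node add1n; congr pair; lia.
- have -> : iota N k = [seq (N + p)%N | p <- iota 0 k] by rewrite -iotaDl addn0.
  rewrite -map_comp.
  apply/eq_in_map => p; rewrite mem_iota add0n /= => pn.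
  rewrite /lab0; have -> : (N + p < m)%N = false by lia.
  have -> : (N + p < N)%N = false by lia.
  by rewrite /gap_node; congr pair; lia.
Qed.

Lemma lab0_some P b : lab0 P = Some b ->
  [/\ lab P = b, ~~ dblpos P & b = false -> ~~ second_of dblpos P].
Proof.
rewrite /lab0 /labw; case: (ltnP P m) => Pm.
  move=> [<-]; split=> //; by rewrite /double_first leqNgt Pm.
case: (ltnP P N) => PN; last first.
  move=> [<-]; split=> //; first by rewrite /double_first [(P < N)%N]ltnNge PN andbF.
  move=> _; case: P Pm PN => //= P _ PN; apply/negP => /(double_firstP hv h12)[l hl [E1 E2]].
  by have := typ_le hv hl; lia.
move=> E; rewrite E; split=> //.
  rewrite /double_first Pm PN /= negbK -index_mem.
  by move: E; rewrite /weight; case: ifP.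
move=> _; case: P Pm PN E => //= P Pm PN E; apply/negP => /(double_firstP hv h12)[l hl [E1 E2]].
have Ep : ((P.+1 - m).+1 = typ l)%N by lia.
move: E; rewrite Ep /weight (index_typ hv) // hl.
have [[E' _]|[_ ->]] := row_strict_cases hv hw hl => //.
by rewrite E2 in E'; lia.
Qed.

Lemma lab0_none P : lab0 P = None -> ~~ second_of dblpos P ->
  [/\ dblpos P, lab0 P.+1 = None & (P.+1 < N)%N].
Proof.
rewrite {1}/lab0; case: (ltnP P m) => // Pm; case: (ltnP P N) => // PN.
have [l hl [E1|[E1 E2]]] := pos_cases hv h12 Pm PN; last first.
  by rewrite E1 addnS /= double_first_prv // E2 eqxx.
move=> E _; have Ed : typ l = (prv l).+2.
  have [Es|//] := h12 hl; move: E.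
  have -> : ((P - m).+1 = typ l)%N by lia.
  rewrite /weight (index_typ hv) // hl; have [[_ ->]|[E' _]] := row_strict_cases hv hw hl.
    by case: (_.2).
  by rewrite Es in E'; lia.
have tl := typ_le hv hl; have P1 : (P.+1 < N)%N by lia.
split=> //; first by rewrite E1 double_first_prv // Ed.
rewrite /lab0 P1 ltnNge (leqW Pm) /=.
have -> : ((P.+1 - m).+1 = typ l)%N by lia.
rewrite /weight (index_typ hv) // hl; have [[E' _]|[_ ->]] := row_strict_cases hv hw hl => //.
by rewrite Ed in E'; lia.
Qed.

(** At a position that is not inside a double both procedures have the same stack up to renaming.
    Across a double, [match_aux] skips two crosses while [bstack] pushes and pops once. So the cups
    differ only by that of the double itself, and the induction advances by two there. *)
Lemma match_auxP r P (c : int * int) : (P + r = M)%N -> ~~ second_of dblpos P ->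
  c \in match_aux [seq (gap_node q.+1, lab0 q) | q <- iota P r] [seq gap_node q.+1 | q <- stk P] <->
  exists i j, [/\ (P <= j < M)%N, cup i j, ~~ second_of dblpos j & c = (gap_node i.+1, gap_node j.+1)].
Proof.
elim/ltn_ind: r P c => -[_|r IH] P c.
  rewrite addn0 => -> _; split=> // -[i [j [h _ _ _]]].
  by case/andP: h => h1; rewrite ltnNge h1.
move=> EM nd2 /=; case E: (lab0 P) => [[]|].
- have [lP dP _] := lab0_some E.
  have := IH r (ltnSn r) P.+1 c; rewrite /= lP; rewrite addSn -addnS => /(_ EM dP) H.
  rewrite H; split=> -[i [j [/andP[h1 h2] cij d e]]]; exists i, j; split=> //.
    by rewrite (ltnW h1).
  rewrite h2 andbT ltn_neqAle h1 andbT; apply/eqP => Ej.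
  by have [_ _ lj _ _] := matchedP cij; rewrite -Ej lP in lj.
- have [lP dP _] := lab0_some E.
  have := IH r (ltnSn r) P.+1 c; rewrite /= lP; rewrite addSn -addnS => /(_ EM dP) H.
  case Es: (stk P) H => [|q st] /= H.
    rewrite H; split=> -[i [j [/andP[h1 h2] cij d e]]]; exists i, j; split=> //.
      by rewrite (ltnW h1).
    rewrite h2 andbT ltn_neqAle h1 andbT; apply/eqP => Ej.
    by have [_ _ _] := matchedP cij; rewrite -Ej Es.
  have cqP : cup q P by rewrite /matched lP Es /=.
  rewrite inE; split.
    case/orP => [/eqP ->|/H[i [j [/andP[h1 h2] cij d e]]]].
      by exists q, P; split=> //; rewrite leqnn /=; lia.
    by exists i, j; split=> //; rewrite (ltnW h1).
  move=> [i [j [/andP[h1 h2] cij d e]]]; apply/orP.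
  move: h1; rewrite leq_eqVlt => /orP[/eqP Ej|h1]; [left|right].
    by rewrite -Ej in cij e; rewrite e (matched_injl cij cqP).
  by apply/H; exists i, j; split=> //; rewrite h1.
have [dP E1 P1] := lab0_none E nd2; have [lP lP1] := double_first_lab hv h12 hw dP.
case: r IH EM => [|r] IH EM; first by lia.
have d3 : ~~ second_of dblpos P.+2.
  by apply/negP => /(double_first_lab hv h12 hw)[h _]; rewrite h in lP1.
have := IH r (ltnW (ltnSn _)) P.+2 c; rewrite /= lP (negbTE lP1) /=.
have -> : (P.+2 + r = P + r.+2)%N by lia.
move=> /(_ EM d3) H; rewrite E1 H; split=> -[i [j [/andP[h1 h2] cij d e]]]; exists i, j; split=> //.
  by rewrite h2 andbT; lia.
have [_ _ lj _ _] := matchedP cij.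
have jP : j != P by apply/eqP => Ej; rewrite Ej lP in lj.
have jP1 : j != P.+1 by apply/eqP => Ej; move: d; rewrite Ej /= dP.
by rewrite h2 andbT; lia.
Qed.

Lemma bstack_right r : (r <= k)%N -> size (stk (N + r)) = (k - r)%N.
Proof.
elim: r => [|r IH] rk; first by rewrite addn0 subn0; apply: size_bstack_total.
rewrite addnS /=; have -> : lab (N + r) = false.
  by rewrite /labw !ltnNge -addnA leq_addr addnA leq_addr.
by rewrite size_behead IH ?(ltnW rk) //; lia.
Qed.

(** By [bstack_right] the [k] appended wedges close exactly the [k] vees open at [N]. This is why
    the left end of a cup to an appended point is a fixed position. *)
Lemma bstack_matched_right i : i \in stk N <-> exists j, [/\ (N <= j < M)%N, (i < N)%N & cup i j].
Proof.
split=> [iN|[j [/andP[h1 h2] iN c]]].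
  have [ltiN li] := mem_bstack iN.
  have nil : stk M = [::] by apply: size0nil; rewrite bstack_right // subnn.
  have iM : (i < M)%N by apply: leq_trans ltiN (leq_addr _ _).
  have [|j jM c] := matched_exists iM li; first by rewrite nil.
  exists j; split=> //; rewrite jM andbT leqNgt; apply/negP => jN.
  by have := matched_notin c jN; rewrite iN.
apply: (bstack_subset h1) => //; have [_ _ _ -> _] := matchedP c; exact: mem_head.
Qed.

(** In terms of gaps, a cup inside the range joins the gap before its left end to the gap after its
    right end, and is black unless it starts at a prepended point. The arc of a double entry has
    this form too, being that of its own cup. The bound [m <= i] in the second kind discards cups
    between two added points. *)
Definition cup_arc (a : int * int * bool) :=
  (exists i j, [/\ (j < N)%N, cup i j & a = (gap_node i, gap_node j.+1, (m <= i)%N)]) \/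
  (exists i j, [/\ (N <= j < M)%N, (m <= i < N)%N, cup i j & a = (gap_node i.+1, gap_node j.+2, false)]).

Lemma arcP a : a \in (Dgraph n k ii w).2 <-> cup_arc a.
Proof.
have mem c : c \in match_aux (ext_seq n k ii w) [::] <->
  exists i j, [/\ (j < M)%N, cup i j, ~~ second_of dblpos j & c = (gap_node i.+1, gap_node j.+1)].
  by rewrite ext_seqE; have := @match_auxP M 0 c (add0n _) isT.
have mid P : inmid n (gap_node P.+1) = (m <= P < N)%N.
  by rewrite /inmid /gap_node; lia.
have hs : size w = size ii by case: hw.
rewrite /= mem_cat; split.
  case/orP => /mapP[c].
    rewrite mem_filter => /andP[/andP[c1 c2] /(nthP (0%N, (false, false)))[l]].
    rewrite size_zip hs minnn => hl El ->; left.
    have Ec : c = (typ l, nth (false, false) w l) by rewrite -El nth_zip.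
    have [[_ h]|[Ed _]] := row_strict_cases hv hw hl.
      by move: c1 c2; rewrite Ec /= h; case: (_.2).
    have dl : dblpos (m + prv l)%N by rewrite double_first_prv // Ed.
    exists (m + prv l)%N; exists (m + prv l)%N.+1; split.
    - by have := typ_le hv hl; lia.
    - by have := double_matched (double_first_lab hv h12 hw) dl.
    - by rewrite leq_addr Ec /= Ed /gap_node; congr (_, _, _); lia.
  rewrite mem_filter => /andP[hc /mem[i [j [jM cij d e]]]] ->.
  have [ij li lj _ _] := matchedP cij.
  have mj : (m <= j)%N by rewrite leqNgt; apply: contra lj; apply: lab_left.
  rewrite e /=; case: (ltnP j N) => jN.
    have -> : gap_node j.+1 <= n%:Z by rewrite /gap_node; lia.
    left; exists i, j; split=> //; congr (_, _, _); rewrite /gap_node; lia.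
  have -> : (gap_node j.+1 <= n%:Z) = false by rewrite /gap_node; lia.
  right; exists i, j; split=> //; first by rewrite jN.
    by move: hc; rewrite e /= !mid [(j < N)%N]ltnNge jN andbF orbF.
  by congr (_, _, _); rewrite /gap_node; lia.
case=> [[i [j [jN cij ->]]]|[i [j [/andP[jN jM] /andP[mi iN] cij ->]]]]; last first.
  apply/orP; right; apply/mapP; exists (gap_node i.+1, gap_node j.+1).
    rewrite mem_filter /= !mid mi iN /=; apply/mem; exists i, j; split=> //.
    case: j jN {jM cij} => // j jN; apply/negP => /(double_firstP hv h12)[l hl [E1 E2]].
    by have := typ_le hv hl; lia.
  rewrite /=; have -> : (gap_node j.+1 <= n%:Z) = false by rewrite /gap_node; lia.
  by congr (_, _, _); rewrite /gap_node; lia.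
have [ij li lj _ _] := matchedP cij.
have mj : (m <= j)%N by rewrite leqNgt; apply: contra lj; apply: lab_left.
apply/orP; case: (boolP (second_of dblpos j)) => dj; [left|right].
  have [Ej di] := matched_second (double_first_lab hv h12 hw) cij dj.
  have [l hl [E1 E2]] := double_firstP hv h12 di.
  have [[E' _]|[_ /andP[h1 h2]]] := row_strict_cases hv hw hl; first by rewrite E2 in E'; lia.
  apply/mapP; exists (typ l, nth (false, false) w l).
    rewrite mem_filter /= h1 h2 /=; apply/(nthP (0%N, (false, false))); exists l.
      by rewrite size_zip hs minnn.
    by rewrite nth_zip.
  by rewrite /= E2 Ej E1 leq_addr /gap_node; congr (_, _, _); lia.
apply/mapP; exists (gap_node i.+1, gap_node j.+1).
  rewrite mem_filter /= !mid mj jN orbT /=; apply/mem; exists i, j; split=> //.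
  by apply: leq_trans jN (leq_addr _ _).
rewrite /=; have -> : gap_node j.+1 <= n%:Z by rewrite /gap_node; lia.
congr (_, _, _); rewrite /gap_node; lia.
Qed.

Lemma nodeP u : 0 < u -> u <= n%:Z ->
  u \in (Dgraph n k ii w).1 = (u \in [seq p%:Z | p <- ii]).
Proof.
move=> u0 un.
rewrite (_ : (Dgraph n k ii w).1 = [seq p%:Z | p <- ii]
  ++ [seq - (j%:Z) | j <- iota 0 (Lnum n k ii w).+1]
  ++ [seq (n + 1 + j)%N%:Z | j <- iota 0 (Rnum n k ii w).+1]) // !mem_cat.
apply/orP/idP; last by left.
by case=> // /orP[] /mapP[j _ E]; exfalso; lia.
Qed.

End One.
End Arcs.

Definition fixed_pos (n k : nat) (ii : seq nat) (w w' : seq (bool * bool)) (q : nat) :=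
  [|| (q < n - k)%N, double_first n k ii q, q \in bstack (labw n k ii w) (n - k + n)%N
    | q \in bstack (labw n k ii w') (n - k + n)%N].

(** * Independent nodes and free circles *)

Section Count.
Variables (n k : nat) (ii : seq nat).
Local Notation m := (n - k)%N.
Local Notation N := (m + n)%N.
Local Notation dblpos := (double_first n k ii).
Local Notation nd := (gap_node n k).
Hypothesis hv : valid_type n ii.
Variables w w' : seq (bool * bool).
Hypothesis hw : row_strict n k ii w.
Hypothesis hw' : row_strict n k ii w'.
Local Notation lab := (labw n k ii w).
Local Notation lab' := (labw n k ii w').
Let nu : no_underflow lab N. Proof. exact: labw_no_underflow. Qed.
Let nu' : no_underflow lab' N. Proof. exact: labw_no_underflow. Qed.
Let h12 := typ12 hv hw.
Local Notation fxpos := (fixed_pos n k ii w w').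
Local Notation leading := (free_leading (N := N) lab lab' fxpos).
Local Notation dsol := (pos_solution N lab lab' fxpos).
Variable G : graph.
Hypothesis HA : forall a, a \in G.2 <-> cup_arc n k ii w a \/ cup_arc n k ii w' a.
Hypothesis HN : forall u, 0 < u -> u <= n%:Z -> u \in G.1 = (u \in [seq p%:Z | p <- ii]).

Fixpoint xorp (d : nat -> bool) (g : nat) : bool :=
  if g is g'.+1 then xorp d g' (+) d g' else false.

(** The two ends of a cup contribute equal terms, which cancel modulo 2, and the stretch between
    them contributes nothing by induction. *)
Lemma xorp_matched (d : nat -> bool) L : no_underflow L N ->
  (forall i j, (j < N)%N -> matched L i j -> d i = d j) ->
  forall i j, (j < N)%N -> matched L i j -> xorp d i = xorp d j.+1.
Proof.
move=> nuL hd; have step i j : (j < N)%N -> matched L i j ->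
    xorp d i.+1 = xorp d j -> xorp d i = xorp d j.+1.
  by move=> jN c /= <-; rewrite -(hd i j jN c) -addbA addbb addbF.
move=> i j jN c; apply: (step i j jN c).
have tr (a b c' : nat) : xorp d a = xorp d b -> xorp d b = xorp d c' -> xorp d a = xorp d c'.
  by move=> -> ->.
exact: (@bstack_ind_matched L N (fun a b => xorp d a = xorp d b) nuL (fun=> erefl) tr step i j jN c).
Qed.

Lemma xorp_btop (d : nat -> bool) L : no_underflow L N ->
  (forall i j, (j < N)%N -> matched L i j -> d i = d j) ->
  forall g, (g <= N)%N -> xorp d (btop L g) = xorp d g.
Proof.
move=> nuL hd; apply: (@bstack_ind L N (fun a b => xorp d a = xorp d b)) => //.
  by move=> a b c' -> ->.
move=> i j jN c _; exact: (xorp_matched nuL hd jN c).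
Qed.

(** Before an open vee there is a balanced stretch, with sum 0, preceded by the next open vee or by
    nothing; so the claim spreads over the open vees from left to right. It makes the green arcs to
    appended points carry the value [false]. *)
Lemma xorp_bstack (d : nat -> bool) L : no_underflow L N ->
  (forall i j, (j < N)%N -> matched L i j -> d i = d j) ->
  (forall i, i \in bstack L N -> d i = false) ->
  forall i, i \in bstack L N -> xorp d i.+1 = false.
Proof.
move=> nuL hd hs; elim/ltn_ind => i IH iS; rewrite /= hs // addbF.
have [iN _] := mem_bstack iS; rewrite -(xorp_btop nuL hd (ltnW iN)) /btop.
case E: (bstack L i) => [//|q st]; have [qi _ _] := bstack_cons E.
apply: IH => //; have [pre ->] := bstack_split iS.
by rewrite mem_cat inE E mem_head !orbT.
Qed.

Lemma xorp0 (d : nat -> bool) g : (forall i, (i < g)%N -> d i = false) -> xorp d g = false.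
Proof. by elim: g => //= g IH h; rewrite IH ?h // => i ig; apply: h; apply: ltnW. Qed.

Lemma node_of_pos_solution d : dsol d -> exists2 h, node_solution G h &
  forall g, (g <= N)%N -> h (nd g) = xorp d g.
Proof.
move=> [hd hd' hf].
have d0 i : (i < m)%N -> d i = false.
  by move=> im; apply: hf; [apply: leq_trans im (leq_addr _ _)|rewrite /fixed_pos im].
have x0 g : (g <= m)%N -> xorp d g = false.
  by move=> gm; apply: xorp0 => i ig; apply: d0; apply: leq_trans gm.
(* Outside 1..n the value is [false]: at nodes <= 0 this is the sum over prepended positions, and at
   nodes > n it agrees with the other ends of the green arcs there. *)
pose h (u : int) := if (0 < u) && (u <= n%:Z) then xorp d (m + `|u|)%N else false.
have hE g : (g <= N)%N -> h (nd g) = xorp d g.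
  move=> gN; rewrite /h /gap_node; case: ifP => hg.
    by congr xorp; lia.
  by rewrite x0 //; lia.
have ds i : i \in bstack lab N -> d i = false.
  by move=> iS; have [iN _] := mem_bstack iS; apply: hf => //; rewrite /fixed_pos iS !orbT.
have ds' i : i \in bstack lab' N -> d i = false.
  by move=> iS; have [iN _] := mem_bstack iS; apply: hf => //; rewrite /fixed_pos iS !orbT.
have H v : row_strict n k ii v -> no_underflow (labw n k ii v) N ->
    (forall i j, (j < N)%N -> matched (labw n k ii v) i j -> d i = d j) ->
    (forall i, i \in bstack (labw n k ii v) N -> d i = false) ->
    forall a, cup_arc n k ii v a -> h a.1.1 = h a.1.2 /\ (~~ a.2 -> h a.1.1 = false).
  move=> hv' nuv hdv hsv a [[i [j [jN c ->]]]|[i [j [/andP[jN jM] /andP[mi iN] c ->]]]] /=.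
    have [ij _ _ _ _] := matchedP c; have iN := ltn_trans ij jN.
    rewrite !hE //; last exact: ltnW.
    split; first exact: (xorp_matched nuv hdv jN c).
    by rewrite -ltnNge => im; apply: x0; apply: ltnW.
  have iS : i \in bstack (labw n k ii v) N.
    by apply/(bstack_matched_right hv hv'); exists j; rewrite jN.
  rewrite hE // (xorp_bstack nuv hdv hsv iS); split=> //.
  by rewrite /h /gap_node; case: ifP => // hj; exfalso; lia.
exists h => //; split.
- by move=> a /HA[] /H[].
- by move=> a /HA[] /H[].
- by move=> u u0; rewrite /h ltNge u0.
Qed.

(* The gap inside a double is not a node; it takes the value of the gap before. *)
Definition gapval (h : int -> bool) (g : nat) :=
  if second_of dblpos g then h (nd g.-1) else h (nd g).

(** The inverse of taking partial sums: a position receives the jump between its two gaps. Along a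
    cup the outer gaps agree because of the arc and the inner gaps by induction on balanced
    stretches, so the jumps at both ends agree. At an open vee both neighbouring gaps carry [false],
    by green arcs or because they are nodes <= 0. *)
Lemma pos_of_node_solution h : node_solution G h -> dsol (fun q => gapval h q (+) gapval h q.+1).
Proof.
move=> [h1 h2 h3]; set t := gapval h.
have tE g : ~~ second_of dblpos g -> t g = h (nd g) by rewrite /t /gapval => /negbTE ->.
have t0 g : (g <= m)%N -> t g = false.
  move=> gm; rewrite tE; first by apply: h3; rewrite /gap_node; lia.
  by case: g gm => // g gm /=; rewrite /double_first leqNgt gm.
have H v : row_strict n k ii v -> (forall a, cup_arc n k ii v a -> a \in G.2) ->
  [/\ (forall i j, (j < N)%N -> matched (labw n k ii v) i j -> t i (+) t i.+1 = t j (+) t j.+1) &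
     forall q, q \in bstack (labw n k ii v) N -> t q (+) t q.+1 = false].
  move=> hv' ha; have nuv : no_underflow (labw n k ii v) N by apply: labw_no_underflow.
  have tcup i j : (j < N)%N -> matched (labw n k ii v) i j -> t i = t j.+1.
    move=> jN c; have [ij li lj _ _] := matchedP c; rewrite !tE.
    - by have := h1 _ (ha (nd i, nd j.+1, (m <= i)%N) _); apply; left; exists i, j.
    - by apply/negP => /(double_first_lab hv h12 hv')[]; rewrite (negbTE lj).
    - case: i {c ij} li => //= i li; apply/negP => /(double_first_lab hv h12 hv')[_].
      by rewrite li.
  have step i j : (j < N)%N -> matched (labw n k ii v) i j -> t i.+1 = t j -> t i = t j.+1.
    by move=> jN c _; apply: tcup.
  have tr (a b c : nat) : t a = t b -> t b = t c -> t a = t c by move=> -> ->.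
  split=> [i j jN c|q].
    have E : t i.+1 = t j := @bstack_ind_matched _ N (fun a b => t a = t b) nuv (fun=> erefl) tr step i j jN c.
    by rewrite E (tcup i j jN c) addbC.
  move=> qS; have [qN lq] := mem_bstack qS.
  have tS : forall r, r \in bstack (labw n k ii v) N -> t r.+1 = false.
    move=> r rS; have [rN lr] := mem_bstack rS; case: (ltnP r m) => rm; first exact: t0.
    have [j [jM _ c]] := (bstack_matched_right hv hv' r).1 rS.
    rewrite tE.
      apply: (h2 (nd r.+1, nd j.+2, false)) => //; apply: ha; right; exists r, j.
      by rewrite rm.
    apply/negP => dr; have c' := double_matched (double_first_lab hv h12 hv') dr.
    have r1 : (r.+1 < N)%N.
      by have [l hl [E1 E2]] := double_firstP hv h12 dr; have := typ_le hv hl; lia.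
    by have := matched_notin c' r1; rewrite rS.
  rewrite tS // addbF.
  have <- : t (btop (labw n k ii v) q) = t q.
    exact: (@bstack_ind _ N (fun a b => t a = t b) nuv (fun=> erefl) tr step q (ltnW qN)).
  rewrite /btop; case E: (bstack _ q) => [|r st]; first exact: t0.
  apply: tS; have [pre ->] := bstack_split qS.
  by rewrite mem_cat inE E mem_head !orbT.
have [c1 s1] := H w hw (fun a h => (HA a).2 (or_introl h)).
have [c2 s2] := H w' hw' (fun a h => (HA a).2 (or_intror h)).
split=> // q qN /or4P[].
- by move=> qm; rewrite !t0 // ltnW.
- move=> dq; have nd2 : ~~ second_of dblpos q.
    case: q dq {qN} => //= q dq; apply/negP => /(double_first_lab hv h12 hw)[_].
    by have [-> _] := double_first_lab hv h12 hw dq.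
  by rewrite tE // /t /gapval /= dq addbb.
- exact: s1.
- exact: s2.
Qed.

(** A first true term at [q] is the same as a first true partial sum at the gap q + 1. This gap is a
    node unless [q] is the first point of a double, and there solutions are false. *)
Lemma independent_leading (q : 'I_N) : independent n G (nd q.+1) <-> leading q.
Proof.
split.
  move=> /independentP[jG j0 jn [h hs [hj hu]]]; apply/free_leadingP.
  have dS := pos_of_node_solution hs; eexists; first exact: dS.
  have ndq : ~~ dblpos q.
    move: jG; rewrite HN // => /mapP[p pi E].
    have Ep : ((q - m).+1 = p)%N by move: E j0; rewrite /gap_node; lia.
    by rewrite /double_first Ep pi !andbF.
  have lt g : (g <= q)%N -> gapval h g = false.
    by move=> gq; rewrite /gapval; case: ifP => _; apply: hu; rewrite /gap_node; lia.
  split; first by rewrite lt // /gapval /= (negbTE ndq) hj.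
  by move=> i iq; rewrite !lt // ltnW.
move=> /free_leadingP[d hd [dq d0]].
have [h hs hE] := node_of_pos_solution hd; have [_ _ hf] := hd.
have fq : ~~ fxpos q by apply/negP => /(hf _ (ltn_ord q)); rewrite dq.
move: fq; rewrite /fixed_pos !negb_or -leqNgt => /and4P[qm ndq _ _].
have qN := ltn_ord q.
apply/independentP.
have j0 : 0 < nd q.+1 by rewrite /gap_node; lia.
have jn : nd q.+1 <= n%:Z by rewrite /gap_node; lia.
split=> //.
  rewrite HN //; apply/mapP; exists (q - m).+1; last by rewrite /gap_node; lia.
  by move: ndq; rewrite /double_first qm qN /= negbK.
exists h => //; split.
  by rewrite hE //= dq xorp0.
move=> u uq; case: (lerP u 0) => u0; first by have [_ _ h3] := hs; apply: h3.
have -> : u = nd (m + `|u|)%N by rewrite /gap_node; lia.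
rewrite hE; first by apply: xorp0 => i ig; apply: d0; move: uq; rewrite /gap_node; lia.
by move: uq; rewrite /gap_node; lia.
Qed.

Lemma n_indep_leading : n_indep n G = #|leading|.
Proof.
rewrite /n_indep -size_filter cardE -(size_map (fun q : 'I_N => nd q.+1)).
apply/perm_size/uniq_perm.
- by rewrite filter_uniq ?undup_uniq.
- rewrite map_inj_uniq ?enum_uniq // => a b /gap_node_inj [E]; exact: val_inj.
move=> u; rewrite mem_filter mem_undup; apply/andP/mapP.
  move=> [hi _]; have /independentP[_ u0 un _] := hi.
  have qN : (m + `|u|.-1 < N)%N by lia.
  have Eu : u = nd (Ordinal qN).+1 by rewrite /gap_node /=; lia.
  by exists (Ordinal qN) => //; rewrite mem_enum; apply/independent_leading; rewrite -Eu.
move=> [q]; rewrite mem_enum => lq ->.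
have hi := (independent_leading q).2 lq; split=> //.
by have /independentP[] := hi.
Qed.

End Count.

(** * Products of linear factors *)

Section Steps.
Variable K : comUnitRingType.
Local Notation M2 := 'M[K]_2.
Definition vec := nat -> 'rV[K]_2.
Implicit Types (v w y : vec) (pi : nat -> M2).

Definition vshift (a : nat) v : vec := fun s => v (s + a)%N.
(* A sequence v stands for the sum of the v_s N^-(s+1), modulo polynomials in N,
   so that N drops the first term; [lstep p] is (1 - p) + N p. *)
Definition lstep (p : M2) v : vec := fun s => v s *m (1%:M - p) + v s.+1 *m p.
Fixpoint lsteps pi (p : nat) v : vec :=
  if p is p'.+1 then lstep (pi p') (lsteps pi p' v) else v.
Definition lkernel pi p v := forall s, lsteps pi p v s = 0.

Lemma vshift0 v : vshift 0 v = v.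
Proof. by apply/funext => s; rewrite /vshift addn0. Qed.

Lemma vshift_add a b v : vshift a (vshift b v) = vshift (a + b) v.
Proof. by apply/funext => s; rewrite /vshift addnA. Qed.

Lemma lstep_vshift p a v : lstep p (vshift a v) = vshift a (lstep p v).
Proof. by apply/funext => s; rewrite /lstep /vshift addSn. Qed.

Lemma lsteps_vshift pi p a v : lsteps pi p (vshift a v) = vshift a (lsteps pi p v).
Proof. by elim: p => //= p ->; rewrite lstep_vshift. Qed.

Lemma lstep_lin p (a : K) v w :
  lstep p (fun s => a *: v s + w s) = fun s => a *: lstep p v s + lstep p w s.
Proof.
apply/funext => s; rewrite /lstep !mulmxDl -!scalemxAl scalerDr.
by rewrite addrACA.
Qed.

Lemma lsteps_lin pi p (a : K) v w :
  lsteps pi p (fun s => a *: v s + w s) = fun s => a *: lsteps pi p v s + lsteps pi p w s.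
Proof. by elim: p => //= p ->; rewrite lstep_lin. Qed.

Lemma lsteps0 pi p : lsteps pi p (fun=> 0) = fun=> 0.
Proof.
elim: p => //= p ->; apply/funext => s.
by rewrite /lstep !mul0mx addr0.
Qed.

Lemma eq_lsteps pi pi' p : (forall q, (q < p)%N -> pi q = pi' q) -> lsteps pi p = lsteps pi' p.
Proof.
elim: p => //= p IH h; apply/funext => v.
by rewrite IH ?(h p) // => q qp; apply: h; rewrite ltnS ltnW.
Qed.

Lemma idem_compl (p : M2) : p *m p = p ->
  [/\ (1%:M - p) *m p = 0, p *m (1%:M - p) = 0 & (1%:M - p) *m (1%:M - p) = 1%:M - p].
Proof.
move=> pp; have qp : (1%:M - p) *m p = 0 by rewrite mulmxBl mul1mx pp subrr.
by split; rewrite // mulmxBr mulmx1 ?pp ?subrr // qp subr0.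
Qed.

(** The product (p + N (1 - p)) ((1 - p) + N p) expands to N, since p (1 - p) = 0 and both p and 1 -
    p are idempotent. *)
Lemma lstep_cup (p : M2) v : p *m p = p -> lstep (1%:M - p) (lstep p v) = vshift 1 v.
Proof.
move=> pp; apply/funext => s; rewrite /lstep /vshift addn1.
have -> : 1%:M - (1%:M - p) = p by rewrite opprB addrCA subrr addr0.
have [qp pq qq] := idem_compl pp.
rewrite !mulmxDl -!mulmxA qp pp pq qq !mulmx0 add0r addr0 -mulmxDr.
by rewrite addrC subrK mulmx1.
Qed.

Lemma lsteps_cup pi i j a v : pi i *m pi i = pi i -> pi j = 1%:M - pi i ->
  lsteps pi j v = vshift a (lsteps pi i.+1 v) -> lsteps pi j.+1 v = vshift a.+1 (lsteps pi i v).
Proof.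
move=> pp pj /= ->; rewrite pj lstep_vshift lstep_cup // vshift_add addn1 //.
Qed.

(** Multiplying v_s (1 - p) + v_(s+1) p = 0 by p leaves v_(s+1) p = 0, and then v_s = v_s p for all
    s. So the kernel of one factor consists of the constant terms in the image of p. *)
Lemma lstep_ker (p : M2) v : p *m p = p ->
  (forall s, lstep p v s = 0) <-> (forall s, v s.+1 = 0) /\ v 0%N *m p = v 0%N.
Proof.
move=> pp; split=> [h|[h0 h1] [|s]]; last first.
- by rewrite /lstep !h0 !mul0mx addr0.
- by rewrite /lstep h0 mul0mx addr0 mulmxBr mulmx1 h1 subrr.
have hp s : v s.+1 *m p = 0.
  have := congr1 (fun x => x *m p) (h s); rewrite /lstep mulmxDl mul0mx -!mulmxA.
  by rewrite mulmxBl mul1mx pp subrr mulmx0 add0r.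
have hq s : v s *m p = v s.
  have := h s; rewrite /lstep hp addr0 mulmxBr mulmx1 => /eqP.
  by rewrite subr_eq0 => /eqP.
by split=> // s; rewrite -(hq s.+1) hp.
Qed.

Lemma lkernelS pi p v : pi p *m pi p = pi p ->
  lkernel pi p.+1 v <->
  (forall s, lsteps pi p v s.+1 = 0) /\ lsteps pi p v 0%N *m pi p = lsteps pi p v 0%N.
Proof. by move=> pp; apply: lstep_ker. Qed.

Lemma lkernelW pi p v : lkernel pi p v -> lkernel pi p.+1 v.
Proof. by move=> h s; rewrite /= /lstep !h !mul0mx addr0. Qed.

Lemma lkernel_le pi p q v : (p <= q)%N -> lkernel pi p v -> lkernel pi q v.
Proof.
elim: q => [|q IH]; first by rewrite leqn0 => /eqP ->.
by rewrite leq_eqVlt => /orP[/eqP ->//|]; rewrite ltnS => pq /(IH pq) /lkernelW.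
Qed.

Lemma lkernel_vshift1 pi p v : pi p *m pi p = pi p ->
  lkernel pi p.+1 v -> lkernel pi p (vshift 1 v).
Proof.
by move=> pp /(lkernelS _ pp)[h _] s; rewrite lsteps_vshift /vshift addn1.
Qed.

(** A right inverse of [lstep], namely (1 - p) + N^-1 p; it serves to construct vectors with a
    prescribed image under a product of factors. *)
Definition rstep (p : M2) y : vec := fun s =>
  y s *m (1%:M - p) + (if s is s'.+1 then y s' *m p else 0).
Fixpoint rsteps pi (p : nat) y : vec :=
  if p is p'.+1 then rsteps pi p' (rstep (pi p') y) else y.
Definition const_vec (u : 'rV[K]_2) : vec := fun s => if s == 0%N then u else 0.

Lemma lstep_rstep (p : M2) y : p *m p = p -> lstep p (rstep p y) = y.
Proof.
move=> pp; apply/funext => s; rewrite /lstep /rstep.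
have [qp pq qq] := idem_compl pp.
case: s => [|s]; rewrite !mulmxDl ?mul0mx -!mulmxA qp pp ?pq qq !mulmx0.
  by rewrite add0r addr0 -mulmxDr subrK mulmx1.
by rewrite add0r addr0 -mulmxDr subrK mulmx1.
Qed.

Lemma lsteps_rsteps pi p y : (forall q, (q < p)%N -> pi q *m pi q = pi q) ->
  lsteps pi p (rsteps pi p y) = y.
Proof.
elim: p y => //= p IH y h; rewrite IH ?lstep_rstep ?h // => q qp.
by rewrite h // ltnS ltnW.
Qed.

End Steps.

Lemma ord2P (i : 'I_2) : i = 0 \/ i = 1.
Proof. by case: i => [[|[|//]] h]; [left|right]; apply: val_inj. Qed.

Lemma row2P (T : Type) (u v : 'rV[T]_2) : u 0 0 = v 0 0 -> u 0 1 = v 0 1 -> u = v.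
Proof. by move=> h0 h1; apply/rowP => i; case: (ord2P i) => ->. Qed.

Lemma sum2 (V : nmodType) (F : 'I_2 -> V) : \sum_(i < 2) F i = F 0 + F 1.
Proof. by rewrite !big_ord_recl big_ord0 addr0; congr (_ + F _); apply: val_inj. Qed.

(** * Rank one Hermitian projectors *)

Section Herm.
Variable K : numClosedFieldType.
Implicit Types (u v : 'rV[K]_2) (p : 'M[K]_2).

Definition nrm u : K := u 0 0 * (u 0 0)^* + u 0 1 * (u 0 1)^*.
(** Acting on row vectors from the right, this is v |-> (<v, u> / <u, u>) u, the orthogonal
    projector onto the line of u. *)
Definition herm u : 'M[K]_2 := \matrix_(a, b) ((u 0 a)^* * u 0 b / nrm u).
Definition perp u : 'rV[K]_2 := \row_a (if a == 0 then - (u 0 1)^* else (u 0 0)^*).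
Definition prj p := exists2 u, u != 0 & p = herm u.

Lemma nrm_neq0 u : u != 0 -> nrm u != 0.
Proof.
apply: contraNneq => /eqP; rewrite /nrm -!normCK.
rewrite paddr_eq0 ?exprn_ge0 // !expf_eq0 /= !normr_eq0 => /andP[/eqP h0 /eqP h1].
by apply/eqP/row2P; rewrite mxE.
Qed.

Lemma mul_herm v u :
  v *m herm u = ((v 0 0 * (u 0 0)^* + v 0 1 * (u 0 1)^*) / nrm u) *: u.
Proof.
by apply: row2P; rewrite !mxE sum2 !mxE; ring.
Qed.

Lemma mul_herm_id u : u != 0 -> u *m herm u = u.
Proof. by move=> /nrm_neq0 h; rewrite mul_herm -/(nrm u) divff // scale1r. Qed.

Lemma herm_idem u : u != 0 -> herm u *m herm u = herm u.
Proof.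
move=> /nrm_neq0 h; apply/matrixP => a b; rewrite !mxE sum2 !mxE.
rewrite /nrm in h *; field; exact: h.
Qed.

Lemma herm_scale c u : c != 0 -> herm (c *: u) = herm u.
Proof.
move=> c0; apply/matrixP => a b; rewrite !mxE.
have -> : nrm (c *: u) = (c * c^*) * nrm u by rewrite /nrm !mxE !rmorphM; ring.
have c0' : c^* != 0 by rewrite conjC_eq0.
rewrite rmorphM invfM /=; set A := (u 0 a)^*; set B := u 0 b; set t := c * c^*.
have t0 : t != 0 by rewrite mulf_neq0.
have -> : c^* * A * (c * B) = t * (A * B) by rewrite /t; ring.
have -> : t * (A * B) * (t^-1 / nrm u) = t / t * (A * B / nrm u) by ring.
by rewrite divff // mul1r.
Qed.

Lemma perp0 u : perp u 0 0 = - (u 0 1)^*. Proof. by rewrite mxE. Qed.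
Lemma perp1 u : perp u 0 1 = (u 0 0)^*. Proof. by rewrite mxE. Qed.

Lemma herm_perp u : u != 0 -> herm (perp u) = 1%:M - herm u.
Proof.
move=> /nrm_neq0 h.
have E : nrm (perp u) = nrm u by rewrite /nrm perp0 perp1 rmorphN /= !conjCK; ring.
apply/matrixP => a b; rewrite !mxE E -/(perp u).
rewrite /nrm in h *.
case: (ord2P a) => ->; case: (ord2P b) => -> /=; rewrite ?rmorphN /= ?conjCK; try (field; exact: h).
Qed.

Lemma perp_neq0 u : u != 0 -> perp u != 0.
Proof.
apply: contraNneq => /rowP h; apply/eqP/row2P.
  by have := h 1; rewrite !mxE /= => /eqP; rewrite conjC_eq0 => /eqP.
by have := h 0; rewrite !mxE /= => /eqP; rewrite oppr_eq0 conjC_eq0 => /eqP.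
Qed.

Lemma prj_idem p : prj p -> p *m p = p.
Proof. by case=> u u0 ->; apply: herm_idem. Qed.

Lemma prj_compl p : prj p -> prj (1%:M - p).
Proof. by case=> u u0 ->; exists (perp u); rewrite ?perp_neq0 // herm_perp. Qed.

(** This is the gain from Hermitian projectors: one nonzero fixed vector determines the projector,
    whereas an arbitrary idempotent would still have a free kernel. *)
Lemma prj_fix p v : prj p -> v != 0 -> v *m p = v -> p = herm v.
Proof.
case=> u u0 -> v0; rewrite mul_herm; set c := _ / _ => E.
rewrite -E herm_scale //; apply: contraNneq v0 => c0.
by rewrite -E c0 scale0r.
Qed.

Lemma prj_fix_line p v w : prj p -> v != 0 -> v *m p = v -> w *m p = w ->
  exists c, w = c *: v.
Proof.
move=> pp v0 vp; rewrite (prj_fix pp v0 vp) mul_herm => h.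
by eexists; rewrite -{1}h; reflexivity.
Qed.

Lemma prj_kill p v : prj p -> v != 0 -> v *m p = 0 -> p = 1%:M - herm v.
Proof.
move=> pp v0 vp; rewrite -(@prj_fix (1%:M - p) v) //; first by rewrite subKr.
- exact: prj_compl.
- by rewrite mulmxBr mulmx1 vp subr0.
Qed.

Lemma prj_herm u : u != 0 -> prj (herm u).
Proof. by exists u. Qed.

Lemma prj_row p : prj p -> exists a, row a p != 0.
Proof.
move=> [u u0 ->]; case: (eqVneq (u 0 0) 0) => h.
  exists 1; apply/eqP => /rowP /(_ 1); rewrite !mxE => /eqP.
  rewrite !mulf_eq0 invr_eq0 (negbTE (nrm_neq0 u0)) orbF conjC_eq0 orbb => /eqP h1.
  by case/eqP: u0; apply: row2P; rewrite mxE.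
exists 0; apply/eqP => /rowP /(_ 0); rewrite !mxE => /eqP.
by rewrite !mulf_eq0 invr_eq0 (negbTE (nrm_neq0 u0)) orbF conjC_eq0 orbb (negbTE h).
Qed.

Lemma row_prj p a : prj p -> row a p *m p = row a p.
Proof. by move=> pp; rewrite -row_mul prj_idem. Qed.

Lemma prj_neq_compl p : prj p -> p <> 1%:M - p.
Proof.
move=> pp E; have [u u0 Ep] := pp.
have : p = 0.
  have := prj_idem pp; rewrite {2}E mulmxBr mulmx1 prj_idem // subrr => <- //.
move=> p0; have := mul_herm_id u0; rewrite -Ep p0 mulmx0 => E0.
by rewrite -E0 eqxx in u0.
Qed.

Definition erow : 'rV[K]_2 := delta_mx 0 0.
Definition frow : 'rV[K]_2 := delta_mx 0 1.
Definition fproj : 'M[K]_2 := herm frow.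
Definition eproj : 'M[K]_2 := 1%:M - fproj.

Lemma er_neq0 : erow != 0.
Proof. by apply/eqP => /rowP /(_ 0); rewrite !mxE /= => /eqP; rewrite oner_eq0. Qed.
Lemma fr_neq0 : frow != 0.
Proof. by apply/eqP => /rowP /(_ 1); rewrite !mxE /= => /eqP; rewrite oner_eq0. Qed.
Lemma prj_fproj : prj fproj. Proof. exact: prj_herm fr_neq0. Qed.
Lemma prj_eproj : prj eproj. Proof. exact: prj_compl prj_fproj. Qed.

Lemma mul_fproj v : v *m fproj = v 0 1 *: frow.
Proof.
rewrite mul_herm /nrm !mxE /= rmorph1 rmorph0.
by congr (_ *: _); rewrite mulr0 mul0r !add0r mulr1 mul1r divr1.
Qed.

Lemma lstepF (v : vec K) s : lstep fproj v s = \row_a (if a == 0 then v s 0 0 else v s.+1 0 1).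
Proof.
rewrite /lstep mulmxBr mulmx1 !mul_fproj.
by apply: row2P; rewrite !mxE /= ?mulr0 ?mulr1 ?subr0 ?addr0 ?subrr ?add0r.
Qed.

(** The kernel of [b] such factors consists of the f-terms of index below [b]. For b = m these are
    the vectors added below V. *)
Lemma iter_lstepF b (v : vec K) s :
  iter b (lstep fproj) v s = \row_a (if a == 0 then v s 0 0 else v (s + b)%N 0 1).
Proof.
elim: b s => [|b IH] s /=; first by apply: row2P; rewrite !mxE ?addn0.
by rewrite lstepF; apply: row2P; rewrite !mxE !IH !mxE //= addnS addSn.
Qed.

Lemma eproj_herm : eproj = herm erow.
Proof.
apply: prj_fix prj_eproj er_neq0 _.
by rewrite mulmxBr mulmx1 mul_fproj !mxE /= scale0r subr0.
Qed.

End Herm.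

(** * Cups and complementary projectors *)

Section Cups.
Variable K : numClosedFieldType.
Variable lab : nat -> bool.
Local Notation vec := (vec K).
Local Notation Fm := (fproj K).
Implicit Types (pi : nat -> 'M[K]_2) (v : vec).
Local Notation cup := (matched lab).
Local Notation stk := (bstack lab).
Local Notation tp := (btop lab).
Local Notation tc := (wedges lab).
Local Notation bc := (vees lab).

Definition cups_ok N pi := forall i j, (j < N)%N -> cup i j -> pi j = 1%:M - pi i.
Definition prjs N pi := forall i, (i < N)%N -> prj (pi i).

(** What a balanced stretch of 2s positions between two gaps does: its factors compose to N^s, and
    it has s wedges and s vees. *)
Definition Yrel pi a b := exists s, [/\ b = (a + 2 * s)%N, tc b = (tc a + s)%N,
  bc b = (bc a + s)%N & forall v, lsteps pi b v = vshift s (lsteps pi a v)].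

Lemma Yrel_refl pi a : Yrel pi a a.
Proof. by exists 0%N; split; rewrite ?muln0 ?addn0 // => v; rewrite vshift0. Qed.

Lemma Yrel_trans pi a b c : Yrel pi a b -> Yrel pi b c -> Yrel pi a c.
Proof.
move=> [s [E1 E2 E3 Es]] [r [E4 E5 E6 Er]]; exists (s + r)%N.
split; try lia; by move=> v; rewrite Er Es vshift_add addnC.
Qed.

Lemma Yrel_cup N pi i j : prjs N pi -> cups_ok N pi -> (j < N)%N -> cup i j ->
  Yrel pi i.+1 j -> Yrel pi i j.+1.
Proof.
move=> hp hc jN c [s [Ej Et Eb Ey]]; have [ij li lj _ _] := matchedP c.
exists s.+1; split; first lia.
- by rewrite wedgesS Et wedgesS li lj /=; lia.
- by rewrite veesS Eb veesS li (negbTE lj) /=; lia.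
move=> v; apply: lsteps_cup; first by apply: prj_idem; apply: hp; apply: ltn_trans jN.
  exact: hc.
exact: Ey.
Qed.

Lemma lsteps_btop N pi : no_underflow lab N -> prjs N pi -> cups_ok N pi ->
  forall p, (p <= N)%N -> Yrel pi (tp p) p.
Proof.
move=> nu hp hc; apply: bstack_ind => //; first exact: Yrel_refl.
- exact: Yrel_trans.
- by move=> i j; apply: Yrel_cup.
Qed.

Lemma lsteps_cup_in N pi i j : no_underflow lab N -> prjs N pi -> cups_ok N pi ->
  (j <= N)%N -> cup i j -> Yrel pi i.+1 j.
Proof.
move=> nu hp hc jN c; have := lsteps_btop nu hp hc jN.
by rewrite /btop; have [_ _ _ -> _] := matchedP c.
Qed.

Lemma lsteps_cup_out N pi i j : no_underflow lab N -> prjs N pi -> cups_ok N pi ->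
  (j < N)%N -> cup i j -> Yrel pi i j.+1.
Proof.
move=> nu hp hc jN c; apply: (Yrel_cup hp) => //.
exact: (lsteps_cup_in nu hp hc (ltnW jN)).
Qed.

Lemma lsteps_allF N pi : no_underflow lab N -> prjs N pi -> cups_ok N pi ->
  forall p, (p <= N)%N -> (forall x, x \in stk p -> pi x = Fm) ->
  exists2 s, p = (2 * s + size (stk p))%N &
    forall v, lsteps pi p v = vshift s (iter (size (stk p)) (lstep Fm) v).
Proof.
move=> nu hp hc; elim/ltn_ind => p IH pN hF.
have := lsteps_btop nu hp hc pN; rewrite /btop; case E: (stk p) hF => [|q st] hF.
  by move=> [s [-> _ _ h]]; exists s; rewrite ?addn0.
have [qp lq Eq] := bstack_cons E; case=> s [Ep _ _ h].
have [|r Er hr] := IH q qp (leq_trans (ltnW qp) pN).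
  by move=> x; rewrite Eq => xs; apply: hF; rewrite inE xs orbT.
exists (s + r)%N; first by rewrite Ep {1}Er Eq /=; lia.
move=> v; rewrite h /= hr Eq hF ?mem_head // lstep_vshift vshift_add //.
Qed.

(** A balanced stretch of 2s positions is undone by N^s, since its factors compose to N^s, and each
    open vee passed on the way costs one further N by [lkernel_vshift1]. The equation records the
    total exponent. *)
Lemma lkernel_descend N pi : no_underflow lab N -> prjs N pi -> cups_ok N pi ->
  forall p i, (p <= N)%N -> i \in stk p ->
  exists2 s, (2 * s + i + size (stk i) + 2 = p + size (stk p))%N &
    forall v, lkernel pi p v -> lkernel pi i.+1 (vshift s v).
Proof.
move=> nu hp hc; elim/ltn_ind => p IH i pN.
have := lsteps_btop nu hp hc pN; rewrite /btop; case E: (stk p) => [//|q st] [s [Ep _ _ h]].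
have [qp lq Eq] := bstack_cons E; rewrite inE.
have hq v : lkernel pi p v -> lkernel pi q.+1 (vshift s v).
  by move=> hv a; rewrite lsteps_vshift -h.
case/orP => [/eqP ->|]; first by exists s => //; rewrite Eq Ep /=; lia.
rewrite -Eq => iq; have [r Er hr] := IH q qp i (leq_trans (ltnW qp) pN) iq.
exists (r + s.+1)%N; first by rewrite Ep /=; lia.
move=> v /hq hv; rewrite -vshift_add; apply: hr.
rewrite -(add1n s) -vshift_add; apply: lkernel_vshift1 hv.
by apply/prj_idem/hp; apply: leq_trans pN.
Qed.

(* Inside the flag the unmatched cups are forced by F_n = V: pushing f_n down
   by N reaches the line frow modulo the flag just below position i. *)
Lemma unmatched_fixed N pi m n k : no_underflow lab N -> prjs N pi -> cups_ok N pi ->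
  (forall i, (i < m)%N -> pi i = Fm) -> N = (m + n)%N -> n = (m + k)%N ->
  size (stk N) = k ->
  lkernel pi N (fun s => if s.+1 == n then frow K else 0) ->
  forall i, i \in stk N -> pi i = Fm.
Proof.
move=> nu hp hc hm EN En Ek hL; elim/ltn_ind => i IH iN.
have [pre Epre] := bstack_split iN; have [ltiN li] := mem_bstack iN.
have [x xs|s Ei hi] := @lsteps_allF N pi nu hp hc i (ltnW ltiN).
  apply: IH; first by have [] := mem_bstack xs.
  by rewrite Epre mem_cat inE xs !orbT.
have [r Er hr] := lkernel_descend nu hp hc (leqnn N) iN.
have /(lkernelS _ (prj_idem (hp _ ltiN)))[_] := hr _ hL.
set b := size (stk i) in Ei hi Er.
have -> : lsteps pi i (vshift r (fun s => if s.+1 == n then frow K else 0)) 0%N = frow K.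
  rewrite hi /vshift iter_lstepF; apply: row2P; rewrite !mxE /=.
    by case: ifP; rewrite mxE.
  have -> : (0 + s + b + r).+1 = n by lia.
  by rewrite eqxx mxE.
move=> h; exact: prj_fix (hp _ ltiN) (fr_neq0 K) h.
Qed.

(** With the line of f at all [k] open vees the whole product is N^m times [k] factors of f. Its
    kernel has e-indices below m and f-indices below m + k = n: this is V together with the m added
    vectors. *)
Lemma lsteps_total N pi m n k : no_underflow lab N -> prjs N pi -> cups_ok N pi ->
  (forall i, i \in stk N -> pi i = Fm) -> N = (m + n)%N -> n = (m + k)%N ->
  size (stk N) = k ->
  forall v, lsteps pi N v = vshift m (iter k (lstep Fm) v).
Proof.
move=> nu hp hc hF EN En Ek v; have [s Es ->] := @lsteps_allF N pi nu hp hc N (leqnn N) hF.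
have -> : s = m by rewrite Ek in Es; lia.
by rewrite Ek.
Qed.

(** The vector v yields at position j a nonzero u fixed by [pi j]. As N^(s+1) v is already in the
    kernel before i, the factor at i produces the same u as an element of the image of 1 - [pi i].
    So u spans the image of [pi j] and the kernel of [pi i]. *)
Lemma cup_of_vector N pi i j v s : prjs N pi -> (i < N)%N -> (j < N)%N ->
  (forall v, lsteps pi j v = vshift s (lsteps pi i.+1 v)) ->
  lkernel pi j.+1 v -> ~ lkernel pi j v -> lkernel pi i (vshift s.+1 v) -> pi j = 1%:M - pi i.
Proof.
move=> hp iN jN hY hv nv hi.
have /(lkernelS _ (prj_idem (hp _ jN)))[h0 h1] := hv.
set u := lsteps pi j v 0%N in h1.
have u0 : u != 0.
  by apply/eqP => u0; apply: nv => -[|a].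
have hu : lstep (pi i) (lsteps pi i (vshift s v)) 0%N = u.
  by rewrite /u hY -[RHS]/(vshift s (lsteps pi i.+1 v) 0%N) -lsteps_vshift.
move: hu; rewrite /lstep.
have -> : lsteps pi i (vshift s v) 1%N = 0.
  by have := hi 0%N; rewrite !lsteps_vshift /vshift add0n add1n.
rewrite mul0mx addr0 => hu.
have [qp pq qq] := idem_compl (prj_idem (hp _ iN)).
have ui : u *m pi i = 0 by rewrite -hu -mulmxA qp mulmx0.
rewrite (prj_kill (hp _ iN) u0 ui) subKr.
exact: prj_fix (hp _ jN) u0 h1.
Qed.

End Cups.

(** * Projectors in generic position *)

Section Types.
Variable K : numClosedFieldType.
Variables lab dbl : nat -> bool.
Variable N : nat.
Local Notation vec := (vec K).
Local Notation Em := (eproj K).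
Local Notation er := (erow K).
Implicit Types (pi : nat -> 'M[K]_2) (v : vec).
Local Notation cup := (matched lab).
Local Notation stk := (bstack lab).
Local Notation dbl2 := (second_of dbl).
Local Notation tc := (wedges lab).
Local Notation bc := (vees lab).

Hypothesis nu : no_underflow lab N.
Hypothesis dblP : forall q, dbl q -> lab q /\ ~~ lab q.+1.

Definition Pseries v := forall s, v s 0 1 = 0.

Lemma Pseries_vshift a v : Pseries v -> Pseries (vshift a v).
Proof. by move=> h s; apply: h. Qed.

(** Induction on the right end: the cups ending before [j] already give the shift relation between i
    + 1 and [j], so one test vector per cup is enough. The cups of doubles are covered by the
    hypothesis on [dbl]. *)
Lemma cups_ok_of_vectors pi : prjs N pi ->
  (forall q, dbl q -> (q.+1 < N)%N -> pi q.+1 = 1%:M - pi q) ->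
  (forall i j, (j < N)%N -> cup i j -> ~~ dbl2 j -> cups_ok lab j pi ->
     exists v, [/\ lkernel pi j.+1 v, ~ lkernel pi j v & lkernel pi i (vshift ((j.+1 - i)./2) v)]) ->
  cups_ok lab N pi.
Proof.
move=> hp hd h i j; elim/ltn_ind: j i => j IH i jN c.
case: (boolP (dbl2 j)) => [|nd].
  move=> dj; have [E di] := matched_second dblP c dj; rewrite E in jN *; exact: hd.
have hc : cups_ok lab j pi by move=> i' j' jj; apply: IH => //; apply: ltn_trans jN.
have [v [h1 h2 h3]] := h i j jN c nd hc.
have nuj : no_underflow lab j by move=> q qj; apply: nu; apply: ltn_trans jN.
have hpj : prjs j pi by move=> q qj; apply: hp; apply: ltn_trans jN.
have [s [Ej _ _ hY]] := lsteps_cup_in nuj hpj hc (leqnn j) c.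
have [ij _ _ _ _] := matchedP c.
apply: (cup_of_vector hp (ltn_trans ij jN) jN hY h1 h2).
by move: h3; have -> : ((j.+1 - i)./2 = s.+1)%N by rewrite Ej; lia.
Qed.

(** A criterion by jumps: outside doubles, new vectors of the class [cl] enter the kernel at wedges
    and never at vees. For a cup from i to j, a vector entering at j is moved by N before j, by the
    shift relation before i + 1, and lies before i because nothing enters at the vee i. For the
    cells, [cl] is the class of vectors of P. *)
Lemma cups_ok_of_types (cl : vec -> Prop) pi :
  (forall a v, cl v -> cl (vshift a v)) -> prjs N pi ->
  (forall q, dbl q -> (q.+1 < N)%N -> pi q.+1 = 1%:M - pi q) ->
  (forall q, (q < N)%N -> lab q -> ~~ dbl q ->
     forall v, cl v -> lkernel pi q.+1 v -> lkernel pi q v) ->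
  (forall q, (q < N)%N -> ~~ lab q -> ~~ dbl2 q ->
     exists v, [/\ cl v, lkernel pi q.+1 v & ~ lkernel pi q v]) ->
  cups_ok lab N pi.
Proof.
move=> hcl hp hd h1 h2; apply: cups_ok_of_vectors => // i j jN c nd hc.
have [ij li lj _ _] := matchedP c.
have [v [Pv v1 v2]] := h2 j jN lj nd; exists v; split => //.
have nuj : no_underflow lab j by move=> q qj; apply: nu; apply: ltn_trans jN.
have hpj : prjs j pi by move=> q qj; apply: hp; apply: ltn_trans jN.
have [s [Ej _ _ hY]] := lsteps_cup_in nuj hpj hc (leqnn j) c.
have -> : ((j.+1 - i)./2 = s.+1)%N by rewrite Ej; lia.
have iN := ltn_trans ij jN.
have ndi : ~~ dbl i.
  apply/negP => di; have E := matched_injr c (double_matched dblP di).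
  by move: nd; rewrite E /= di.
apply: h1 => //; first exact: hcl.
have hv : lkernel pi j (vshift 1 v) by apply: lkernel_vshift1 v1; apply/prj_idem/hp.
have -> : vshift s.+1 v = vshift s (vshift 1 v) by rewrite vshift_add addn1.
by move=> a; rewrite lsteps_vshift -hY; apply: hv.
Qed.

(** The line that would let a vector of P enter already at a vee: orthogonal to the line of the
    innermost open vee, or the line of e when none is open. Genericity avoids it. *)
Definition ctop pi p := if stk p is q :: _ then 1%:M - pi q else Em.
Definition generic pi q := lab q -> ~~ dbl q -> pi q <> ctop pi q.

Definition epsv (t : nat) : vec := fun s => if s == t then er else 0.

Lemma lstep_cst p (c : 'rV[K]_2) : lstep p (const_vec c) = const_vec (c *m (1%:M - p)).
Proof.
apply/funext => -[|s]; rewrite /lstep /const_vec /=.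

by rewrite  mul0mx addr0.
by rewrite !mul0mx addr0.
Qed.

Lemma prj_ctop pi p : prjs N pi -> (p <= N)%N -> prj (ctop pi p).
Proof.
move=> hp pN; rewrite /ctop; case E: (stk p) => [|q st]; first exact: prj_eproj.
have [qp _ _] := bstack_cons E; apply/prj_compl/hp; exact: leq_trans pN.
Qed.

(* The invariant: [epsv (tc p)] spans the P-part of N^-1 L_p modulo L_p, and in
   the frame at p it points in the direction orthogonal to the innermost
   unmatched position. *)
Lemma generic_top pi : prjs N pi -> cups_ok lab N pi ->
  (forall q, (q < N)%N -> generic pi q) ->
  forall p, (p <= N)%N -> ~~ dbl2 p ->
  (exists c, [/\ c != 0, lsteps pi p (epsv (tc p)) = const_vec c & c *m ctop pi p = c]) /\
  (forall v, Pseries v -> lkernel pi p v <-> (forall s, (tc p <= s)%N -> v s = 0)).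
Proof.
move=> hp hc hg; elim/ltn_ind => -[_ _ _|p IH pN nd].
  split.
    exists er; split; first exact: er_neq0.
      by apply/funext => s.
    by rewrite /ctop /= eproj_herm mul_herm_id // er_neq0.
  by move=> v Pv; split=> [h s _|h s]; [apply: h|apply: h].
case: (boolP (lab p)) => lp.
  have ndp : ~~ dbl2 p.
    by case: p lp nd {IH pN} => //= p lp _; apply/negP => /dblP[_]; rewrite lp.
  have [[c [c0 Ec cc]] hT] := IH p (ltnSn p) (ltnW pN) ndp.
  have Et : tc p.+1 = tc p by rewrite wedgesS lp addn0.
  have [qp pq qq] := idem_compl (prj_idem (hp _ pN)).
  (* Otherwise [pi p] and [ctop pi p] would both be the projector onto the line of [c]. *)
  have npi : c *m pi p <> c.
    move=> E; apply: (hg p pN lp nd).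
    by rewrite (prj_fix (hp _ pN) c0 E) -(prj_fix (prj_ctop hp (ltnW pN)) c0 cc).
  split.
    exists (c *m (1%:M - pi p)); split.
    - rewrite mulmxBr mulmx1 subr_eq0; apply/eqP => E; exact: npi.
    - by rewrite Et /= Ec lstep_cst.
    - by rewrite /ctop /= lp -mulmxA qq.
  move=> v Pv; rewrite Et; split=> [hv|/hT h]; last by apply: lkernelW; exact: h.
  have /hT h1 : lkernel pi p (vshift 1 v) by apply: lkernel_vshift1 hv; apply/prj_idem/hp.
  have hS s : (tc p < s)%N -> v s = 0.
    by case: s => // s ts; have := h1 (Pseries_vshift 1 Pv) s ts; rewrite /vshift addn1.
  set a := v (tc p) 0 0.
  (* No terms of index above [tc p] are left and those below it lie in the kernel at [p], so only
     the multiple of [epsv (tc p)] has to be excluded. *)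
  have Ev : v = fun s => a *: epsv (tc p) s + (if (s < tc p)%N then v s else 0).
    apply/funext => s; rewrite /epsv; case: (ltngtP s (tc p)) => st.
    - by rewrite scaler0 add0r.
    - by rewrite scaler0 add0r hS.
    - rewrite addr0 st; apply: row2P; rewrite !mxE /= ?mulr1 ?mulr0 //; exact: Pv.
  have hlow : lkernel pi p (fun s => if (s < tc p)%N then v s else 0).
    apply/hT => [s|s ts]; first by case: ifP; rewrite ?mxE // Pv.
    by rewrite ltnNge ts.
  have EY : lsteps pi p v = const_vec (a *: c).
    rewrite Ev lsteps_lin Ec; apply/funext => s; rewrite hlow addr0 /const_vec.
    by case: ifP; rewrite ?scaler0.
  have /(lkernelS _ (prj_idem (hp _ pN)))[_] := hv.
  rewrite EY /const_vec /= -scalemxAl => Ea.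
  have a0 : a = 0.
    apply/eqP; apply: contra_notT npi => a0; apply: (scalerI a0); exact: Ea.
  move=> s; rewrite leq_eqVlt => /orP[/eqP <-|]; last exact: hS.
  by apply: row2P; rewrite ?mxE //; apply: Pv.
have := nu pN lp; case E: (stk p) => [//|i s'] _.
have c : cup i p by rewrite /matched lp E /=.
have [ip li _ _ Ep] := matchedP c.
have ndi : ~~ dbl2 i.
  by case: i li {c ip E Ep} => //= i li; apply/negP => /dblP[_]; rewrite li.
have iN := ltn_trans ip pN.
have [s [Es Et _ hY]] := lsteps_cup_out nu hp hc pN c.
have [[d [d0 Ed dd]] hT] := IH i (ltnW ip) (ltnW iN) ndi.
split.
  exists d; split => //; last by move: dd; rewrite /ctop Ep.
  rewrite hY -lsteps_vshift -Ed; congr lsteps; apply/funext => a.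
  by rewrite /vshift /epsv Et eqn_add2r.
move=> v Pv; have H : lkernel pi p.+1 v <-> lkernel pi i (vshift s v).
  by split=> h a; have := h a; rewrite hY lsteps_vshift.
rewrite H hT; last exact: Pseries_vshift.
rewrite Et; split=> h a ta; last by apply: h; rewrite leq_add2r.
have := h (a - s)%N; rewrite /vshift subnK; last by apply: leq_trans ta; apply: leq_addl.
by apply; lia.
Qed.

(** A vee raises the bound on the f-indices by one, because N maps each kernel into the preceding
    one; a cup raises it by its number of vees, because its factors compose to that power of N. *)
Lemma bot_component pi : prjs N pi -> cups_ok lab N pi ->
  forall p, (p <= N)%N -> forall v, lkernel pi p v ->
  forall s, (bc p <= s)%N -> v s 0 1 = 0.
Proof.
move=> hp hc; elim/ltn_ind => -[_ _|p IH pN] v hv s bs.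
  by have -> : v s = 0 := hv s; rewrite mxE.
case: (boolP (lab p)) => lp.
  have h1 : lkernel pi p (vshift 1 v) by apply: lkernel_vshift1 hv; apply/prj_idem/hp.
  case: s bs => [|s]; rewrite veesS lp addn1 // ltnS => bs.
  by have := IH p (ltnSn p) (ltnW pN) _ h1 s bs; rewrite /vshift addn1.
have := nu pN lp; case E: (stk p) => [//|i s'] _.
have c : cup i p by rewrite /matched lp E /=.
have [ip li _ _ Ep] := matchedP c.
have iN := ltn_trans ip pN.
have [r [Es _ Eb hY]] := lsteps_cup_out nu hp hc pN c.
have h1 : lkernel pi i (vshift r v) by move=> a; rewrite lsteps_vshift -hY; apply: hv.
have := IH i (ltnW ip) (ltnW iN) _ h1 (s - r)%N.
rewrite /vshift subnK; last by rewrite Eb in bs; apply: leq_trans bs; apply: leq_addl.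
by apply; lia.
Qed.

End Types.

(** * Vectors as sequences *)

Section Emb.
Variable K : numClosedFieldType.
Variables (n k : nat).
Local Notation m := (n - k)%N.
Local Notation vec := (vec K).
Local Notation Fm := (fproj K).
Implicit Types (pi : nat -> 'M[K]_2) (x : vec).

Definition cmp (s : nat) : 'I_2 := if (s < m)%N then 0 else 1.

(* The coordinate of e_{s+1} (s < m) sits at index s of the first component
   and the one of f_r at index m + r - 1 of the second one: this is V
   shifted by the m added points. *)
Definition embV (v : 'rV[K]_n) : vec := fun s =>
  if insub s is Some a then v 0 a *: delta_mx 0 (cmp s) else 0.
Definition unembV x : 'rV[K]_n := \row_a x a 0 (cmp a).

Lemma embV_lin a v w : embV (a *: v + w) = fun s => a *: embV v s + embV w s.
Proof.
apply/funext => s; rewrite /embV; case: insubP => [b _ _|_]; last by rewrite scaler0 addr0.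
by rewrite !mxE scalerDl scalerA.
Qed.

Lemma embE v (a : 'I_n) : embV v a = v 0 a *: delta_mx 0 (cmp a).
Proof. by rewrite /embV valK. Qed.

Lemma embV_big v s : (n <= s)%N -> embV v s = 0.
Proof. by move=> h; rewrite /embV insubF // ltnNge h. Qed.

Lemma cmp0 s : (s < m)%N -> cmp s = 0. Proof. by rewrite /cmp => ->. Qed.
Lemma cmp1 s : (m <= s)%N -> cmp s = 1. Proof. by rewrite /cmp ltnNge => ->. Qed.

Lemma embV_off v s c : c != cmp s -> embV v s 0 c = 0.
Proof.
move=> h; rewrite /embV; case: insubP => [b _ _|_]; last by rewrite mxE.
by rewrite !mxE eqxx /= (negbTE h) mulr0.
Qed.

Lemma embV_on v (a : 'I_n) : embV v a 0 (cmp a) = v 0 a.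
Proof. by rewrite embE !mxE !eqxx mulr1. Qed.

Lemma embV_unemb x : (forall s, (m <= s)%N -> x s 0 0 = 0) ->
  (forall s, (s < m)%N -> x s 0 1 = 0) -> (forall s, (n <= s)%N -> x s 0 1 = 0) ->
  embV (unembV x) = x.
Proof.
move=> h0 h1 h2; apply/funext => s; case: (ltnP s n) => sn; last first.
  rewrite embV_big //; apply: row2P; rewrite mxE ?h2 // h0 //.
  exact: leq_trans (leq_subr _ _) sn.
have -> : s = Ordinal sn by [].
rewrite embE mxE; set a := Ordinal sn; case: (ltnP a m) => am.
  by rewrite cmp0 //; apply: row2P; rewrite !mxE /= ?mulr1 ?mulr0 ?h1.
by rewrite cmp1 //; apply: row2P; rewrite !mxE /= ?mulr1 ?mulr0 ?h0.
Qed.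

Lemma embV0 : embV 0 = fun=> 0.
Proof. by apply/funext => s; rewrite /embV; case: insubP => // a _ _; rewrite mxE scale0r. Qed.

Lemma lsteps_left pi (b : nat) x : (forall i, (i < b)%N -> pi i = Fm) ->
  lsteps pi b x = iter b (lstep Fm) x.
Proof. by elim: b => //= b IH h; rewrite IH ?h // => i ib; apply: h; apply: ltnW. Qed.

(** The [m] prepended factors forget the f-terms of index below [m]. *)
Lemma eq_lsteps_mod pi x x' P : (forall i, (i < m)%N -> pi i = Fm) ->
  (forall s, x s 0 0 = x' s 0 0) -> (forall s, (m <= s)%N -> x s 0 1 = x' s 0 1) ->
  (m <= P)%N -> lsteps pi P x = lsteps pi P x'.
Proof.
move=> hF h0 h1 /subnKC <-; elim: (P - m)%N => [|d IH]; last by rewrite addnS /= IH.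
rewrite addn0 !lsteps_left //; apply/funext => s; rewrite !iter_lstepF.
by apply: row2P; rewrite !mxE //= h1 // leq_addl.
Qed.

Lemma lkernel_left pi v : (forall i, (i < m)%N -> pi i = Fm) ->
  lkernel pi m (embV v) <-> v = 0.
Proof.
move=> hF; split=> [h|-> s]; last by rewrite embV0 lsteps0.
apply/rowP => a; rewrite mxE -embV_on; case: (ltnP a m) => am.
  by have := h a; rewrite lsteps_left // iter_lstepF cmp0 // => /rowP /(_ 0); rewrite !mxE.
have := h (a - m)%N; rewrite lsteps_left // iter_lstepF cmp1 // => /rowP /(_ 1).
by rewrite !mxE /= subnK.
Qed.

Definition lsteps_coef pi p s (v : 'rV[K]_n) : 'rV[K]_2 := lsteps pi p (embV v) s.
Lemma lsteps_coef_lin pi p s : linear (lsteps_coef pi p s).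
Proof. by move=> a v w; rewrite /lsteps_coef embV_lin lsteps_lin. Qed.
HB.instance Definition _ pi p s :=
  GRing.isLinear.Build K 'rV[K]_n 'rV[K]_2 *:%R (lsteps_coef pi p s) (lsteps_coef_lin pi p s).

Lemma lkernel_span pi P q (A : 'M[K]_(q, n)) v : (forall a, lkernel pi P (embV (row a A))) ->
  (v <= A)%MS -> lkernel pi P (embV v).
Proof.
move=> h /submxP[D ->] s; rewrite -/(lsteps_coef pi P s _) mulmx_sum_row linear_sum big1 // => a _.
by rewrite linearZ /= /lsteps_coef h scaler0.
Qed.

End Emb.

(** * A basis of V adapted to a sequence of projectors *)

Section Basis.
Variable K : numClosedFieldType.
Variables (n k : nat).
Local Notation m := (n - k)%N.
Local Notation N := (m + n)%N.
Local Notation Fm := (fproj K).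
Variable pi : nat -> 'M[K]_2.
Hypothesis hp : prjs N pi.
Hypothesis hF : forall i, (i < m)%N -> pi i = Fm.
Hypothesis hT : forall v, lsteps pi N v = vshift m (iter k (lstep Fm) v).
Hypothesis kn : (k <= n)%N.
Variable ch : nat -> 'I_2.
Hypothesis hch : forall a, (a < n)%N -> row (ch a) (pi (m + a)) != 0.

(** A vector in the kernel after position m + a but not before: a nonzero row of [pi (m + a)],
    selected by [ch a], is lifted through all earlier factors. *)
Definition bvec (a : nat) : vec K := rsteps pi (m + a) (const_vec (row (ch a) (pi (m + a)))).
Definition Bmx : 'M[K]_n := \matrix_(a, b) bvec a b 0 (cmp n k b).

Lemma lsteps_bvec a : (a < n)%N -> lsteps pi (m + a) (bvec a) = const_vec (row (ch a) (pi (m + a))).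
Proof.
move=> an; apply: lsteps_rsteps => q qa; apply/prj_idem/hp.
by apply: ltn_trans qa _; rewrite ltn_add2l.
Qed.

Lemma lkernel_bvec a : (a < n)%N -> lkernel pi (m + a).+1 (bvec a).
Proof.
move=> an; have h : (m + a < N)%N by rewrite ltn_add2l.
apply/lkernelS; first exact/prj_idem/hp.
by rewrite lsteps_bvec //; split => //; rewrite /const_vec /= row_prj //; apply: hp.
Qed.

Lemma rsteps_left b y : (forall i, (i < b)%N -> pi i = Fm) ->
  forall s, (s < b)%N -> rsteps pi b y s 0 1 = 0.
Proof.
elim: b y => // b IH y h s; rewrite ltnS /= leq_eqVlt => /orP[/eqP E|]; last first.
  by apply: IH => i ib; apply: h; apply: ltnW.
rewrite h //.
have hb c z : (forall i, (i < c)%N -> pi i = Fm) -> rsteps pi c z c 0 1 = z 0%N 0 1.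
  elim: c z => //= c IHc z hc; rewrite hc // .
  have hc' i : (i < c)%N -> pi i = Fm by move=> ic; apply: hc; apply: ltnW.
  have gen : forall y t, (rsteps pi c y (t + c)%N) 0 1 = y t 0 1.
    elim: (c) hc' => [|d IHd] hd y' t /=; first by rewrite addn0.
    rewrite addnS -addSn IHd; last by move=> i id; apply: hd; apply: ltnW.
    rewrite hd // /rstep mxE mulmxBr mulmx1 !mul_fproj !mxE /= mulr1 subrr add0r.
    by rewrite mulr1.
  have := gen (rstep Fm z) 1%N; rewrite add1n => ->.
  by rewrite /rstep mxE mulmxBr mulmx1 !mul_fproj !mxE /= mulr1 subrr add0r mulr1.
rewrite -E in h *; rewrite E hb; last by move=> i ib; apply: h; rewrite E ltnW.
by rewrite /rstep mxE mulmxBr mulmx1 !mul_fproj !mxE /= mulr1 subrr add0r.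
Qed.

Lemma rsteps_add a b y : exists z, rsteps pi (a + b) y = rsteps pi a z.
Proof.
elim: b y => [|b IH] y; first by exists y; rewrite addn0.
by rewrite addnS /=; apply: IH.
Qed.

(** The lifted vectors lie in V: the total product [hT] bounds their indices from above, and
    [rsteps_left] shows that they have no term at the added indices. *)
Lemma embV_row_Bmx (a : 'I_n) : embV k (row a Bmx) = bvec a.
Proof.
have -> : row a Bmx = unembV n k (bvec a) by apply/rowP => b; rewrite !mxE.
have hL : lkernel pi N (bvec a).
  by apply: lkernel_le (lkernel_bvec (ltn_ord a)); rewrite -addnS leq_add2l.
apply: embV_unemb => s sm.
- have := hL (s - m)%N; rewrite hT /vshift subnK // iter_lstepF => /rowP /(_ 0).
  by rewrite !mxE.
- by rewrite /bvec; have [z ->] := rsteps_add m a (const_vec (row (ch a) (pi (m + a)))); apply: rsteps_left.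
- have := hL (s - m - k)%N; rewrite hT /vshift iter_lstepF => /rowP /(_ 1).
  by rewrite !mxE /=; have -> : (s - m - k + m + k = s)%N by lia.
Qed.

Lemma row_pid r (a : 'I_n) : row a ((pid_mx r : 'M[K]_n) *m Bmx) = if (a < r)%N then row a Bmx else 0.
Proof.
rewrite row_mul; have -> : row a (pid_mx r : 'M[K]_n) = (a < r)%:R *: delta_mx 0 a.
  by apply/rowP => b; rewrite !mxE eqxx /= -val_eqE /= [(b : nat) == a]eq_sym; case: (_ == _); rewrite ?mulr1 ?mulr0.
by rewrite -scalemxAl -rowE; case: ifP; rewrite ?scale1r ?scale0r.
Qed.

(** Triangularity: the leading coefficient after m + a factors kills the rows before [a] and not row
    [a] itself, so the coefficients of a linear relation vanish one by one, starting from the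
    last. *)
Lemma Bmx_free : row_free Bmx.
Proof.
apply/row_freeP; suff: (Bmx \in unitmx) by exists (invmx Bmx); apply: mulmxV.
rewrite -row_free_unit -kermx_eq0; apply/eqP/row_matrixP => i; rewrite row0.
set c := row i (kermx Bmx).
have hc : c *m Bmx = 0 by rewrite /c -row_mul mulmx_ker row0.
suff H : forall d (a : 'I_n), (n - a <= d)%N -> c 0 a = 0.
  by apply/rowP => a; rewrite [RHS]mxE; apply: (H n); rewrite leq_subr.
elim=> [|d IH] a ha; first by have := ltn_ord a; lia.
have := congr1 (lsteps_coef k pi (m + a) 0%N) hc.
rewrite linear0 mulmx_sum_row linear_sum (bigD1 a) //= big1 => [|b ba].
  rewrite addr0 linearZ /= /lsteps_coef embV_row_Bmx lsteps_bvec // /const_vec /= => /eqP.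
  by rewrite scaler_eq0 (negbTE (hch (ltn_ord a))) orbF => /eqP.
case: (ltngtP b a) => ab; last by rewrite (val_inj ab) eqxx in ba.
  rewrite linearZ /= /lsteps_coef embV_row_Bmx [lsteps _ _ _ _](_ : _ = 0) ?scaler0 //.
  by apply: lkernel_le (lkernel_bvec (ltn_ord b)) _; rewrite -addnS leq_add2l.
rewrite IH ?scale0r ?linear0 //; have := ltn_ord a; have := ltn_ord b; lia.
Qed.

Lemma rank_pid r : (r <= n)%N -> \rank ((pid_mx r : 'M[K]_n) *m Bmx) = r.
Proof. by move=> rn; rewrite mxrankMfree ?Bmx_free // rank_pid_mx. Qed.

(** For the converse, the kernel at m + r + 1 exceeds the one at m + r by at most the line of
    [pi (m + r)], and row [r] already covers this line. *)
Lemma sub_pid r v : (r <= n)%N ->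
  (v <= (pid_mx r : 'M[K]_n) *m Bmx)%MS <-> lkernel pi (m + r) (embV k v).
Proof.
move=> rn; split.
  apply: lkernel_span => a; rewrite row_pid; case: ifP => ar.
    by rewrite embV_row_Bmx; apply: lkernel_le (lkernel_bvec (ltn_ord a)); rewrite -addnS leq_add2l.
  by rewrite embV0 => s; rewrite lsteps0.
elim: r rn v => [|r IH] rn v.
  by rewrite addn0 => /(lkernel_left _ hF) ->; rewrite sub0mx.
rewrite addnS => hv; have rN : (m + r < N)%N by rewrite ltn_add2l.
have /(lkernelS _ (prj_idem (hp rN)))[h0 h1] := hv.
pose a := Ordinal rn.
have [c Ec] := prj_fix_line (hp rN) (hch rn) (row_prj (ch r) (hp rN)) h1.
have hw : lkernel pi (m + r) (embV k (v + (- c) *: row a Bmx)).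
  move=> s; rewrite addrC embV_lin lsteps_lin embV_row_Bmx lsteps_bvec //.
  case: s => [|s]; first by rewrite Ec /const_vec /= scaleNr addNr.
  by rewrite h0 /const_vec /= scaler0 addr0.
have ra : (row a Bmx <= (pid_mx r.+1 : 'M[K]_n) *m Bmx)%MS.
  have := row_sub a ((pid_mx r.+1 : 'M[K]_n) *m Bmx); by rewrite row_pid /= ltnSn.
have -> : v = (v + (- c) *: row a Bmx) + c *: row a Bmx by rewrite scaleNr subrK.
apply: addmx_sub; last exact: scalemx_sub.
apply: submx_trans (IH (ltnW rn) _ hw) _; apply/row_subP => b.
rewrite row_pid; case: ifP => br; last exact: sub0mx.
have := row_sub b ((pid_mx r.+1 : 'M[K]_n) *m Bmx); by rewrite row_pid ltnS ltnW.
Qed.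

End Basis.

(** * Flags and sequences of projectors *)

Section Flags.
Variable R : realType.
Local Notation K := (R[i]).
Variables (n k : nat) (ii : seq nat).
Local Notation m := (n - k)%N.
Local Notation N := (m + n)%N.
Local Notation Fm := (fproj K).
Local Notation prv := (iprev ii).
Local Notation typ := (ityp ii).
Local Notation dblpos := (double_first n k ii).
Local Notation emb := (@embV K n k).
Implicit Types (pi : nat -> 'M[K]_2) (F : flagsp R n ii).

Hypothesis hv : valid_type n ii.
Hypothesis h12 : forall l, (l < size ii)%N -> typ l = (prv l).+1 \/ typ l = (prv l).+2.

Definition flag_rep F pi := forall (l : 'I_(size ii)) v,
  (v <= F l)%MS <-> lkernel pi (m + typ l) (emb v).
(** At a double, any complementary pair of projectors describes the step from F_(l-1) to its
    preimage under N; fixing the line of f removes this freedom. *)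
Definition normalized pi := [/\ prjs N pi, (forall i, (i < m)%N -> pi i = Fm) &
  forall q, dblpos q -> pi q = Fm /\ pi q.+1 = 1%:M - Fm].

(** On V, the map N differs from the shift only in that it sends f_1 to 0 instead of an added
    vector, and the prepended factors do not see the difference. *)
Lemma lsteps_embV_N pi P v : (forall i, (i < m)%N -> pi i = Fm) -> (m <= P)%N ->
  lsteps pi P (emb (v *m Nmx R n k)) = lsteps pi P (vshift 1 (emb v)).
Proof.
move=> hF mP.
have E : (v *m Nmx R n k : 'rV_n) = \row_b (if insub b.+1 is Some a then
     (if (a : 'I_n) == m :> nat then 0 else v 0 a) else 0).
  apply/rowP => b; rewrite !mxE; case: insubP => [a _ Ea|hb].
    rewrite (bigD1 a) //= big1 => [|c ca]; rewrite !mxE ?Ea ?eqxx /=.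
      by rewrite addr0; case: eqP => _; rewrite ?mulr0 ?mulr1.
    rewrite -Ea; have -> : ((c : nat) == a) = false by apply/negP => /eqP /val_inj h; rewrite h eqxx in ca.
    by rewrite mulr0.
  rewrite big1 // => c _; rewrite !mxE; case: eqP => [h|_]; last by rewrite mulr0.
  by move: hb; rewrite -h ltn_ord.
rewrite E.
have H s : emb (\row_b (if insub b.+1 is Some a then
     (if (a : 'I_n) == m :> nat then 0 else v 0 a) else 0)) s =
     if s.+1 == m then 0 else (if insub s.+1 is Some a then v 0 (a : 'I_n) else 0) *: delta_mx 0 (cmp n k s).
  rewrite /embV; case: insubP => [b _ Eb|hb].
    rewrite mxE Eb; case: insubP => [a _ Ea|]; rewrite ?scale0r ?if_same //.
    by rewrite Ea; case: ifP; rewrite ?scale0r.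
  case: insubP => [a ha Ea|_]; last by rewrite scale0r if_same.
  by move: hb; rewrite (ltn_trans (ltnSn s) ha).
have H' s : vshift 1 (emb v) s = (if insub s.+1 is Some a then v 0 (a : 'I_n) else 0) *: delta_mx 0 (cmp n k s.+1).
  rewrite /vshift /embV addn1; case: insubP => [a _ Ea|_]; rewrite ?scale0r //.
have D s : (s.+1 != m)%N -> cmp n k s.+1 = cmp n k s.
  by rewrite /cmp => h; have -> : (s.+1 < m)%N = (s < m)%N by lia.
apply: (eq_lsteps_mod hF) => // s; last first.
  by move=> ms; rewrite H H' D ?ifN //; lia.
rewrite H H'; case: eqP => h; last by rewrite D //; apply/eqP.
by rewrite mxE cmp1 ?h // !mxE /= mulr0.
Qed.

Lemma prev_space F pi (l : 'I_(size ii)) :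
  (forall i, (i < m)%N -> pi i = Fm) ->
  (forall l' : 'I_(size ii), (l' < l)%N -> \rank (F l') = typ l') ->
  (forall (l' : 'I_(size ii)) v, (l' < l)%N -> (v <= F l')%MS <-> lkernel pi (m + typ l') (emb v)) ->
  exists B : 'M[K]_n, [/\ \rank B = prv l,
    (forall v, (v <= B)%MS <-> lkernel pi (m + prv l) (emb v)) &
    (l = 0%N :> nat /\ B = 0) \/ (exists l' : 'I_(size ii), l = l'.+1 :> nat /\ B = F l')].
Proof.
case: l => -[|l] hl hF hr hrep.
  exists 0; split; [by rewrite mxrank0| | by left].
  move=> v /=; rewrite addn0 lkernel_left //; split=> [|->]; last exact: sub0mx.
  by rewrite submx0 => /eqP.
pose l' := Ordinal (ltnW hl : (l < size ii)%N).
exists (F l'); split; [exact: (hr l' (ltnSn l)) | by move=> v; apply: (hrep l' v (ltnSn l)) |].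
by right; exists l'.
Qed.

Lemma flag_rep_modify F pi pi' (l : nat) : (l < size ii)%N ->
  (forall q, (q < m + prv l)%N -> pi q = pi' q) ->
  (forall (l' : 'I_(size ii)) v, (l' < l)%N -> (v <= F l')%MS <-> lkernel pi (m + typ l') (emb v)) ->
  (forall (l' : 'I_(size ii)) v, (l' < l)%N -> (v <= F l')%MS <-> lkernel pi' (m + typ l') (emb v)).
Proof.
move=> hl hq h l' v l'l; rewrite h // /lkernel (@eq_lsteps _ pi pi') // => q qq; apply: hq.
apply: leq_trans qq _; rewrite leq_add2l; case: l hl l'l {h} => // l hl.
rewrite ltnS leq_eqVlt => /orP[/eqP -> //|h]; exact: ltnW (typ_lt hv h (ltnW hl)).
Qed.

(** Since N F_l lies in F_(l-1), the leading coefficient after the factors of F_(l-1) embeds F_l /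
    F_(l-1) into the plane. A one-dimensional image is the line of the new projector; a
    two-dimensional image is the whole plane, which is what the normalized pair at a double
    describes. *)
Lemma exists_flag_rep (x : {ptws Ix n ii -> R}) : springer_lift k x ->
  exists pi, normalized pi /\ flag_rep (flagof x) pi.
Proof.
move=> [xl xN0 xN]; set F := flagof x.
have FE l v : (v <= F l)%MS = (v <= cmat x l)%MS by rewrite ffunE genmxE.
have Fr l : \rank (F l) = typ l by rewrite ffunE mxrank_gen; case: (xl l).
suff H L : (L <= size ii)%N -> exists pi, normalized pi /\
    forall (l : 'I_(size ii)) v, (l < L)%N -> (v <= F l)%MS <-> lkernel pi (m + typ l) (emb v).
  have [pi [g h]] := H _ (leqnn _); exists pi; split => // l v; exact: h.
elim: L => [_|L IH hL].
  (* With no space to represent yet, the sequence only has to be normalized. *)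
  exists (fun q => if second_of dblpos q then 1%:M - Fm else Fm); split => //; split.
  - by move=> q _; case: ifP => _; [apply: prj_eproj|apply: prj_fproj].
  - by case=> // q qm /=; rewrite /double_first leqNgt (ltnW qm).
  move=> q hq /=; rewrite hq; split => //; case: q hq => // q hq /=.
  by case: ifP => // /(double_firstP hv h12) [l hl [E1 E2]]; move: hq; rewrite E1 -addnS double_first_prvS.
have [pi [[hp hF hd] hrep]] := IH (ltnW hL).
pose l := Ordinal hL; pose p := (m + prv L)%N.
have pN : (p < N)%N by rewrite ltn_add2l prv_le.
have [B [Br Brep Bcase]] := @prev_space F pi l hF (fun l' _ => Fr l') hrep.
have BF : (B <= F l)%MS.
  case: Bcase => [[_ ->]|[l' [E ->]]]; first exact: sub0mx.
  by rewrite !ffunE !genmxE; case: (xN l' l E).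
have FB v : (v <= F l)%MS -> (v *m Nmx R n k <= B)%MS.
  rewrite FE => hvl; apply: submx_trans (submxMr _ hvl) _.
  case: Bcase => [[E ->]|[l' [E ->]]]; first by rewrite (xN0 l E) sub0mx.
  by rewrite ffunE genmxE; case: (xN l' l E).
have hconst v : (v <= F l)%MS -> forall s, lsteps pi p (emb v) s.+1 = 0.
  move=> /FB /Brep h s; have := h s; rewrite /= lsteps_embV_N ?leq_addr // lsteps_vshift /vshift addn1.
  exact.
pose G : 'M[K]_(n, 2) := lin1_mx (lsteps_coef k pi p 0%N).
have GE (v : 'rV_n) : v *m G = lsteps pi p (emb v) 0%N by rewrite mul_rV_lin1.
have kerG (v : 'rV_n) : (v <= F l)%MS -> v *m G = 0 -> (v <= B)%MS.
  by move=> vF; rewrite GE => v0; apply/Brep => -[|s] //; apply: hconst.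
have rkG : (\rank (F l *m G) + prv L = typ L)%N.
  rewrite -[RHS](Fr l) -(mxrank_mul_ker (F l) G); congr (_ + _)%N.
  rewrite -[LHS]Br; apply/eqmx_rank/andP; split; last first.
    apply/row_subP => a; apply: kerG; first exact: submx_trans (row_sub _ _) (capmxSl _ _).
    by apply/sub_kermxP; exact: submx_trans (row_sub _ _) (capmxSr _ _).
  rewrite sub_capmx BF; apply/row_subP => a; apply/sub_kermxP; rewrite GE.
  by apply: ((Brep _).1 _ 0%N); apply: row_sub.
have [Es|Ed] := h12 hL; last first.
  have dp : dblpos p by rewrite double_first_prv // Ed.
  have [p1 p2] := hd _ dp.
  exists pi; split => // l' v; rewrite ltnS leq_eqVlt => /orP[/eqP E|]; last exact: hrep.
  have -> : l' = l by apply: val_inj.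
  have EY : lsteps pi (m + typ L) (emb v) = vshift 1 (lsteps pi p (emb v)).
    by rewrite Ed !addnS /= -/p p2 p1 lstep_cup //; apply/prj_idem/prj_fproj.
  split=> [/hconst h s|h].
    by rewrite EY /vshift addn1.
  have full : (v *m G <= F l *m G)%MS.
    by apply: submx_full; rewrite /row_full; apply/eqP; move: rkG; rewrite Ed; lia.
  case/submxP: full => D; rewrite mulmxA => ED.
  have DF : (D *m F l <= F l)%MS by apply: submxMl.
  rewrite -(subrK (D *m F l) v); apply: addmx_sub => //.
  apply: submx_trans BF; apply/Brep.
  rewrite -scaleN1r => -[|s].
    by rewrite -GE mulmxDl -scalemxAl ED scaleN1r subrr.
  rewrite addrC embV_lin lsteps_lin (hconst _ DF) scaler0 add0r.
  by have := h s; rewrite EY /vshift addn1.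
have rk1 : \rank (F l *m G) = 1%N by move: rkG; rewrite Es; lia.
have [a ha] : exists a, row a (F l *m G) != 0.
  apply/existsP; apply: contra_eqT rk1; rewrite negb_exists => /forallP h.
  suff -> : F l *m G = 0 by rewrite mxrank0.
  by apply/row_matrixP => a; rewrite row0; apply/eqP/negbNE/h.
set u := row a (F l *m G) in ha.
have uline (v : 'rV_n) : (v <= F l)%MS -> exists c, v *m G = c *: u.
  move=> vF; apply/sub_rVP; apply: submx_trans (submxMr G vF) _.
  have := mxrank_leqif_sup (row_sub a (F l *m G)); case=> _ <-.
  by rewrite -/u rank_rV ha rk1.
have ndp : dblpos p = false by rewrite double_first_prv // Es; lia.
have nd2 : second_of dblpos p = false by rewrite second_of_prv // ltnW.
pose pi' q := if q == p then herm u else pi q.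
have pi'p : pi' p = herm u by rewrite /pi' eqxx.
have Ypp : lsteps pi' p = lsteps pi p by apply: eq_lsteps => q qp; rewrite /pi' ltn_eqF.
exists pi'; split.
  split.
  - by move=> q qN; rewrite /pi'; case: ifP => _; [apply: prj_herm|apply: hp].
  - by move=> i im; rewrite /pi' ltn_eqF ?hF //; apply: leq_trans im (leq_addr _ _).
  - move=> q dq; have [d1 d2] := hd q dq; rewrite /pi'; split; case: eqP => // E.
      by rewrite E ndp in dq.
    by move: nd2; rewrite -E /= dq.
move=> l' v; rewrite ltnS leq_eqVlt => /orP[/eqP E|ll]; last first.
  by apply: (@flag_rep_modify F pi pi' L hL _ hrep) => // q qp; rewrite /pi' ltn_eqF.
have -> : l' = l by apply: val_inj.
rewrite /= Es addnS lkernelS ?pi'p; last exact: herm_idem.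
rewrite Ypp -/p -GE; split=> [vF|[h0 h1]].
  split; first exact: hconst.
  by have [c ->] := uline v vF; rewrite -scalemxAl mul_herm_id.
have [c Ec] := prj_fix_line (prj_herm ha) ha (mul_herm_id ha) h1.
have rF : (row a (F l) <= F l)%MS by apply: row_sub.
rewrite -(subrK (c *: row a (F l)) v); apply: addmx_sub; last exact: scalemx_sub.
apply: submx_trans BF; apply/Brep; rewrite -scaleNr => -[|s].
  by rewrite -GE mulmxDl -scalemxAl Ec /u row_mul scaleNr subrr.
by rewrite addrC embV_lin lsteps_lin h0 (hconst _ rF) scaler0 addr0.
Qed.

End Flags.

(** * Uniqueness of the projectors and flags built from them *)

Section Lifts.
Variable R : realType.
Local Notation K := (R[i]).
Variables (n k : nat) (ii : seq nat).
Local Notation m := (n - k)%N.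
Local Notation N := (m + n)%N.
Local Notation Fm := (fproj K).
Local Notation prv := (iprev ii).
Local Notation typ := (ityp ii).
Local Notation dblpos := (double_first n k ii).
Local Notation emb := (@embV K n k).
Local Notation rep := (@flag_rep R n k ii).
Local Notation goodpi := (@normalized R n k ii).
Local Notation Lift := {ptws Ix n ii -> R}.
Implicit Types (pi : nat -> 'M[K]_2) (F : flagsp R n ii) (x : Lift).

Hypothesis hv : valid_type n ii.
Hypothesis h12 : forall l, (l < size ii)%N -> typ l = (prv l).+1 \/ typ l = (prv l).+2.

Lemma sub_flagof x l (v : 'rV[K]_n) : (v <= flagof x l)%MS = (v <= cmat x l)%MS.
Proof. by rewrite ffunE genmxE. Qed.

Lemma rank_flagof x l : is_lift x -> \rank (flagof x l) = typ l.
Proof. by move=> xl; rewrite ffunE mxrank_gen; case: (xl l). Qed.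

Lemma flag_rep_inj x y pi : rep (flagof x) pi -> rep (flagof y) pi -> flagof x = flagof y.
Proof.
move=> hx hy; apply/ffunP => l; have := hx l; have := hy l.
rewrite !ffunE => h1 h2; apply/eq_genmx/eqmxP/andP; split.
  by apply/row_subP => a; rewrite -(genmxE (cmat y l)); apply/h1/h2; rewrite genmxE row_sub.
by apply/row_subP => a; rewrite -(genmxE (cmat x l)); apply/h2/h1; rewrite genmxE row_sub.
Qed.

Lemma flag_rep_nontriv x pi (l : 'I_(size ii)) : is_lift x -> (forall i, (i < m)%N -> pi i = Fm) ->
  rep (flagof x) pi -> exists a, ~ lkernel pi (m + prv l) (emb (row a (cmat x l))).
Proof.
move=> xl hF hx; apply: contrapT => h.
have {}h a : lkernel pi (m + prv l) (emb (row a (cmat x l))).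
  by apply: contrapT => ha; apply: h; exists a.
have [B [Br Brep _]] := @prev_space R n k ii (flagof x) pi l hF
  (fun l' _ => rank_flagof l' xl) (fun l' v _ => hx l' v).
have /mxrankS : (cmat x l <= B)%MS by apply/row_subP => a; apply/Brep.
by case: (xl l) => _ ->; rewrite Br leqNgt (prv_lt hv).
Qed.

Lemma normalized_prj pi (l : nat) : (l < size ii)%N -> goodpi pi -> prj (pi (m + prv l)%N).
Proof. by move=> hl [hp _ _]; apply: hp; rewrite ltn_add2l (prv_le hv). Qed.

Lemma flag_rep_const x pi (l : 'I_(size ii)) v : goodpi pi -> rep (flagof x) pi ->
  (v <= cmat x l)%MS -> forall s, lsteps pi (m + prv l) (emb v) s.+1 = 0.
Proof.
move=> g hx; rewrite -sub_flagof => /hx hL s.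
have [hp hF hd] := g.
have pp := prj_idem (normalized_prj (ltn_ord l) g).
have [E|E] := h12 (ltn_ord l); rewrite E in hL.
  by move: hL; rewrite addnS => /(lkernelS _ pp)[].
have dp : dblpos (m + prv l) by rewrite double_first_prv // E.
have [p1 p2] := hd _ dp.
by have := hL s; rewrite !addnS /= p2 p1 lstep_cup ?/vshift ?addn1 //; apply/prj_idem/prj_fproj.
Qed.

Lemma flag_rep_single x pi (l : 'I_(size ii)) v : goodpi pi -> rep (flagof x) pi ->
  typ l = (prv l).+1 -> (v <= cmat x l)%MS ->
  let b := lsteps pi (m + prv l) (emb v) 0%N in b != 0 -> pi (m + prv l)%N = herm b.
Proof.
move=> g hx E; rewrite -sub_flagof => /hx; rewrite E addnS => hL b b0.
have pp := normalized_prj (ltn_ord l) g.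
have [_ h] := (lkernelS _ (prj_idem pp)).1 hL.
exact: prj_fix pp b0 h.
Qed.

(** Once the earlier projectors agree, a row of the lift of F_l outside F_(l-1) has the same nonzero
    leading coefficient for both sequences, and this spans the line of the next projector. *)
Lemma flag_rep_uniq x pi pi' : is_lift x -> goodpi pi -> goodpi pi' ->
  rep (flagof x) pi -> rep (flagof x) pi' -> forall q, (q < N)%N -> pi q = pi' q.
Proof.
move=> xl g g' hx hx'; have [hp hF hd] := g; have [hp' hF' hd'] := g'.
elim/ltn_ind => q IH qN; case: (ltnP q m) => qm; first by rewrite hF ?hF'.
have [l hl [Eq|[Eq E2]]] := pos_cases hv h12 qm qN; last first.
  have dq : dblpos (m + prv l) by rewrite double_first_prv // E2.
  by rewrite Eq addnS; have [_ ->] := hd _ dq; have [_ ->] := hd' _ dq.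
have [E|E] := h12 hl; last first.
  have dq : dblpos (m + prv l) by rewrite double_first_prv // E.
  by rewrite Eq; have [-> _] := hd _ dq; have [-> _] := hd' _ dq.
pose lo := Ordinal hl.
have [a ha] := @flag_rep_nontriv x pi lo xl hF hx.
have rs : (row a (cmat x lo) <= cmat x lo)%MS by apply: row_sub.
have b0 : lsteps pi (m + prv l) (emb (row a (cmat x lo))) 0%N != 0.
  by apply/eqP => h; apply: ha => -[|s] //; apply: (flag_rep_const (l := lo)).
have EY : lsteps pi q = lsteps pi' q.
  by apply: eq_lsteps => q' q'q; apply: IH => //; apply: ltn_trans qN.
rewrite Eq (@flag_rep_single x pi lo _ g hx E rs b0) (@flag_rep_single x pi' lo _ g' hx' E rs) -?Eq -?EY //.
by rewrite Eq.
Qed.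

Section Build.
Variable pi : nat -> 'M[K]_2.
Hypothesis g : goodpi pi.
Hypothesis hT : forall v, lsteps pi N v = vshift m (iter k (lstep Fm) v).
Hypothesis kn : (k <= n)%N.
Variable ch : nat -> 'I_2.
Hypothesis hch : forall a, (a < n)%N -> row (ch a) (pi (m + a)%N) != 0.

Definition stiefel_lift : Lift := fun t : Ix n ii =>
  if (t.1.1.2 < typ t.1.1.1)%N then
    let z := bvec n k pi ch t.1.1.2 t.1.2 0 (cmp n k t.1.2) in
    if t.2 then complex.Im z else complex.Re z
  else 0.

Lemma cmat_stiefel_lift l : cmat stiefel_lift l = (pid_mx (typ l) : 'M[K]_n) *m Bmx n k pi ch.
Proof.
have [hp hF hd] := g.
apply/row_matrixP => a; rewrite row_pid; apply/rowP => b; rewrite !mxE /stiefel_lift /=.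
case: ifP => _; last by rewrite mxE.
by rewrite !mxE; case: (bvec _ _ _ _ _ _ _ _).
Qed.

Lemma stiefel_lift_is_lift : is_lift stiefel_lift.
Proof.
have [hp hF hd] := g.
move=> l; split; first by move=> a b c h; rewrite /stiefel_lift /= ltnNge h.
by rewrite cmat_stiefel_lift (rank_pid hp hF hT kn hch) // (typ_le hv).
Qed.

Lemma stiefel_lift_rep : rep (flagof stiefel_lift) pi.
Proof.
have [hp hF hd] := g => l v.
by rewrite sub_flagof cmat_stiefel_lift (sub_pid hp hF hT kn hch) // (typ_le hv).
Qed.

Lemma stiefel_lift_springer : springer_lift k stiefel_lift.
Proof.
have [hp hF hd] := g; have hr := stiefel_lift_rep; have hl := stiefel_lift_is_lift.
have hN (l : 'I_(size ii)) a : lkernel pi (m + prv l) (emb (row a (cmat stiefel_lift l *m Nmx R n k))).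
  rewrite row_mul => s; rewrite lsteps_embV_N ?leq_addr // lsteps_vshift /vshift addn1.
  by apply: flag_rep_const => //; apply: row_sub.
split=> // [l l0|l1 l2 E].
  apply/row_matrixP => a; rewrite row0; apply/(lkernel_left _ hF).
  by have := hN l a; rewrite l0 /= addn0.
split; apply/row_subP => a; rewrite -sub_flagof; apply/hr.
  have h1 : (row a (cmat stiefel_lift l1) <= flagof stiefel_lift l1)%MS by rewrite sub_flagof row_sub.
  move: ((hr _ _).1 h1); apply: lkernel_le; rewrite leq_add2l; have := typ_lt hv (ltnSn l1); rewrite -E => h.
  by apply/ltnW/h.
by have := hN l2 a; rewrite E.
Qed.

End Build.

(** * Projectors satisfying the conditions of a tableau *)

Section CupParams.
Variable w : seq (bool * bool).
Hypothesis hw : row_strict n k ii w.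
Hypothesis hnk : (2 * k <= n)%N.
Local Notation lab := (labw n k ii w).

Definition cup_params pi := [/\ goodpi pi, cups_ok lab N pi &
  forall i, i \in bstack lab N -> pi i = Fm].

Let nu : no_underflow lab N. Proof. exact: labw_no_underflow. Qed.

Lemma cup_params_total pi : cup_params pi -> forall v, lsteps pi N v = vshift m (iter k (lstep Fm) v).
Proof.
move=> [[hp _ _] hc hs]; apply: (lsteps_total (n := n) nu hp hc hs) => //; first by lia.
exact: size_bstack_total.
Qed.

Lemma cup_params_of_cups x pi : is_lift x -> goodpi pi -> rep (flagof x) pi ->
  cups_ok lab N pi -> cup_params pi.
Proof.
move=> xl g hx hc; split=> // i; have [hp hF hd] := g.
have Es := size_bstack_total hv hw.
case: (posnP k) => k0.
  by rewrite k0 in Es *; move/size0nil: Es => ->.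
apply: (unmatched_fixed nu hp hc hF _ _ Es) => //; first by lia.
have hl : ((size ii).-1 < size ii)%N by rewrite prednK ?(size_ii hv).
pose l := Ordinal hl.
have El : typ l = n.
  rewrite -[RHS](prv_size hv) /=; have := size_ii hv; by case: (size ii).
have n0 : (n.-1 < n)%N by lia.
(* This sequence is the last basis vector, f_k, which lies in the last space because that space is
   V. *)
have -> : (fun s => if s.+1 == n then frow K else 0) = emb (delta_mx 0 (Ordinal n0)).
  apply/funext => s; rewrite /embV; case: insubP => [a _ Ea|sn].
    rewrite mxE eqxx /= -val_eqE /= Ea; case: eqP => h.
      have -> : (s == n.-1) by apply/eqP; lia.
      by rewrite scale1r cmp1 //; lia.
    by have -> : (s == n.-1) = false; [apply/eqP; lia | rewrite scale0r].
  by case: eqP => // h; lia.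
have h : ((delta_mx 0 (Ordinal n0) : 'rV[K]_n) <= flagof x l)%MS.
  by rewrite submx_full // /row_full rank_flagof // El.
by have := (hx l _).1 h; rewrite El.
Qed.

End CupParams.
End Lifts.

(** * The cells *)

Section Cell.
Variable R : realType.
Local Notation K := (R[i]).
Variables (n k : nat) (ii : seq nat).
Local Notation m := (n - k)%N.
Local Notation N := (m + n)%N.
Local Notation Fm := (fproj K).
Local Notation prv := (iprev ii).
Local Notation typ := (ityp ii).
Local Notation dblpos := (double_first n k ii).
Local Notation emb := (@embV K n k).
Local Notation rep := (@flag_rep R n k ii).
Local Notation goodpi := (@normalized R n k ii).
Local Notation Lift := {ptws Ix n ii -> R}.
Implicit Types (pi : nat -> 'M[K]_2) (F : flagsp R n ii) (x : Lift).

Hypothesis hv : valid_type n ii.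
Variable w : seq (bool * bool).
Hypothesis hw : row_strict n k ii w.
Hypothesis hnk : (2 * k <= n)%N.
Local Notation lab := (labw n k ii w).
Local Notation tc := (wedges lab).
Local Notation bc := (vees lab).

Lemma mul_diagmx (P : 'I_n -> bool) (v : 'rV[K]_n) a :
  (v *m diagmx R P) 0 a = if P a then v 0 a else 0.
Proof.
rewrite mxE (bigD1 a) //= big1 => [|b ba]; last by rewrite mxE (negbTE ba) mulr0.
by rewrite mxE eqxx addr0; case: (P a); rewrite ?mulr1 ?mulr0.
Qed.

Lemma sub_diagmx (P : 'I_n -> bool) (v : 'rV[K]_n) :
  reflect (forall a, ~~ P a -> v 0 a = 0) (v <= diagmx R P)%MS.
Proof.
apply: (iffP idP) => [/submxP[D ->] a /negbTE Pa|h]; first by rewrite mul_diagmx Pa.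
suff -> : v = v *m diagmx R P by apply: submxMl.
by apply/rowP => a; rewrite mul_diagmx; case: ifP => // /negbT /h.
Qed.

Lemma mul_diagmx2 (P Q : 'I_n -> bool) :
  diagmx R P *m diagmx R Q = diagmx R (fun a => P a && Q a).
Proof.
apply/row_matrixP => a; apply/rowP => b; rewrite row_mul mul_diagmx !mxE.
case: (eqVneq a b) => [->|_] /=; last by rewrite if_same.
by case: (Q b); rewrite ?andbT ?andbF.
Qed.

Let h12 := typ12 hv hw.
Let nu : no_underflow lab N. Proof. exact: labw_no_underflow. Qed.

Lemma wedges_le p : (p <= N)%N -> (tc p <= m)%N.
Proof.
by move=> pN; have [h _] := counts_mono n k ii w pN; have [E _] := counts_total hv hw; rewrite E in h.
Qed.

(** The projection onto P along Q fixes F ∩ P and kills the image of F in Q. Hence a vector of P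
    lying in F' lies in F, and the cell condition determines F ∩ P. *)
Lemma Fprime_P (A : 'M[K]_n) (l : 'I_(size ii)) : (Fprime k A == Fw R n k w l)%MS ->
  forall v : 'rV_n, (forall a : 'I_n, (m <= a)%N -> v 0 a = 0) ->
  (v <= A)%MS <-> (forall a : 'I_n, (tc (m + typ l) <= a)%N -> v 0 a = 0).
Proof.
case/andP=> h1 h2 v Pv.
have vP : (v <= Pmx R n k)%MS by apply/sub_diagmx => a; rewrite -leqNgt; apply: Pv.
rewrite (wedges_typ hv hw (ltn_ord l)); split=> [vA a ta|h].
  have : (v <= Fw R n k w l)%MS.
    apply: submx_trans h1; apply: submx_trans (addsmxSl _ _).
    by rewrite sub_capmx vA.
  move/sub_diagmx => h; case: (ltnP a m) => am; last exact: Pv.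
  by apply: h; rewrite negb_or -leqNgt ta negb_and -ltnNge am.
have : (v <= Fprime k A)%MS.
  apply: submx_trans h2; apply/sub_diagmx => a; rewrite negb_or -leqNgt => /andP[+ _].
  exact: h.
case/sub_addsmxP => -[u1 u2] /= E.
have PP : ((A :&: Pmx R n k) *m Pmx R n k = A :&: Pmx R n k)%MS.
  have /submxP[D ->] : (A :&: Pmx R n k <= Pmx R n k)%MS by apply: capmxSr.
  rewrite -mulmxA mul_diagmx2; congr (_ *m _).
  by apply/matrixP => a b; rewrite !mxE andbb.
have QP : Qproj R n k *m Pmx R n k = 0.
  rewrite mul_diagmx2; apply/matrixP => a b; rewrite !mxE.
  by rewrite leqNgt andNb andbF.
have -> : v = u1 *m (A :&: Pmx R n k)%MS.
  have {1}-> : v = v *m Pmx R n k.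
    by apply/rowP => a; rewrite mul_diagmx; case: ltnP => // /Pv.
  by rewrite E mulmxDl -!mulmxA PP QP !mulmx0 addr0.
by apply: submx_trans (submxMl _ _) (capmxSl _ _).
Qed.

Definition Pvec (v : vec K) :=
  exists2 v0 : 'rV[K]_n, v = emb v0 & forall a : 'I_n, (m <= a)%N -> v0 0 a = 0.

Lemma Pvec_Pseries v : Pvec v -> Pseries v.
Proof.
case=> v0 -> h s; case: (ltnP s m) => sm; first by rewrite embV_off // cmp0.
rewrite /embV; case: insubP => [a _ Ea|_]; last by rewrite mxE.
by rewrite h ?Ea // scale0r mxE.
Qed.

Lemma Pvec_vshift a v : Pvec v -> Pvec (vshift a v).
Proof.
move=> cv; have hP := Pvec_Pseries cv; case: cv => v0 E h.
exists (unembV n k (vshift a v)).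
  rewrite embV_unemb // => s sm; try exact: hP (s + a)%N.
  by rewrite /vshift E embV_off // cmp1 //; apply: leq_trans sm (leq_addr _ _).
by move=> b mb; rewrite mxE cmp1 //; apply: (hP (b + a)%N).
Qed.

Lemma cell_types x pi : is_lift x -> goodpi pi -> rep (flagof x) pi ->
  (forall l, (Fprime k (cmat x l) == Fw R n k w l)%MS) ->
  forall l, (l <= size ii)%N ->
  forall v : 'rV_n, (forall a : 'I_n, (m <= a)%N -> v 0 a = 0) ->
  lkernel pi (m + prv l) (emb v) <-> (forall a : 'I_n, (tc (m + prv l) <= a)%N -> v 0 a = 0).
Proof.
move=> xl g hx hF [|l] hl v Pv.
  have [_ hF0 _] := g; have [t0 _] := @counts_left n k ii w m (leqnn m).
  rewrite /= addn0 lkernel_left // t0; split=> [->|h]; first by move=> a; rewrite mxE.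
  by apply/rowP => a; rewrite mxE h.
rewrite -(Fprime_P (hF (Ordinal hl)) Pv) -sub_flagof; symmetry; exact: (hx (Ordinal hl) v).
Qed.

(** By [cell_types], outside doubles the vectors of P in the kernel grow by one basis vector at each
    wedge and stay the same at each vee. This is the criterion [cups_ok_of_types]. *)
Lemma cell_cup_params x : springer_lift k x ->
  (forall l, (Fprime k (cmat x l) == Fw R n k w l)%MS) ->
  exists2 pi, cup_params n k ii w pi & rep (flagof x) pi.
Proof.
move=> sx hF; have [xl _ _] := sx.
have [pi [g hx]] := exists_flag_rep hv h12 sx; have [hp hF0 hd] := g.
exists pi => //; apply: (cup_params_of_cups hv hw hnk xl g hx).
have ht := cell_types xl g hx hF.
apply: (cups_ok_of_types nu (double_first_lab hv h12 hw) Pvec_vshift hp).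
- by move=> q /hd[-> ->].
- move=> q qN lq nd v cv hL; case: (ltnP q m) => qm.
    have hP := Pvec_Pseries cv; move=> s.
    have hl i : (i < q.+1)%N -> pi i = Fm by move=> iq; apply: hF0; apply: leq_trans iq qm.
    rewrite lsteps_left => [|i iq]; last exact/hl/ltnW.
    have := hL s; rewrite lsteps_left // !iter_lstepF => /rowP h.
    by apply: row2P; rewrite !mxE /= ?hP //; have := h 0; rewrite !mxE.
  have [l hl [Eq|[Eq E2]]] := pos_cases hv h12 qm qN; last first.
    by move: lq; rewrite Eq (lab_double2 hv hw).
  have [E|E] := h12 hl; last by move: nd; rewrite Eq double_first_prv ?E ?eqxx //; apply: h12.
  case: cv => v0 Ev Pv; rewrite Ev Eq in hL *.
  apply/(ht l (ltnW hl) _ Pv) => a ta.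
  have := (ht l.+1 hl _ Pv).1; rewrite /= -/(typ l) E addnS => /(_ hL); apply.
  by rewrite wedgesS -Eq lq addn0 Eq.
- move=> q qN lq nd.
  have qm : (m <= q)%N by rewrite leqNgt; apply: contra lq; apply: lab_left.
  have [l hl [Eq|[Eq E2]]] := pos_cases hv h12 qm qN; last first.
    by move: nd; rewrite Eq addnS /= double_first_prv ?E2 ?eqxx //; apply: h12.
  have [E|E] := h12 hl; last by move: lq; rewrite Eq (lab_double1 k hv).
  set t := tc (m + prv l).
  have tS : tc (m + prv l).+1 = t.+1 by rewrite wedgesS -Eq lq Eq addn1.
  have tm : (t < m)%N by rewrite -tS; apply: wedges_le; rewrite -Eq.
  have tn : (t < n)%N by apply: leq_trans tm (leq_subr _ _).
  pose v0 : 'rV[K]_n := delta_mx 0 (Ordinal tn).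
  have Pv : forall a : 'I_n, (m <= a)%N -> v0 0 a = 0.
    by move=> a ma; rewrite mxE eqxx /= -val_eqE /= gtn_eqF // (leq_trans tm).
  exists (emb v0); split; first by exists v0.
    rewrite Eq; have := (ht l.+1 hl _ Pv).2; rewrite /= -/(typ l) E addnS; apply.
    by move=> a ta; rewrite mxE eqxx /= -val_eqE /= gtn_eqF // -tS.
  rewrite Eq => /(ht l (ltnW hl) _ Pv) /(_ (Ordinal tn) (leqnn _)) /eqP.
  by rewrite mxE !eqxx oner_eq0.
Qed.

Lemma rank_diagmx_le (P : 'I_n -> bool) t b :
  (forall a : 'I_n, P a -> (a < t)%N || ((m <= a)%N && (a < m + b)%N)) ->
  (\rank (diagmx R P) <= t + b)%N.
Proof.
move=> h.
have -> : diagmx R P = \sum_(a | P a) delta_mx a a.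
  apply/matrixP => a b'; rewrite summxE mxE; case Pa: (P a); last first.
    rewrite andbF big1 // => c Pc; rewrite mxE; case: eqP => // E.
    by rewrite -E Pa in Pc.
  rewrite (bigD1 a) //= big1 => [|c /andP[_ ca]]; rewrite mxE ?eqxx ?addr0 ?andbT /= 1?[b' == a]eq_sym //.
  by rewrite [a == c]eq_sym (negbTE ca).
apply: (@leq_trans (\sum_(a | P a) 1)%N).
  elim/big_rec2: _ => [|a r A _ IH]; first by rewrite mxrank0.
  by apply: leq_trans (mxrank_add _ _) _; rewrite mxrank_delta leq_add2l.
rewrite sum1_card cardE -(size_map val).
have -> : (t + b = size (iota 0 t ++ iota m b))%N by rewrite size_cat !size_iota.
apply: uniq_leq_size.
  by rewrite map_inj_uniq ?enum_uniq //; apply: val_inj.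
move=> c /mapP[a]; rewrite mem_enum => /h Pa ->.
by rewrite mem_cat !mem_iota /= add0n.
Qed.

(** The bounds [generic_top] and [bot_component] on the two summands show that F' is contained in
    F(w). Equality follows by ranks: kernel and image of the projection to Q give F' the rank of
    F_l, and F(w) has rank at most t + b = i_l. *)
Lemma generic_Ycirc x pi : springer_lift k x -> cup_params n k ii w pi -> rep (flagof x) pi ->
  (forall q, (q < N)%N -> generic lab dblpos pi q) ->
  Ycirc R n k ii w (flagof x).
Proof.
move=> sx [g hc hs] hx hg; exists x; split => // l.
have [xl _ _] := sx; have [hp hF0 hd] := g.
set A := cmat x l.
have lN : (m + typ l <= N)%N by rewrite leq_add2l (typ_le hv).
have nd : ~~ second_of dblpos (m + typ l).
  by rewrite -[typ l]/(prv l.+1) (second_of_prv k hv h12).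
have hA (v : 'rV_n) : (v <= A)%MS -> lkernel pi (m + typ l) (emb v).
  by move=> h; apply/hx; rewrite sub_flagof.
have [_ htop] := generic_top nu (double_first_lab hv h12 hw) hp hc hg lN nd.
have hbot := bot_component nu hp hc lN.
have t_eq := wedges_typ hv hw (ltn_ord l); have b_eq := vees_typ hv hw (ltn_ord l).
have zP (v : 'rV_n) (a : 'I_n) : (v <= A)%MS -> (v <= Pmx R n k)%MS ->
    (tcount ii w (typ l) <= a)%N -> v 0 a = 0.
  move=> vA /sub_diagmx vP ta.
  have cv : Pvec (emb v) by exists v => // b mb; apply: vP; rewrite -leqNgt.
  case: (ltnP a m) => am; last by apply: vP; rewrite -leqNgt.
  have h := (htop _ (Pvec_Pseries cv)).1 (hA _ vA); rewrite -(@embV_on K n k) h ?mxE //.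
  by rewrite t_eq.
have zB (v : 'rV_n) (a : 'I_n) : (v <= A)%MS -> (m + bcount ii w (typ l) <= a)%N -> v 0 a = 0.
  move=> vA ba; have := hbot _ (hA _ vA) a; rewrite b_eq => /(_ ba).
  by rewrite -[v 0 a](@embV_on _ n k) cmp1 //; apply: leq_trans ba; apply: leq_addr.
have sub : (Fprime k A <= Fw R n k w l)%MS.
  rewrite addsmx_sub; apply/andP; split; apply/row_subP => c; apply/sub_diagmx => a.
    have vA : (row c (A :&: Pmx R n k) <= A)%MS := submx_trans (row_sub _ _) (capmxSl _ _).
    have vP : (row c (A :&: Pmx R n k) <= Pmx R n k)%MS := submx_trans (row_sub _ _) (capmxSr _ _).
    by rewrite negb_or -leqNgt => /andP[ta _]; apply: zP.
  rewrite row_mul mul_diagmx; case: (leqP m a) => ma // hn.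
  apply: zB; first exact: row_sub.
  by rewrite leqNgt; apply: contra hn => ->; rewrite orbT.
rewrite sub /=.
have := mxrank_leqif_sup sub; case=> _ <-; rewrite eqn_leq mxrankS //=.
have rF : \rank (Fprime k A) = typ l.
  have [_ <-] := xl l; rewrite -/A -(mxrank_mul_ker A (Qproj R n k)) addnC.
  rewrite mxrank_disjoint_sum.
    congr (_ + _)%N; suff E : (Pmx R n k :=: kermx (Qproj R n k))%MS.
      by rewrite (cap_eqmx (eqmx_refl A) E).
    apply/eqmxP/andP; split.
      apply/row_subP => c; apply/sub_kermxP; apply/rowP => a; rewrite mul_diagmx [RHS]mxE.
      have /sub_diagmx h := row_sub c (Pmx R n k).
      by case: leqP => // ma; apply: h; rewrite -leqNgt.
    apply/row_subP => c; apply/sub_diagmx => a; rewrite -leqNgt => ma.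
    have /sub_kermxP /rowP /(_ a) := row_sub c (kermx (Qproj R n k)).
    by rewrite mul_diagmx ma [RHS]mxE.
  apply/row_matrixP => c; rewrite row0.
  set v := row c _.
  have /sub_diagmx v1 : (v <= Pmx R n k)%MS.
    by apply: submx_trans (row_sub _ _) _; apply: submx_trans (capmxSl _ _) (capmxSr _ _).
  have /submxP[D ED] : (v <= A *m Qproj R n k)%MS.
    by apply: submx_trans (row_sub _ _) (capmxSr _ _).
  apply/rowP => a; rewrite [RHS]mxE; case: (ltnP a m) => am; last by apply: v1; rewrite -leqNgt.
  by rewrite ED mulmxA mul_diagmx leqNgt am.
rewrite rF; have : (tcount ii w (typ l) + bcount ii w (typ l) = typ l)%N.
  have : (tc (m + typ l) + bc (m + typ l) = m + typ l)%N.
    by rewrite /wedges /vees addnC count_predC size_iota.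
  by rewrite t_eq b_eq; lia.
by move=> <-; apply: rank_diagmx_le => a.
Qed.

End Cell.

(** * The Zariski closure *)

Section PolyFun.
Variable R : realType.
Local Notation K := (R[i]).
Variable J : Type.
Implicit Types (p : (J -> K) -> K).

Lemma pf_ext p q : polyfun p -> p =1 q -> polyfun q.
Proof. by move=> hp /funext <-. Qed.

Lemma pf_sum (I : Type) (r : seq I) (P : pred I) (F : I -> (J -> K) -> K) :
  (forall i, polyfun (F i)) -> polyfun (fun z => \sum_(i <- r | P i) F i z).
Proof.
move=> h; elim: r => [|i r IH].
  by apply: pf_ext (pf_const J 0) _ => z; rewrite big_nil.
case Pi: (P i).
  by apply: pf_ext (pf_add (h i) IH) _ => z; rewrite big_cons Pi.
by apply: pf_ext IH _ => z; rewrite big_cons Pi.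
Qed.

Lemma pf_prod (I : Type) (r : seq I) (P : pred I) (F : I -> (J -> K) -> K) :
  (forall i, polyfun (F i)) -> polyfun (fun z => \prod_(i <- r | P i) F i z).
Proof.
move=> h; elim: r => [|i r IH].
  by apply: pf_ext (pf_const J 1) _ => z; rewrite big_nil.
case Pi: (P i).
  by apply: pf_ext (pf_mul (h i) IH) _ => z; rewrite big_cons Pi.
by apply: pf_ext IH _ => z; rewrite big_cons Pi.
Qed.

Lemma pf_det r (M : (J -> K) -> 'M[K]_r) :
  (forall a b, polyfun (fun z => M z a b)) -> polyfun (fun z => \det (M z)).
Proof.
move=> h; apply: pf_sum => s; apply: pf_mul; first exact: pf_const.
by apply: pf_prod.
Qed.

Lemma pf_mulmx r s (a : (J -> K) -> 'rV[K]_r) (M : 'M[K]_(r, s)) :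
  (forall b, polyfun (fun z => a z 0 b)) -> forall c, polyfun (fun z => (a z *m M) 0 c).
Proof.
move=> h c; apply: (@pf_ext (fun z => \sum_b a z 0 b * M b c)); last by move=> z; rewrite mxE.
by apply: pf_sum => b; apply: pf_mul => //; apply: pf_const.
Qed.

End PolyFun.

(** * Conditions that pass from the cell to its closure *)

Section Closure.
Variable R : realType.
Local Notation K := (R[i]).
Variables (n k : nat) (ii : seq nat).
Local Notation m := (n - k)%N.
Local Notation N := (m + n)%N.
Local Notation Fm := (fproj K).
Local Notation typ := (ityp ii).
Local Notation dblpos := (double_first n k ii).
Local Notation emb := (@embV K n k).
Local Notation rep := (@flag_rep R n k ii).
Local Notation Lift := {ptws Ix n ii -> R}.
Implicit Types (pi : nat -> 'M[K]_2) (F : flagsp R n ii) (x : Lift).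

Hypothesis hv : valid_type n ii.
Variable w : seq (bool * bool).
Hypothesis hw : row_strict n k ii w.
Hypothesis hnk : (2 * k <= n)%N.
Local Notation lab := (labw n k ii w).
Let nu : no_underflow lab N. Proof. exact: labw_no_underflow. Qed.
Let h12 := typ12 hv hw.

Definition zclosed_pt (A : set (flagsp R n ii)) x := forall p, polyfun p ->
  (forall y : Lift, is_lift y -> A (flagof y) -> p (cvec y) = 0) -> p (cvec x) = 0.

(** If the polynomial row were outside F_l at [x], stacking it under the lift would give a rank
    above i_l, and some minor of that size would be nonzero at [x]. On the lifts of flags in [A] the
    rank is only i_l, so this minor vanishes there, and hence also at [x]. *)
Lemma zclosed_sub (A : set (flagsp R n ii)) x l (a : _ -> 'rV[K]_n) :
  is_lift x -> zclosed_pt A x -> (forall b, polyfun (fun z => a z 0 b)) ->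
  (forall y : Lift, is_lift y -> A (flagof y) -> (a (cvec y) <= cmat y l)%MS) ->
  (a (cvec x) <= cmat x l)%MS.
Proof.
move=> xl hx ha hy; apply/negPn/negP => hn.
pose B z := col_mx (\matrix_(c, d) (z (l, c, d) : K)) (a z) : 'M[K]_(n + 1, n).
have BE (y : Lift) : B (cvec y) = col_mx (cmat y l) (a (cvec y)).
  by rewrite /B; congr col_mx; apply/matrixP => c d; rewrite !mxE.
pose f := maxrankfun (B (cvec x)).
have frow := maxrowsub_free (B (cvec x)).
have full : row_full (rowsub f (B (cvec x)))^T.
  by rewrite /row_full mxrank_tr.
pose g := fullrankfun full.
pose D z := rowsub g (rowsub f (B z))^T.
have pD : polyfun (fun z => \det (D z)).
  apply: pf_det => c d; apply: (@pf_ext _ _ (fun z => B z (f d) (g c))).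
    rewrite /B; case: (split_ordP (f d)) => e E.
      apply: (@pf_ext _ _ (fun z => z (l, e, g c))); first exact: pf_var.
      by move=> z; rewrite E col_mxEu mxE.
    apply: (@pf_ext _ _ (fun z => a z 0 (g c))); first exact: ha.
    by move=> z; rewrite E col_mxEd (ord1 e).
  by move=> z; rewrite !mxE.
have unit_rank (y : Lift) : \det (D (cvec y)) != 0 ->
    (\rank (B (cvec x)) <= \rank (B (cvec y)))%N.
  rewrite -unitfE -unitmxE -row_full_unit => /eqP {1}<-.
  apply: leq_trans (mxrankS (rowsub_sub _ _)) _; rewrite mxrank_tr.
  exact: mxrankS (rowsub_sub _ _).
have rx : (typ l < \rank (B (cvec x)))%N.
  have sub : (cmat x l <= B (cvec x))%MS.
    by have := submx_refl (B (cvec x)); rewrite {1}BE col_mx_sub => /andP[].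
  case: (xl l) => _ <-; rewrite ltn_neqAle mxrankS // andbT.
  have [_ ->] := mxrank_leqif_sup sub.
  by rewrite BE col_mx_sub negb_and hn orbT.
have : \det (D (cvec x)) != 0.
  by rewrite -unitfE -unitmxE; apply: fullrowsub_unit.
rewrite (hx _ pD) ?eqxx // => y yl yA; apply/eqP/negPn/negP => /unit_rank.
rewrite leqNgt => /negP; apply; apply: leq_ltn_trans rx.
case: (yl l) => _ <-; rewrite BE; apply: mxrankS.
by rewrite col_mx_sub submx_refl hy.
Qed.

Definition rowz (l : 'I_(size ii)) (c : 'I_n) (z : 'I_(size ii) * 'I_n * 'I_n -> K) : 'rV[K]_n :=
  \row_d z (l, c, d).

Lemma rowzE (y : Lift) l c : rowz l c (cvec y) = row c (cmat y l).
Proof. by apply/rowP => d; rewrite !mxE. Qed.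

Lemma pf_rowz l c d : polyfun (fun z => rowz l c z 0 d).
Proof. by apply: (pf_ext (pf_var R (l, c, d))) => z; rewrite mxE. Qed.

Fixpoint Npow s : 'M[K]_n := if s is s'.+1 then Npow s' *m Nmx R n k else 1%:M.

Lemma lsteps_embV_Npow pi P s v : (forall i, (i < m)%N -> pi i = Fm) -> (m <= P)%N ->
  lsteps pi P (emb (v *m Npow s)) = vshift s (lsteps pi P (emb v)).
Proof.
move=> hF mP; elim: s => [|s IH] /=; first by rewrite mulmx1 vshift0.
by rewrite mulmxA lsteps_embV_N // lsteps_vshift IH vshift_add add1n.
Qed.

Lemma Ycirc_rep F : Ycirc R n k ii w F ->
  exists x pi, [/\ springer_lift k x, flagof x = F, cup_params n k ii w pi & rep F pi].
Proof.
move=> [x [sx <- hF]]; have [pi hpi hx] := cell_cup_params hv hw hnk sx hF.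
by exists x, pi.
Qed.

(** The form of a cup that is expressible by polynomials: its factors compose to N^((j + 1 - i)/2),
    which therefore maps the space F_l ending at j into the kernel before i. *)
Lemma cup_params_cup_sub x pi i j (l : 'I_(size ii)) c : cup_params n k ii w pi -> rep (flagof x) pi ->
  (j < N)%N -> matched lab i j -> (m + typ l)%N = j.+1 ->
  lkernel pi i (vshift ((j.+1 - i)./2) (emb (row c (cmat x l)))).
Proof.
move=> [[hp _ _] hc _] hx jN cij E.
have [s [Ej _ _ hY]] := lsteps_cup_out nu hp hc jN cij.
have -> : ((j.+1 - i)./2 = s)%N by rewrite Ej; lia.
have := (hx l (row c (cmat x l))).1; rewrite sub_flagof row_sub E => /(_ isT) h a.
by rewrite lsteps_vshift -hY; apply: h.
Qed.

Lemma closure_springer x : is_lift x -> zclosed_pt (Ycirc R n k ii w) x -> springer_lift k x.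
Proof.
move=> xl hx; split=> // [l l0|l1 l2 E].
  apply/row_matrixP => c; rewrite row0 row_mul -rowzE; apply/rowP => d; rewrite [RHS]mxE.
  apply: (hx (fun z => (rowz l c z *m Nmx R n k) 0 d)).
    by apply: pf_mulmx => b; apply: pf_rowz.
  move=> y yl [y' [[_ h0 _] Ef _]].
  have -> : rowz l c (cvec y) *m Nmx R n k = 0; last by rewrite mxE.
  have : (row c (cmat y l) <= cmat y' l)%MS by rewrite -sub_flagof Ef sub_flagof row_sub.
  by rewrite rowzE => /submxP[D ->]; rewrite -mulmxA h0 // mulmx0.
split; apply/row_subP => c.
  rewrite -rowzE; apply: (zclosed_sub xl hx); first by move=> b; apply: pf_rowz.
  move=> y yl [y' [[_ _ h] Ef _]]; have [h1 _] := h l1 l2 E.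
  rewrite rowzE -sub_flagof -Ef sub_flagof; apply: submx_trans h1.
  by rewrite -sub_flagof Ef sub_flagof row_sub.
rewrite row_mul -rowzE; apply: (zclosed_sub xl hx (a := fun z => rowz l2 c z *m Nmx R n k)).
  by apply: pf_mulmx => b; apply: pf_rowz.
move=> y yl [y' [[_ _ h] Ef _]]; have [_ h1] := h l1 l2 E.
rewrite rowzE -sub_flagof -Ef sub_flagof; apply: submx_trans h1; apply: submxMr.
by rewrite -sub_flagof Ef sub_flagof row_sub.
Qed.

(** The inclusion of [cup_params_cup_sub] passes to the closure, and [cups_ok_of_vectors] recovers
    the cups from it. The test vector at [j] is a row of the lift of F_l outside F_(l-1). *)
Lemma closure_cup_params x : is_lift x -> zclosed_pt (Ycirc R n k ii w) x ->
  exists2 pi, cup_params n k ii w pi & rep (flagof x) pi.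
Proof.
move=> xl hx; have sx := closure_springer xl hx.
have [pi [g hpi]] := exists_flag_rep hv h12 sx; exists pi => //.
apply: (cup_params_of_cups hv hw hnk xl g hpi).
have [hp hF hd] := g.
apply: (cups_ok_of_vectors nu (double_first_lab hv h12 hw) hp).
  by move=> q /hd[-> ->].
move=> i j jN c nd _; have [ij li lj _ _] := matchedP c.
have jm : (m <= j)%N by rewrite leqNgt; apply: contra lj; apply: lab_left.
have [l0 hl [Ej|[Ej E2]]] := pos_cases hv h12 jm jN; last first.
  by move: nd; rewrite Ej addnS /= double_first_prv ?E2 ?eqxx.
have [E|E] := h12 hl; last by move: lj; rewrite Ej (lab_double1 k hv).
pose l := Ordinal hl.
have El : (m + typ l = j.+1)%N by rewrite /= E addnS -Ej.
have [c0 hc0] := flag_rep_nontriv hv l xl hF hpi.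
exists (emb (row c0 (cmat x l))); split; rewrite ?Ej //.
  have := (hpi l (row c0 (cmat x l))).1; rewrite sub_flagof row_sub El -Ej; exact.
rewrite -Ej; set s := (_./2).
(* Before a prepended position all factors are those of f and the kernel is cut out by explicit
   linear equations; before any later left end of a cup it meets V in 0 or in a space of the
   flag. *)
case: (ltnP i m) => im.
  have hF' i' : (i' < i)%N -> pi i' = Fm by move=> h; apply: hF; apply: ltn_trans im.
  move=> t; rewrite lsteps_left //; apply/rowP => d; rewrite [RHS]mxE.
  rewrite -rowzE.
  apply: (hx (fun z => (iter i (lstep Fm) (vshift s (emb (rowz l c0 z))) t) 0 d)).
    have pfe t' d' : polyfun (fun z => emb (rowz l c0 z) t' 0 d').
      rewrite /embV; case: insubP => [b _ _|_]; last first.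
        by apply: (pf_ext (pf_const _ 0)) => z; rewrite mxE.
      apply: (pf_ext (pf_mul (pf_rowz l c0 b) (pf_const _ ((delta_mx 0 (cmp n k t') : 'rV[K]_2) 0 d')))).
      by move=> z; rewrite [RHS]mxE.
    case: (ord2P d) => ->.
      by apply: pf_ext (pfe (t + s)%N 0) _ => z; rewrite iter_lstepF [RHS]mxE.
    by apply: pf_ext (pfe (t + i + s)%N 1) _ => z; rewrite iter_lstepF [RHS]mxE.
  move=> y yl /Ycirc_rep[y' [piy [_ _ hpy hy]]].
  have [[_ hFy _] _ _] := hpy.
  have := cup_params_cup_sub c0 hpy hy jN c El; rewrite -/s => /(_ t).
  rewrite lsteps_left => [|i' h]; last by apply: hFy; apply: ltn_trans im.
  by rewrite rowzE => ->; rewrite mxE.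
have iN := ltn_trans ij jN.
suff : lkernel pi i (emb (row c0 (cmat x l) *m Npow s)).
  by move=> h t; rewrite lsteps_vshift -lsteps_embV_Npow //; apply: h.
have ndi : ~~ dblpos i.
  apply/negP => di; have E' := matched_injr c (double_matched (double_first_lab hv h12 hw) di).
  by move: nd; rewrite E' /= di.
have [l1 hl1 [Ei|[Ei E2]]] := pos_cases hv h12 im iN; last first.
  by move: li; rewrite Ei (lab_double2 hv hw).
case: l1 hl1 Ei => [|l1] hl1 /= Ei.
  rewrite Ei addn0 lkernel_left //.
  apply/rowP => d; rewrite [RHS]mxE -rowzE.
  apply: (hx (fun z => (rowz l c0 z *m Npow s) 0 d)).
    by apply: pf_mulmx => b; apply: pf_rowz.
  move=> y yl /Ycirc_rep[y' [piy [_ _ hpy hy]]].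
  have [[_ hFy _] _ _] := hpy.
  have h : lkernel piy i (emb (rowz l c0 (cvec y) *m Npow s)).
    move=> t; have := cup_params_cup_sub c0 hpy hy jN c El; rewrite -/s => /(_ t).
    by rewrite rowzE lsteps_embV_Npow // lsteps_vshift.
  by move: h; rewrite Ei addn0 lkernel_left // => ->; rewrite mxE.
pose lp := Ordinal (ltnW hl1 : (l1 < size ii)%N).
have Elp : (m + typ lp)%N = i by rewrite Ei.
rewrite -Elp; apply/hpi; rewrite sub_flagof -rowzE.
apply: (zclosed_sub xl hx (a := fun z => rowz l c0 z *m Npow s)).
  by apply: pf_mulmx => b; apply: pf_rowz.
move=> y yl /Ycirc_rep[y' [piy [_ _ hpy hy]]].
have [[_ hFy _] _ _] := hpy.
rewrite -sub_flagof; apply/hy; rewrite Elp => t.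
have := cup_params_cup_sub c0 hpy hy jN c El; rewrite -/s => /(_ t).
by rewrite rowzE lsteps_embV_Npow // lsteps_vshift.
Qed.

End Closure.

Local Open Scope classical_set_scope.

(** * Convergence *)

Section CvgC.
Variable R : realType.
Local Notation K := (R[i]).
Variable T : Type.
Implicit Types (F : set_system T) (f g : T -> K) (a b : K).

(** Lifts carry the product topology of their real coordinates, so complex limits are taken
    separately on real and imaginary parts. *)
Definition cvgC F f a :=
  ((fun x => complex.Re (f x)) @ F --> complex.Re a) /\
  ((fun x => complex.Im (f x)) @ F --> complex.Im a).

Lemma cvgC_cst F a : Filter F -> cvgC F (fun=> a) a.
Proof. by move=> FF; split; apply: cvg_cst. Qed.

Lemma cvgC_add F f g a b : Filter F -> cvgC F f a -> cvgC F g b ->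
  cvgC F (fun x => f x + g x) (a + b).
Proof.
move=> FF [f1 f2] [g1 g2].
have E1 (x y : K) : complex.Re (x + y) = complex.Re x + complex.Re y by case: x; case: y.
have E2 (x y : K) : complex.Im (x + y) = complex.Im x + complex.Im y by case: x; case: y.
split; rewrite ?E1 ?E2.
  by under eq_fun do rewrite E1; apply: cvgD.
by under eq_fun do rewrite E2; apply: cvgD.
Qed.

Lemma cvgC_opp F f a : Filter F -> cvgC F f a -> cvgC F (fun x => - f x) (- a).
Proof.
move=> FF [f1 f2].
have E1 (x : K) : complex.Re (- x) = - complex.Re x by case: x.
have E2 (x : K) : complex.Im (- x) = - complex.Im x by case: x.
split; rewrite ?E1 ?E2.
  by under eq_fun do rewrite E1; apply: cvgN.
by under eq_fun do rewrite E2; apply: cvgN.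
Qed.

Lemma cvgC_mul F f g a b : Filter F -> cvgC F f a -> cvgC F g b ->
  cvgC F (fun x => f x * g x) (a * b).
Proof.
move=> FF [f1 f2] [g1 g2].
have E1 (x y : K) : complex.Re (x * y) =
  complex.Re x * complex.Re y - complex.Im x * complex.Im y by case: x; case: y.
have E2 (x y : K) : complex.Im (x * y) =
  complex.Re x * complex.Im y + complex.Im x * complex.Re y by case: x; case: y.
split; rewrite ?E1 ?E2.
  by under eq_fun do rewrite E1; apply: cvgB; apply: cvgM.
by under eq_fun do rewrite E2; apply: cvgD; apply: cvgM.
Qed.

Lemma cvgC_conj F f a : Filter F -> cvgC F f a -> cvgC F (fun x => (f x)^*) (a^*).
Proof.
move=> FF [f1 f2].
have E1 (x : K) : complex.Re (x^*) = complex.Re x by case: x.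
have E2 (x : K) : complex.Im (x^*) = - complex.Im x by case: x.
split; rewrite ?E1 ?E2.
  by under eq_fun do rewrite E1.
by under eq_fun do rewrite E2; apply: cvgN.
Qed.

Lemma cvgC_near F f a : Filter F -> cvgC F f a -> a != 0 -> \forall x \near F, f x != 0.
Proof.
move=> FF [f1 f2] a0.
have hre (g : T -> R) (c : R) : g @ F --> c -> c != 0 -> \forall x \near F, g x != 0.
  move=> h c0; have : \forall y \near c, y != 0 by apply: open_nbhs_nbhs; split => //; apply: open_neq.
  exact: h.
have : (complex.Re a != 0) \/ (complex.Im a != 0).
  case: a a0 {f1 f2} => r s; rewrite eq_complex /= negb_and => /orP[]; [left|right]; done.
case=> [/(hre _ _ f1)|/(hre _ _ f2)]; apply: filterS => x; by apply: contraNneq => ->; rewrite /= eqxx.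
Qed.

Lemma cvgC_inv F f a : Filter F -> cvgC F f a -> a != 0 ->
  cvgC F (fun x => (f x)^-1) (a^-1).
Proof.
move=> FF [f1 f2] a0.
pose q (x : K) := complex.Re x * complex.Re x + complex.Im x * complex.Im x.
have E1 (x : K) : complex.Re (x^-1) = complex.Re x * (q x)^-1.
  by case: x.
have E2 (x : K) : complex.Im (x^-1) = - complex.Im x * (q x)^-1 by case: x => c d /=; rewrite mulNr.
have q0 : q a != 0.
  move: a0; apply: contra => /eqP; rewrite /q -!expr2 => /eqP; rewrite paddr_eq0 ?sqr_ge0 //.
  by rewrite !sqrf_eq0 eq_complex.
have cq : (fun x => q (f x)) @ F --> q a by apply: cvgD; apply: cvgM.
split; rewrite ?E1 ?E2.
  by under eq_fun do rewrite E1; apply: cvgM => //; apply: cvgV.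
by under eq_fun do rewrite E2; apply: cvgM; [apply: cvgN|apply: cvgV].
Qed.

Lemma cvgC_sum F (I : Type) (r : seq I) (P : pred I) (f : I -> T -> K) (a : I -> K) :
  Filter F -> (forall i, cvgC F (f i) (a i)) ->
  cvgC F (fun x => \sum_(i <- r | P i) f i x) (\sum_(i <- r | P i) a i).
Proof.
move=> FF h; elim: r => [|i r IH].
  under eq_fun do rewrite big_nil; rewrite big_nil; exact: cvgC_cst.
under eq_fun do rewrite big_cons; rewrite big_cons; case: (P i) => //.
exact: cvgC_add.
Qed.

Lemma cvgC_eq F f g a : Filter F -> (\forall x \near F, f x = g x) -> cvgC F g a -> cvgC F f a.
Proof.
move=> FF h [g1 g2]; split.
  apply: cvg_trans g1; apply: near_eq_cvg; by apply: filterS h => x ->.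
apply: cvg_trans g2; apply: near_eq_cvg; by apply: filterS h => x ->.
Qed.

Lemma cvgC_unique F f a b : ProperFilter F -> cvgC F f a -> cvgC F f b -> a = b.
Proof.
move=> FF [f1 f2] [g1 g2]; apply/eqP; rewrite eq_complex; apply/andP.
split; apply/eqP; [exact: cvg_unique f1 g1|exact: cvg_unique f2 g2].
Qed.

Lemma cvgC_polyfun F (J : Type) (z : T -> J -> K) (z0 : J -> K) p :
  Filter F -> (forall j, cvgC F (fun x => z x j) (z0 j)) -> polyfun p ->
  cvgC F (fun x => p (z x)) (p z0).
Proof.
move=> FF h; elim=> [c|j|q r _ IH1 _ IH2|q r _ IH1 _ IH2].
- exact: cvgC_cst.
- exact: h.
- exact: cvgC_add.
- exact: cvgC_mul.
Qed.

Definition cvgMx F r s (f : T -> 'M[K]_(r, s)) (A : 'M[K]_(r, s)) :=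
  forall i j, cvgC F (fun x => f x i j) (A i j).

Lemma cvgM_cst F r s (A : 'M[K]_(r, s)) : Filter F -> cvgMx F (fun=> A) A.
Proof. by move=> FF i j; apply: cvgC_cst. Qed.

Lemma cvgM_add F r s (f g : T -> 'M[K]_(r, s)) A B : Filter F ->
  cvgMx F f A -> cvgMx F g B -> cvgMx F (fun x => f x + g x) (A + B).
Proof.
move=> FF hf hg i j; rewrite mxE; under eq_fun do rewrite mxE; exact: cvgC_add.
Qed.

Lemma cvgM_opp F r s (f : T -> 'M[K]_(r, s)) A : Filter F ->
  cvgMx F f A -> cvgMx F (fun x => - f x) (- A).
Proof.
move=> FF hf i j; rewrite mxE; under eq_fun do rewrite mxE; exact: cvgC_opp.
Qed.

Lemma cvgM_mul F r s t (f : T -> 'M[K]_(r, s)) (g : T -> 'M[K]_(s, t)) A B : Filter F ->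
  cvgMx F f A -> cvgMx F g B -> cvgMx F (fun x => f x *m g x) (A *m B).
Proof.
move=> FF hf hg i j; rewrite mxE; under eq_fun do rewrite mxE.
by apply: cvgC_sum => c; apply: cvgC_mul.
Qed.

Lemma cvgM_scale F r s (f : T -> K) a (A : 'M[K]_(r, s)) : Filter F ->
  cvgC F f a -> cvgMx F (fun x => f x *: A) (a *: A).
Proof.
move=> FF hf i j; rewrite mxE; under eq_fun do rewrite mxE.
by apply: cvgC_mul => //; apply: cvgC_cst.
Qed.

Lemma cvgM_row F r s (f : T -> 'M[K]_(r, s)) A c : Filter F ->
  cvgMx F f A -> cvgMx F (fun x => row c (f x)) (row c A).
Proof. by move=> FF hf i j; rewrite mxE; under eq_fun do rewrite mxE; apply: hf. Qed.

Lemma cvgM_near F r s (f : T -> 'M[K]_(r, s)) A : Filter F ->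
  cvgMx F f A -> A != 0 -> \forall x \near F, f x != 0.
Proof.
move=> FF hf A0.
have [i [j ab]] : exists i j, A i j != 0.
  apply: contrapT => h; case/eqP: A0; apply/matrixP => i j; rewrite mxE.
  by apply/eqP; apply: contrapT => hab; apply: h; exists i, j; apply/negP.
have := cvgC_near FF (hf i j) ab; apply: filterS => x; apply: contraNneq => ->.
by rewrite mxE.
Qed.

Lemma cvgM_eq F r s (f g : T -> 'M[K]_(r, s)) A : Filter F ->
  (\forall x \near F, f x = g x) -> cvgMx F g A -> cvgMx F f A.
Proof.
by move=> FF h hg i j; apply: cvgC_eq (hg i j); apply: filterS h => x ->.
Qed.

Lemma cvgM_herm F (u : T -> 'rV[K]_2) u0 : Filter F -> cvgMx F u u0 -> u0 != 0 ->
  cvgMx F (fun x => herm (u x)) (herm u0).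
Proof.
move=> FF hu n0 i j; rewrite mxE; under eq_fun do rewrite mxE.
apply: cvgC_mul; first by apply: cvgC_mul => //; apply: cvgC_conj.
apply: cvgC_inv; last exact: nrm_neq0.
by apply: cvgC_add; apply: cvgC_mul => //; apply: cvgC_conj.
Qed.

Lemma cvgM_lstep F (p : T -> 'M[K]_2) p0 (v : T -> vec K) v0 : Filter F ->
  cvgMx F p p0 -> (forall s, cvgMx F (fun x => v x s) (v0 s)) ->
  forall s, cvgMx F (fun x => lstep (p x) (v x) s) (lstep p0 v0 s).
Proof.
move=> FF hp hv s; apply: cvgM_add; apply: cvgM_mul => //.
apply: cvgM_add; first exact: cvgM_cst.
exact: cvgM_opp.
Qed.

Lemma cvgM_lsteps F (pi : T -> nat -> 'M[K]_2) pi0 P (v : T -> vec K) v0 : Filter F ->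
  (forall q, (q < P)%N -> cvgMx F (fun x => pi x q) (pi0 q)) ->
  (forall s, cvgMx F (fun x => v x s) (v0 s)) ->
  forall s, cvgMx F (fun x => lsteps (pi x) P (v x) s) (lsteps pi0 P v0 s).
Proof.
move=> FF; elim: P => [//|P IH] hp hv; apply: cvgM_lstep; first exact: hp.
by apply: IH => // q qP; apply: hp; apply: ltnW.
Qed.

Lemma cvgM_rsteps F (pi : T -> nat -> 'M[K]_2) pi0 P (v : T -> vec K) v0 : Filter F ->
  (forall q, (q < P)%N -> cvgMx F (fun x => pi x q) (pi0 q)) ->
  (forall s, cvgMx F (fun x => v x s) (v0 s)) ->
  forall s, cvgMx F (fun x => rsteps (pi x) P (v x) s) (rsteps pi0 P v0 s).
Proof.
move=> FF; elim: P v v0 => [//|P IH] v v0 hp hv; apply: IH.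
  by move=> q qP; apply: hp; apply: ltnW.
have h1 := hp P (ltnSn P).
move=> s; apply: cvgM_add; first apply: cvgM_mul => //.
  apply: cvgM_add; first exact: cvgM_cst.
  exact: cvgM_opp.
by case: s => [|s]; [apply: cvgM_cst|apply: cvgM_mul].
Qed.

End CvgC.

Lemma cvg_ptws (I : Type) (V : topologicalType) (T : Type) (F : set_system T)
    (f : T -> {ptws I -> V}) (f0 : {ptws I -> V}) : Filter F ->
  (forall t, (fun x => f x t) @ F --> f0 t) -> f @ F --> f0.
Proof.
move=> FF h; apply/cvg_sup => i A /=.
case=> B [[C oC <-] /= Cf] sub.
have /(h i) : nbhs (f0 i) C by apply: open_nbhs_nbhs.
move=> hC; rewrite nbhs_filterE; apply: (@filterS _ F FF _ _ _ hC) => x Cx; exact: sub.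
Qed.

Lemma cvg_ptws_proj (I : Type) (V : topologicalType) (T : Type) (F : set_system T)
    (f : T -> {ptws I -> V}) (f0 : {ptws I -> V}) : Filter F ->
  f @ F --> f0 -> forall t, (fun x => f x t) @ F --> f0 t.
Proof.
move=> FF /cvg_sup h t W hW; apply: (h t (fun g : {ptws I -> V} => W (g t))).
exact: (@initial_continuous _ _ (fun g : {ptws I -> V} => g t) f0 W hW).
Qed.

(** * The quotient topology on flags *)

Section Open.
Variable R : realType.
Local Notation K := (R[i]).
Variables (n : nat) (ii : seq nat).
Local Notation typ := (ityp ii).
Local Notation Lift := {ptws Ix n ii -> R}.
Implicit Types (x y : Lift).

Lemma cvg_Lift (T : Type) (F : set_system T) (f : T -> Lift) (f0 : Lift) : Filter F ->
  (forall l, cvgMx F (fun z => cmat (f z) l) (cmat f0 l)) -> f @ F --> f0.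
Proof.
move=> FF h; apply: cvg_ptws => -[[[l a] b] c].
have [h1 h2] := h l a b.
case: c; [move: h2|move: h1]; rewrite !mxE /=; under eq_fun do rewrite mxE /=; exact.
Qed.

Lemma cvg_cmat (T : Type) (F : set_system T) (f : T -> Lift) (f0 : Lift) : Filter F ->
  f @ F --> f0 -> forall l, cvgMx F (fun z => cmat (f z) l) (cmat f0 l).
Proof.
move=> FF h l a b; rewrite mxE; under eq_fun do rewrite mxE.
have hp t : (fun z => f z t) @ F --> f0 t.
  exact: cvg_ptws_proj.
by split; apply: hp.
Qed.

Definition actD (D : 'I_(size ii) -> 'M[K]_n) (y : Lift) : Lift := fun t : Ix n ii =>
  let z := (D t.1.1.1 *m cmat y t.1.1.1) t.1.1.2 t.1.2 in
  if t.2 then complex.Im z else complex.Re z.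

Lemma cmat_actD D y l : cmat (actD D y) l = D l *m cmat y l.
Proof.
apply/matrixP => a b; rewrite mxE /actD /=.
by case: ((D l *m cmat y l) a b).
Qed.

Lemma actD_continuous D : continuous (actD D).
Proof.
move=> y; apply: (@cvg_Lift Lift (nbhs y) (actD D) (actD D y)) => l.
have -> : (fun z => cmat (actD D z) l) = (fun z => D l *m cmat z l).
  by apply/funext => z; rewrite cmat_actD.
rewrite cmat_actD; apply: cvgM_mul; first exact: cvgM_cst.
exact: (@cvg_cmat Lift (nbhs y) id y _ (fun W h => h)).
Qed.

(** The changes of basis between lifts of one flag; the vanishing block keeps the rows of index at
    least i_l equal to zero. *)
Definition goodD (D : 'I_(size ii) -> 'M[K]_n) := forall l : 'I_(size ii), D l \in unitmx /\
  forall a b : 'I_n, (typ l <= a)%N -> (b < typ l)%N -> D l a b = 0.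

Lemma cmat_row0 y (l : 'I_(size ii)) (a : 'I_n) : is_lift y -> (typ l <= a)%N -> row a (cmat y l) = 0.
Proof. by move=> yl h; apply/rowP => b; rewrite !mxE !(yl l).1. Qed.

Lemma goodD_lift D y : goodD D -> is_lift y -> is_lift (actD D y) /\ flagof (actD D y) = flagof y.
Proof.
move=> hD yl; have hf l : (D l *m cmat y l :=: cmat y l)%MS.
  by apply: eqmxMfull; rewrite row_full_unit; case: (hD l).
split=> [l|]; last by apply/ffunP => l; rewrite !ffunE cmat_actD; apply/eq_genmx.
have [Du Dz] := hD l; split; last by rewrite cmat_actD hf; case: (yl l).
move=> a b c ta.
have : (cmat (actD D y) l) a b = 0.
  rewrite cmat_actD mxE big1 // => d _; case: (ltnP d (typ l)) => dl.
    by rewrite Dz ?mul0r.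
  by have /rowP /(_ b) := cmat_row0 yl dl; rewrite !mxE => ->; rewrite mulr0.
by rewrite mxE => /eqP; rewrite eq_complex /= => /andP[/eqP h1 /eqP h2]; case: c.
Qed.

(** The kernel of the lift [y] at l is spanned by the unit rows of index at least i_l. It contains
    the rows of [D l] of such an index, because the corresponding rows of [x] vanish; this is the
    vanishing block. *)
Lemma goodD_exists x y : (forall l : 'I_(size ii), (typ l <= n)%N) ->
  is_lift x -> is_lift y -> flagof x = flagof y ->
  exists2 D, goodD D & actD D y = x.
Proof.
move=> tn xl yl E.
have H l : exists2 D : 'M[K]_n, D \in unitmx & cmat x l = D *m cmat y l.
  apply/eqmxMunitP; move/ffunP: E => /(_ l); rewrite !ffunE.
  by move=> /genmxP.
pose D l := sval (cid2 (H l)).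
have Du l : D l \in unitmx by rewrite /D; case: (cid2 _).
have DE l : cmat x l = D l *m cmat y l by rewrite /D; case: (cid2 _).
exists D; last first.
  apply/funext => -[[[l a] b] c].
  have := DE l => /matrixP /(_ a b); rewrite -cmat_actD !mxE => -[h1 h2].
  by case: c.
move=> l; split=> // a b ta bl.
have rk : \rank (kermx (cmat y l)) = (n - typ l)%N by rewrite mxrank_ker; case: (yl l) => _ ->.
have cp : (copid_mx (typ l) : 'M[K]_n) *m cmat y l = 0.
  apply/row_matrixP => c; rewrite row_mul row0.
  apply/rowP => d; rewrite [RHS]mxE mxE big1 // => e _; rewrite !mxE.
  case: (ltnP e (typ l)) => el.
    have -> : (c == e) = ((c : nat) == e) by [].
    by case: eqP => [->|_]; rewrite ?el subrr mul0r.
  by rewrite !(yl l).1 // mulr0.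
have sub : (copid_mx (typ l) <= kermx (cmat y l))%MS by apply/sub_kermxP.
have sub2 : (kermx (cmat y l) <= (copid_mx (typ l) : 'M[K]_n))%MS.
  by have [_ <-] := mxrank_leqif_sup sub; rewrite rk rank_copid_mx.
have : (row a (D l) <= (copid_mx (typ l) : 'M[K]_n))%MS.
  apply: submx_trans sub2; apply/sub_kermxP.
  by rewrite -row_mul -DE; apply: cmat_row0.
case/submxP => e /rowP /(_ b); rewrite !mxE => ->.
rewrite big1 // => c _; rewrite !mxE.
have -> : (c == b) = ((c : nat) == b) by [].
by case: eqP => [->|_]; rewrite ?bl subrr mulr0.
Qed.

(** The saturation of an open set is the union of its preimages under the changes of basis, which
    act continuously. *)
Lemma flagof_open (U : set Lift) : (forall l : 'I_(size ii), (typ l <= n)%N) ->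
  open U -> open (@flagof R n ii @` (U `&` @is_lift R n ii)).
Proof.
move=> tn oU; rewrite -[open _]/(flag_open _) /flag_open; apply/open_subspaceP.
exists (\bigcup_(D in goodD) (actD D @^-1` U)).
  apply: bigcup_open => D _; apply: open_comp => // y _; exact: actD_continuous.
rewrite eqEsubset; split=> y [].
  move=> [D hD Uy] yl; have [dl dE] := goodD_lift hD yl.
  by split => //; exists (actD D y).
move=> [x [Ux xl] E] yl; split => //.
by have [D hD hx] := goodD_exists tn xl yl E; exists D => //=; rewrite hx.
Qed.

(** Since the quotient map is open, limits at a flag can be computed at any one of its lifts, also
    relative to a subset. *)
Lemma near_flagof (A : set (flagsp R n ii)) x0 (P : set (flagsp R n ii)) :
  (forall l : 'I_(size ii), (typ l <= n)%N) -> is_lift x0 ->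
  (\forall x \near within (@is_lift R n ii `&` @flagof R n ii @^-1` A) (nbhs x0), P (flagof x)) ->
  \forall F \near within A (nbhs (flagof x0)), P F.
Proof.
move=> tn xl hB.
have : nbhs x0 [set t : Lift | is_lift t /\ A (flagof t) -> P (flagof t)] by exact: hB.
rewrite nbhsE => -[U [oU Ux] sub].
have : nbhs (flagof x0) (@flagof R n ii @` (U `&` @is_lift R n ii)).
  by apply: open_nbhs_nbhs; split; [exact: flagof_open|exists x0].
by apply: filterS => F [x [Ux' xl'] <-] AF; apply: sub.
Qed.

Lemma cvg_flagof (Z : topologicalType) (A : set (flagsp R n ii)) x0 (g : flagsp R n ii -> Z) :
  (forall l : 'I_(size ii), (typ l <= n)%N) -> is_lift x0 ->
  g (flagof x) @[x --> within (@is_lift R n ii `&` @flagof R n ii @^-1` A) (nbhs x0)] --> g (flagof x0) ->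
  g @ within A (nbhs (flagof x0)) --> g (flagof x0).
Proof. by move=> tn xl h W /h hW; apply: (near_flagof tn xl). Qed.

Lemma flagof_cvg (T : Type) (F : set_system T) (f : T -> Lift) (f0 : Lift) : Filter F ->
  is_lift f0 -> (\forall z \near F, is_lift (f z)) -> f @ F --> f0 ->
  (fun z => flagof (f z)) @ F --> flagof f0.
Proof.
move=> FF l0 hl hf W; rewrite nbhsE => -[U [oU U0] UW].
have : flag_open U by exact: oU.
move=> /open_subspaceP[V oV E].
have V0 : V f0.
  by have [] : (V `&` @is_lift R n ii) f0 by rewrite E; split.
have hV : \forall z \near F, V (f z).
  by apply: (hf V); apply: open_nbhs_nbhs; split.
change (F [set z | W (flagof (f z))]).
apply: filterS2 hV hl => z Vz lz; apply: UW.
suff : ((@flagof R n ii @^-1` U) `&` @is_lift R n ii) (f z) by case.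
by rewrite -E; split.
Qed.

End Open.

(** * Density of the cells *)

Section Dense.
Variable R : realType.
Local Notation K := (R[i]).
Variables (n k : nat) (ii : seq nat).
Local Notation m := (n - k)%N.
Local Notation N := (m + n)%N.
Local Notation Fm := (fproj K).
Local Notation typ := (ityp ii).
Local Notation dblpos := (double_first n k ii).
Local Notation rep := (@flag_rep R n k ii).
Local Notation Lift := {ptws Ix n ii -> R}.
Local Notation liftx := (@stiefel_lift R n k ii).
Implicit Types (pi : nat -> 'M[K]_2).

Definition validch pi (ch : nat -> 'I_2) := forall a, (a < n)%N -> row (ch a) (pi (m + a)%N) != 0.

Lemma cmat_stiefel_liftE pi ch l a b : cmat (liftx pi ch) l a b =
  if (a < typ l)%N then bvec n k pi ch a b 0 (cmp n k b) else 0.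
Proof.
by rewrite mxE /liftx /=; case: ifP => _ //; case: (bvec _ _ _ _ _ _ _ _).
Qed.

Lemma cvg_stiefel_lift (T : Type) (F : set_system T) (pi : T -> nat -> 'M[K]_2) pi0 ch :
  Filter F -> (forall q, (q < N)%N -> cvgMx F (fun z => pi z q) (pi0 q)) ->
  forall l, cvgMx F (fun z => cmat (liftx (pi z) ch) l) (cmat (liftx pi0 ch) l).
Proof.
move=> FF h l a b; rewrite cmat_stiefel_liftE; under eq_fun do rewrite cmat_stiefel_liftE.
case: ifP => _; last exact: cvgC_cst.
have aN : (m + a < N)%N by rewrite ltn_add2l.
rewrite /bvec.
have H := @cvgM_rsteps R T F pi pi0 (m + a)
  (fun z => const_vec (row (ch a) (pi z (m + a)%N))) (const_vec (row (ch a) (pi0 (m + a)%N))) FF.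
apply: (H _ _ b 0 (cmp n k b)) => [q qa|s].
  by apply: h; apply: ltn_trans aN.
rewrite /const_vec; case: (s == 0%N); last exact: cvgM_cst.
by apply: cvgM_row; apply: h.
Qed.

Lemma validch_exists pi : prjs N pi -> exists ch, validch pi ch.
Proof.
move=> hp; have H a : exists c : 'I_2, (a < n)%N -> row c (pi (m + a)%N) != 0.
  case: (ltnP a n) => an; last by exists 0 => //; rewrite ltnNge an.
  have aN : (m + a < N)%N by rewrite ltn_add2l.
  by have [c hc] := prj_row (hp _ aN); exists c.
by have [ch hch] := choice H; exists ch.
Qed.

Hypothesis hv : valid_type n ii.
Variable w : seq (bool * bool).
Hypothesis hw : row_strict n k ii w.
Hypothesis hnk : (2 * k <= n)%N.
Local Notation lab := (labw n k ii w).
Let h12 := typ12 hv hw.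
Let kn : (k <= n)%N. Proof. by lia. Qed.

Lemma cup_params_stiefel_lift pi ch : cup_params n k ii w pi -> validch pi ch ->
  [/\ is_lift (liftx pi ch), rep (flagof (liftx pi ch)) pi & springer_lift k (liftx pi ch)].
Proof.
move=> hpi hch; have hT := cup_params_total hv hw hnk hpi; have [g _ _] := hpi.
split; first exact: (stiefel_lift_is_lift hv g hT kn hch).
  exact: (stiefel_lift_rep hv g hT kn hch).
exact: (stiefel_lift_springer hv h12 g hT kn hch).
Qed.

Lemma perturb_neq0 (u : 'rV[K]_2) (t : K) : u != 0 -> u + t *: perp u != 0.
Proof.
move=> u0; apply/eqP => E.
have pk : perp u *m herm u = 0.
  rewrite -{1}(mul_herm_id (perp_neq0 u0)) herm_perp // -mulmxA mulmxBl mul1mx herm_idem //.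
  by rewrite subrr mulmx0.
have := congr1 (fun z => z *m herm u) E.
rewrite mulmxDl mul_herm_id // -scalemxAl pk scaler0 addr0 mul0mx => h.
by rewrite h eqxx in u0.
Qed.

Lemma perturb_neq (u : 'rV[K]_2) (t : K) : u != 0 -> t != 0 ->
  herm (u + t *: perp u) <> herm u.
Proof.
move=> u0 t0 E.
have pk : perp u *m herm u = 0.
  rewrite -{1}(mul_herm_id (perp_neq0 u0)) herm_perp // -mulmxA mulmxBl mul1mx herm_idem //.
  by rewrite subrr mulmx0.
have := mul_herm_id (perturb_neq0 t u0); rewrite E mulmxDl mul_herm_id // -scalemxAl pk scaler0.
move=> /addrI /esym /eqP; rewrite scaler_eq0 (negbTE t0) /=.
by rewrite (negbTE (perp_neq0 u0)).
Qed.

Definition perturb pi (j c : nat) (r : 'M[K]_2) q :=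
  if q == j then r else if q == c then 1%:M - r else pi q.

Lemma cup_params_perturb pi j c r : cup_params n k ii w pi -> (j < N)%N -> (c < N)%N ->
  ~~ dblpos j -> (m <= j)%N -> j \notin bstack lab N -> matched lab j c -> prj r ->
  cup_params n k ii w (perturb pi j c r).
Proof.
move=> [[hp hF hd] hc hs] jN cN dj mj jS jc pr.
have [jltc lj lc _ _] := matchedP jc.
have labc q : lab q -> q == c = false by move=> lq; apply/eqP => E; rewrite -E lq in lc.
split; [split|..].
- move=> q qN; rewrite /perturb; case: ifP => // _; case: ifP => // _; last exact: hp.
  exact: prj_compl.
- move=> q qm; rewrite /perturb labc ?lab_left //.
  by case: eqP => [E|_]; [rewrite E ltnNge mj in qm|apply: hF].
- move=> q dq; have [d1 d2] := hd q dq; have [lq lq1] := double_first_lab hv h12 hw dq.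
  rewrite /perturb labc //; case: eqP => [E|_]; first by rewrite E (negbTE dj) in dq.
  split=> //; case: eqP => [E|_]; first by rewrite E lj in lq1.
  case: eqP => // E; have := matched_injl jc; rewrite -E => /(_ _ (double_matched (double_first_lab hv h12 hw) dq)) E'.
  by rewrite -E' (negbTE dj) in dq.
- move=> a b bN ab; have [altb la lb _ _] := matchedP ab.
  rewrite /perturb (labc a la); case: (eqVneq b j) => [E|bj].
    by rewrite E lj in lb.
  case: (eqVneq a j) => [E|aj].
    by rewrite E in ab; rewrite (matched_injr ab jc) eqxx.
  case: (eqVneq b c) => [E|nbc]; last exact: hc.
  by rewrite E in ab; rewrite (matched_injl ab jc) eqxx in aj.
- move=> q qS; have [_ lq] := mem_bstack qS; rewrite /perturb labc //.
  by case: eqP => [E|_]; [rewrite -E qS in jS|apply: hs].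
Qed.

(** At a prepended position or a vee open at [N], the projector and those of all vees open before it
    belong to the line of f, and that line is not orthogonal to itself. *)
Lemma nongeneric_free pi j : cup_params n k ii w pi -> (j < N)%N -> pi j = ctop lab pi j ->
  (m <= j)%N /\ j \notin bstack lab N.
Proof.
move=> [[hp hF hd] hc hs] jN Ej.
have H : pi j = Fm -> (forall x, x \in bstack lab j -> pi x = Fm) -> False.
  move=> h1 h2; apply: (prj_neq_compl (prj_fproj K)).
  move: Ej; rewrite h1 /ctop; case E: (bstack lab j) => [|x s] //.
  by rewrite h2 ?E ?mem_head.
split.
  rewrite leqNgt; apply/negP => jm; apply: H; first exact: hF.
  by move=> x /mem_bstack[xj _]; apply: hF; apply: ltn_trans jm.
apply/negP => jS; apply: H; first exact: hs.
move=> x xj; apply: hs; have [pre ->] := bstack_split jS.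
by rewrite mem_cat inE xj !orbT.
Qed.

Lemma cvgC_real0 (F : set_system R) : Filter F -> (id : R -> R) @ F --> (0 : R) ->
  cvgC F (fun t : R => (t +i* 0)%C) 0.
Proof. by move=> FF h; split => //; apply: cvg_cst. Qed.

(** Induction on the number [d] of last positions where genericity may fail. If it fails at the
    first of them, that position is the left end of a cup inside the range and can be moved. Turning
    its line by a real parameter t, and the line of its partner accordingly, restores genericity
    there for t != 0 and affects no earlier position. The polynomial vanishes for t != 0 by
    induction and at t = 0 by continuity. *)
Lemma cup_params_dense (p : _ -> K) : polyfun p ->
  (forall y : Lift, is_lift y -> Ycirc R n k ii w (flagof y) -> p (cvec y) = 0) ->
  forall d pi ch, cup_params n k ii w pi -> (forall q, (q < N - d)%N -> generic lab dblpos pi q) ->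
  validch pi ch -> p (cvec (liftx pi ch)) = 0.
Proof.
move=> pp hy; elim=> [|d IH] pi ch hpi hg hch.
  have [h1 h2 h3] := cup_params_stiefel_lift hpi hch; apply: hy => //.
  by apply: (generic_Ycirc hv hw hnk h3 hpi h2) => q qN; apply: hg; rewrite subn0.
case: (leqP N d) => Nd.
  by apply: IH => // q; rewrite (eqP (_ : N - d == 0)%N) // subn_eq0.
set j := (N - d.+1)%N.
have jN : (j < N)%N by rewrite /j; lia.
have Ej : (N - d = j.+1)%N by rewrite /j; lia.
case: (pselect (generic lab dblpos pi j)) => [gj|ngj].
  apply: IH => // q; rewrite Ej ltnS leq_eqVlt => /orP[/eqP -> //|]; exact: hg.
have lj : lab j by apply: contrapT => h; apply: ngj => a; case: (h a).
have dj : ~~ dblpos j by apply: contrapT => h; apply: ngj => _ b; case: (h b).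
have Eq : pi j = ctop lab pi j by apply: contrapT => h; apply: ngj => _ _; apply: h.
have [mj jS] := nongeneric_free hpi jN Eq.
have [c cN jc] := matched_exists jN lj jS.
have [jltc _ lc _ _] := matchedP jc.
have [[hp hF hd] hc hs] := hpi.
have [u u0 Eu] := hp j jN.
pose r (t : R) := herm (u + (t +i* 0)%C *: perp u).
pose pit t := perturb pi j c (r t).
have prt t : prj (r t) by apply/prj_herm/perturb_neq0.
have hPt t : cup_params n k ii w (pit t) by apply: cup_params_perturb.
pose F := (0 : R)^'.
have FF : ProperFilter F by apply: Proper_dnbhs_numFieldType.
have cid : (id : R -> R) @ F --> (0 : R).
  by move=> A hA; apply: (cvg_within _ hA).
have cr : cvgMx F r (pi j).
  rewrite Eu -{1}[u]addr0 -{1}(scale0r (perp u)); apply: cvgM_herm.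
  - apply: cvgM_add; first exact: cvgM_cst.
    move=> a b; rewrite mxE; under eq_fun do rewrite mxE.
    apply: cvgC_mul; last exact: cvgC_cst.
    exact: cvgC_real0.
  - by rewrite scale0r addr0.
have cpi q : (q < N)%N -> cvgMx F (fun t => pit t q) (pi q).
  move=> qN; rewrite /pit /perturb; case: eqP => [->|_]; first exact: cr.
  case: eqP => [->|_]; last exact: cvgM_cst.
  rewrite (hc j c cN jc); apply: cvgM_add; first exact: cvgM_cst.
  exact: cvgM_opp.
have cl := cvg_stiefel_lift ch _ cpi.
have cp : cvgC F (fun t => p (cvec (liftx (pit t) ch))) (p (cvec (liftx pi ch))).
  apply: cvgC_polyfun pp => -[[l a] b].
  have := cl _ l a b; rewrite mxE; under eq_fun do rewrite mxE; exact.
apply: (cvgC_unique FF cp); apply: (@cvgC_eq _ _ _ _ (fun=> 0)); last exact: cvgC_cst.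
(* The rows selected at t = 0 stay nonzero nearby, so one selection serves for all small t and the
   lift varies continuously. *)
have near_ch : \forall t \near F, validch (pit t) ch.
  have : \forall t \near F, forall a : 'I_n, row (ch a) (pit t (m + a)%N) != 0.
    apply: filter_forall => a; apply: (cvgM_near (A := row (ch a) (pi (m + a)%N))).
      by apply: cvgM_row; apply: cpi; rewrite ltn_add2l.
    exact: hch.
  by apply: filterS => t h a an; apply: (h (Ordinal an)).
have near_t : \forall t \near F, t != 0 by apply: nbhs_dnbhs_neq.
apply: filterS2 near_ch near_t => t ht t0.
apply: IH => // q; rewrite Ej ltnS leq_eqVlt => /orP[/eqP ->|qj].
  move=> _ _; rewrite /pit {1}/perturb eqxx.
  have -> : ctop lab (perturb pi j c (r t)) j = pi j.
    rewrite Eq /ctop; case E: (bstack lab j) => [//|x s].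
    have [xj _ _] := bstack_cons E; rewrite /perturb ltn_eqF // ltn_eqF //.
    exact: ltn_trans jltc.
  rewrite Eu; apply: perturb_neq => //.
  by apply: contra t0; rewrite eq_complex /= => /andP[].
have Epq x : (x <= q)%N -> pit t x = pi x.
  move=> xq; have xj := leq_ltn_trans xq qj.
  by rewrite /pit /perturb ltn_eqF // ltn_eqF // (ltn_trans xj).
move=> lq dq; rewrite Epq //.
have -> : ctop lab (pit t) q = ctop lab pi q; last exact: hg.
rewrite /ctop; case E: (bstack lab q) => [//|x s].
by have [xq _ _] := bstack_cons E; rewrite Epq // ltnW.
Qed.

(** The conditions are closed and hold on the cell; conversely, the cell is dense among their
    solutions, each of which has an explicit lift. *)
Lemma YtilP F : Ytil R n k ii w F <->
  exists x pi, [/\ is_lift x, flagof x = F, cup_params n k ii w pi & rep F pi].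
Proof.
split=> [[x [xl <- hx]]|[x [pi [xl <- hpi hx]]]].
  by have [pi h1 h2] := closure_cup_params hv hw hnk xl hx; exists x, pi.
have [[hp hF hd] hc hs] := hpi.
have [ch hch] := validch_exists hp.
have [h1 h2 h3] := cup_params_stiefel_lift hpi hch.
exists (liftx pi ch); split=> //; first exact: flag_rep_inj h2 hx.
move=> p pp hy; apply: (cup_params_dense pp hy (d := N)) => // q.
by rewrite subnn.
Qed.

End Dense.

Lemma within_comp (S T U : topologicalType) (A : set S) (B : set T) (h : S -> T) (g : T -> U) a :
  (forall x, A x -> B (h x)) -> h @ within A (nbhs a) --> h a ->
  g @ within B (nbhs (h a)) --> g (h a) ->
  (fun x => g (h x)) @ within A (nbhs a) --> g (h a).
Proof.
move=> AB hh hg W hW.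
have h1 : nbhs (h a) [set y | B y -> W (g y)] by exact: (hg W hW).
have h2 : nbhs a [set x | A x -> B (h x) -> W (g (h x))] by exact: (hh _ h1).
have h3 : nbhs a [set x | A x -> W (g (h x))].
  by apply: filterS h2 => x H Ax; apply: H => //; apply: AB.
exact: h3.
Qed.

(** * Projectors and the projective line *)

Section CP1.
Variable R : realType.
Local Notation K := (R[i]).
Local Notation P1 := (flagsp R 2 [:: 1%N]).
Local Notation Lift2 := {ptws Ix 2 [:: 1%N] -> R}.
Local Notation l0 := (ord0 : 'I_(size [:: 1%N])).

Definition lift2 (u : 'rV[K]_2) : Lift2 := fun t : Ix 2 [:: 1%N] =>
  if t.1.1.2 == 0 then (if t.2 then complex.Im (u 0 t.1.2) else complex.Re (u 0 t.1.2)) else 0.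

Lemma cmat_lift2 u l : cmat (lift2 u) l = delta_mx 0 0 *m u.
Proof.
apply/matrixP => a b; rewrite mxE /lift2 /= mxE (bigD1 0) //= big1 => [|c c0].
  rewrite addr0 mxE andbT; case: ifP => _; last by rewrite mul0r.
  by rewrite mul1r; case: (u 0 b).
by rewrite (ord1 c) eqxx in c0.
Qed.

Lemma sub_lift2 u l (v : 'rV[K]_2) : (v <= flagof (lift2 u) l)%MS <-> exists c, v = c *: u.
Proof.
rewrite ffunE genmxE cmat_lift2; split.
  case/submxP=> D ->; rewrite mulmxA; exists ((D *m delta_mx 0 0 : 'rV_1) 0 0).
  by rewrite [X in X *m u]mx11_scalar mul_scalar_mx.
move=> [c ->]; apply: scalemx_sub.
have {1}-> : u = (delta_mx 0 0 : 'rV_2) *m (delta_mx 0 0 *m u).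
  by rewrite mulmxA mul_delta_mx; rewrite [X in X *m u]mx11_scalar mxE !eqxx mul_scalar_mx scale1r.
exact: submxMl.
Qed.

Lemma lift2_lift u : u != 0 -> is_lift (lift2 u).
Proof.
move=> u0 l; have El : l = l0 by apply: ord1.
split; first by move=> a b c; rewrite El /ityp /= lt0n /lift2 /= => /negbTE E; rewrite -val_eqE /= E.
rewrite cmat_lift2 El /ityp /=; apply/eqP; rewrite eqn_leq; apply/andP; split.
  by apply: leq_trans (mxrankM_maxl _ _) _; rewrite mxrank_delta.
rewrite lt0n mxrank_eq0; apply: contraNneq u0 => h; apply/eqP/rowP => b.
have /matrixP /(_ 0 b) := h; rewrite !mxE (bigD1 0) //= big1 => [|c c0].
  by rewrite mxE eqxx /= mul1r addr0.
by rewrite (ord1 c) eqxx in c0.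
Qed.

Lemma CP1_eq (F G : P1) : CP1 R F -> CP1 R G ->
  (forall v : 'rV[K]_2, (v <= F l0)%MS <-> (v <= G l0)%MS) -> F = G.
Proof.
move=> [x [_ <-]] [y [_ <-]] h; apply/ffunP => l; have -> : l = l0 by apply: ord1.
rewrite !ffunE; apply/eq_genmx/eqmxP/andP; split; apply/row_subP => a.
  by have := (h (row a (cmat x l0))).1; rewrite !ffunE !genmxE row_sub; apply.
by have := (h (row a (cmat y l0))).2; rewrite !ffunE !genmxE row_sub; apply.
Qed.

Definition nzrow (p : 'M[K]_2) : 'I_2 := if row 0 p != 0 then 0 else 1.
Definition toCP (p : 'M[K]_2) : P1 := flagof (lift2 (row (nzrow p) p)).
Definition ofCP (F : P1) : 'M[K]_2 := herm (row (nzrow (F l0)) (F l0)).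

Lemma nzrow_neq0 (p : 'M[K]_2) : p != 0 -> row (nzrow p) p != 0.
Proof.
rewrite /nzrow => p0; case: ifP => // /negbFE /eqP h0.
apply: contraNneq p0 => h1; apply/eqP/row_matrixP => a.
by rewrite row0; case: (ord2P a) => ->.
Qed.

Lemma prj_neq0 (p : 'M[K]_2) : prj p -> p != 0.
Proof.
move=> pp; have [a] := prj_row pp; apply: contraNneq => ->; by rewrite row0.
Qed.

Lemma toCP_CP1 p : prj p -> CP1 R (toCP p).
Proof.
by move=> pp; eexists; split; last reflexivity; apply/lift2_lift/nzrow_neq0/prj_neq0.
Qed.

Lemma sub_toCP p (v : 'rV[K]_2) : prj p -> (v <= toCP p l0)%MS <-> v *m p = v.
Proof.
move=> pp; rewrite sub_lift2; have n0 := nzrow_neq0 (prj_neq0 pp); split.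
  by move=> [c ->]; rewrite -scalemxAl row_prj.
exact: (prj_fix_line pp n0 (row_prj _ pp)).
Qed.

Lemma toCP_row p u : prj p -> u != 0 -> u *m p = u -> toCP p = flagof (lift2 u).
Proof.
move=> pp u0 up; apply: CP1_eq; first exact: toCP_CP1.
  by eexists; split; last reflexivity; exact: lift2_lift.
move=> v; rewrite sub_toCP // sub_lift2; split; first exact: prj_fix_line pp u0 up.
by move=> [c ->]; rewrite -scalemxAl up.
Qed.

Lemma ofCP_flagof (x : Lift2) : is_lift x -> let u := row 0 (cmat x l0) in
  [/\ u != 0, ofCP (flagof x) = herm u & flagof x = flagof (lift2 u)].
Proof.
move=> xl u.
have E : cmat x l0 = delta_mx 0 0 *m u.
  apply/row_matrixP => a; rewrite row_mul; apply/rowP => b.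
  rewrite [RHS]mxE big_ord1 [row a (delta_mx _ _) _ _]mxE [delta_mx _ _ _ _]mxE eqxx andbT.
  case: (ord2P a) => ->; first by rewrite mul1r.
  by rewrite mul0r !mxE !(xl l0).1.
have rk : \rank (cmat x l0) = 1%N by case: (xl l0).
have u0 : u != 0.
  by apply: contra_eqN rk => /eqP h; rewrite E h mulmx0 mxrank0.
have Ef : flagof x = flagof (lift2 u).
  apply/ffunP => l; have -> : l = l0 by apply: ord1.
  by rewrite !ffunE E cmat_lift2.
split=> //; rewrite /ofCP.
have F0 : flagof x l0 != 0 by rewrite -mxrank_eq0 ffunE mxrank_gen rk.
have n0 := nzrow_neq0 F0.
have : (row (nzrow (flagof x l0)) (flagof x l0) <= flagof (lift2 u) l0)%MS by rewrite -Ef row_sub.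
move=> /sub_lift2[c Ec]; rewrite Ec herm_scale //.
by apply: contraNneq n0 => c0; rewrite Ec c0 scale0r.
Qed.

Lemma ofCP_prj F : CP1 R F -> prj (ofCP F).
Proof.
by move=> [x [xl <-]]; have [u0 -> _] := ofCP_flagof xl; apply: prj_herm.
Qed.

Lemma ofCPK F : CP1 R F -> toCP (ofCP F) = F.
Proof.
move=> [x [xl <-]]; have [u0 -> ->] := ofCP_flagof xl.
by apply: toCP_row => //; [apply: prj_herm|apply: mul_herm_id].
Qed.

Lemma toCPK p : prj p -> ofCP (toCP p) = p.
Proof.
move=> pp; have n0 := nzrow_neq0 (prj_neq0 pp).
have [u0 -> _] := ofCP_flagof (lift2_lift n0).
rewrite cmat_lift2.
have -> : row 0 ((delta_mx 0 0 : 'cV_2) *m row (nzrow p) p) = row (nzrow p) p.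
  rewrite row_mul; have -> : row 0 (delta_mx 0 0 : 'cV[K]_2) = 1%:M.
    by apply/matrixP => a b; rewrite !mxE (ord1 a) (ord1 b) !eqxx.
  by rewrite mul1mx.
by rewrite -(prj_fix pp n0 (row_prj _ pp)).
Qed.

Lemma typ1_le (l : 'I_(size [:: 1%N])) : (ityp [:: 1%N] l <= 2)%N.
Proof. by have -> : l = l0 by apply: ord1. Qed.

Lemma cvg_ofCP F0 : CP1 R F0 -> cvgMx (within (CP1 R) (nbhs F0)) ofCP (ofCP F0).
Proof.
move=> [x0 [xl <-]].
pose G := within (@is_lift R 2 [:: 1%N] `&` @flagof R 2 [:: 1%N] @^-1` CP1 R) (nbhs x0).
have FG : Filter G by apply: within_filter.
have H : cvgMx G (fun x => ofCP (flagof x)) (ofCP (flagof x0)).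
  have [u0 -> _] := ofCP_flagof xl.
  apply: (@cvgM_eq _ _ G _ _ _ (fun x : Lift2 => herm (row 0 (cmat x l0)))).
    apply: filterS (withinT _ _) => x [xl' _].
    by have [] := ofCP_flagof xl'.
  apply: cvgM_herm => //; apply: cvgM_row.
  exact: (@cvg_cmat R 2 [:: 1%N] Lift2 G id x0 FG (cvg_within _) l0).
move=> a b; have [h1 h2] := H a b.
split.
  exact: (cvg_flagof (g := fun F => complex.Re (ofCP F a b)) typ1_le xl h1).
exact: (cvg_flagof (g := fun F => complex.Im (ofCP F a b)) typ1_le xl h2).
Qed.

(** The index chosen by [nzrow] may jump. Near [p0], however, the row chosen at [p0] stays nonzero
    and spans the same line as the chosen one. *)
Lemma cvg_toCP (T : Type) (F : set_system T) (f : T -> 'M[K]_2) p0 : Filter F ->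
  prj p0 -> (\forall z \near F, prj (f z)) -> cvgMx F f p0 ->
  (fun z => toCP (f z)) @ F --> toCP p0.
Proof.
move=> FF pp hp hf; set a := nzrow p0.
have n0 : row a p0 != 0 := nzrow_neq0 (prj_neq0 pp).
have cr : cvgMx F (fun z => row a (f z)) (row a p0) by apply: cvgM_row.
have hn := cvgM_near FF cr n0.
have c1 : (fun z => flagof (lift2 (row a (f z)))) @ F --> toCP p0.
  apply: flagof_cvg; first exact: lift2_lift.
    by apply: filterS hn => z; apply: lift2_lift.
  apply: cvg_Lift => l; rewrite cmat_lift2.
  have -> : (fun z => cmat (lift2 (row a (f z))) l) = (fun z => delta_mx 0 0 *m row a (f z)).
    by apply/funext => z; rewrite cmat_lift2.
  by apply: cvgM_mul => //; apply: cvgM_cst.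
apply: cvg_trans c1; apply: near_eq_cvg.
by apply: filterS2 hn hp => z hz pz; rewrite (toCP_row pz hz) // row_prj.
Qed.

(** * Finite products of projective lines *)

Definition base : P1 := toCP (fproj K).

Local Notation Seq := {ptws nat -> P1}.

(** The product of [l] lines inside one ambient space common to all [l], which lets total space and
    fibre be of the same form in the induction. *)
Definition CPn (l : nat) : set Seq :=
  [set t : Seq | (forall j, (j < l)%N -> CP1 R (t j)) /\ forall j, (l <= j)%N -> t j = base].
Definition upd (t : Seq) (l : nat) (b : P1) : Seq := fun j => if j == l then b else t j.

Lemma upd_in t l b : CPn l t -> CP1 R b -> CPn l.+1 (upd t l b).
Proof.
move=> [h1 h2] hb; split=> j; rewrite /upd.
  by rewrite ltnS leq_eqVlt; case: eqP => //= _; apply: h1.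
by move=> lj; rewrite gtn_eqF //; apply: h2; apply: ltnW.
Qed.

Lemma upd_out t l : CPn l.+1 t -> CPn l (upd t l base) /\ CP1 R (t l).
Proof.
move=> [h1 h2]; split; last exact: h1.
split=> j; rewrite /upd.
  by move=> jl; rewrite ltn_eqF //; apply: h1; apply: ltnW.
by rewrite leq_eqVlt eq_sym; case: eqP => //= _; apply: h2.
Qed.

(** The last coordinate is a trivial bundle over CP^1 whose fibre is the product of the other
    coordinates; resetting this coordinate to the base point gives the global trivialization. *)
Lemma iter_bundle_of_homeo l : forall (T : topologicalType) (X : set T) (f : T -> Seq),
  homeo_on X (CPn l) f -> iter_bundle R l X.
Proof.
elim: l => [|l IH] T X f [g [fX gB gf fg [cf cg]]].
  exists (g (fun=> base)); rewrite eqEsubset; split=> x /=.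
    move=> Xx; rewrite -(gf _ Xx); congr g; apply/funext => j.
    by have [_ h] := fX _ Xx; apply: h.
  by move=> ->; apply: gB; split.
move/subspace_continuousP: cf => cf; move/subspace_continuousP: cg => cg.
exists Seq, (CPn l), (fun x => f x l); split; last first.
  apply: (IH _ _ id); exists id; split=> //.
  by split; apply/subspace_continuousP => x _; apply: cvg_within.
have cfl x : X x -> (fun x => f x l) @ within X (nbhs x) --> f x l.
  by move=> Xx; apply: (cvg_ptws_proj (f := f)); exact: cf.
split.
- by move=> x /fX[h _]; apply: h.
- exact/subspace_continuousP.
move=> b Bb; exists setT; split=> //; first exact: openT.
exists (fun x => (f x l, upd (f x) l base)); split=> //.
rewrite preimage_setT setIT setTI.
exists (fun bt => g (upd bt.2 l bt.1)); split.
- by move=> x /fX /upd_out[].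
- by move=> [c t] [/= h1 h2]; apply: gB; apply: upd_in.
- move=> x Xx /=; rewrite -[RHS](gf _ Xx); congr g; apply/funext => j.
  by rewrite /upd; case: eqP => [->|].
- move=> [c t] [/= h1 h2]; have hu := upd_in h2 h1; rewrite fg //; congr pair.
    by rewrite /upd eqxx.
  apply/funext => j; rewrite /upd; case: eqP => // ->.
  by have [_ ->] := h2.
split; apply/subspace_continuousP.
  move=> x Xx.
  apply: (@cvg_pair T P1 Seq (within X (nbhs x)) (nbhs (f x l)) (nbhs (upd (f x) l base)) _ _ _
    (fun x => f x l) (fun x => upd (f x) l base)).
    exact: cfl.
  apply: cvg_ptws => j; rewrite /upd; case: (eqVneq j l) => jl.
    exact: cvg_cst.
  by apply: (cvg_ptws_proj (f := f)); exact: cf.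
move=> [c t] [/= h1 h2].
apply: (@within_comp _ _ _ _ (CPn l.+1) (fun bt : P1 * Seq => upd bt.2 l bt.1) g).
- by move=> [c' t'] [/= h1' h2']; apply: upd_in.
- apply: cvg_ptws => j; rewrite /upd /=; case: (eqVneq j l) => jl.
    by apply: cvg_within_filter; exact: cvg_fst.
  apply: cvg_within_filter; apply: (cvg_ptws_proj (f := fun bt : P1 * Seq => bt.2)).
  exact: cvg_snd.
- by apply: cg; apply: upd_in.
Qed.

End CP1.

(** * The intersections *)

Section Homeo.
Variable R : realType.
Local Notation K := (R[i]).
Variables (n k : nat) (ii : seq nat).
Local Notation m := (n - k)%N.
Local Notation N := (m + n)%N.
Local Notation Fm := (fproj K).
Local Notation prv := (iprev ii).
Local Notation typ := (ityp ii).
Local Notation dblpos := (double_first n k ii).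
Local Notation rep := (@flag_rep R n k ii).
Local Notation goodpi := (@normalized R n k ii).
Local Notation Lift := {ptws Ix n ii -> R}.
Local Notation liftx := (@stiefel_lift R n k ii).
Local Notation emb := (@embV K n k).
Local Notation P1 := (flagsp R 2 [:: 1%N]).
Implicit Types (pi : nat -> 'M[K]_2).

Hypothesis hv : valid_type n ii.
Variables w w' : seq (bool * bool).
Hypothesis hw : row_strict n k ii w.
Hypothesis hw' : row_strict n k ii w'.
Hypothesis hnk : (2 * k <= n)%N.
Local Notation lab := (labw n k ii w).
Local Notation lab' := (labw n k ii w').
Let nu : no_underflow lab N. Proof. exact: labw_no_underflow. Qed.
Let nu' : no_underflow lab' N. Proof. exact: labw_no_underflow. Qed.
Let h12 := typ12 hv hw.
Let tn (l : 'I_(size ii)) : (typ l <= n)%N. Proof. exact: typ_le. Qed.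

Local Notation fxpos := (fixed_pos n k ii w w').
Local Notation edge := (circle_edge (N := N) lab lab').
Local Notation freec := (free_circle (N := N) lab lab' fxpos).
Local Notation lead := (circle_min (N := N) lab lab').
Local Notation leading := (free_leading (N := N) lab lab' fxpos).

Definition joint_params pi := cup_params n k ii w pi /\ cup_params n k ii w' pi.
Definition flip (b : bool) (p : 'M[K]_2) := if b then 1%:M - p else p.

Lemma flip_flip b c p : flip b (flip c p) = flip (b (+) c) p.
Proof. by case: b; case: c => //=; rewrite subKr. Qed.

Lemma flip_prj b p : prj p -> prj (flip b p).
Proof. by case: b => //; apply: prj_compl. Qed.

Lemma flag_rep_ext F pi pi' : (forall q, (q < N)%N -> pi q = pi' q) -> rep F pi -> rep F pi'.
Proof.
move=> h hF l v; rewrite hF /lkernel (@eq_lsteps _ pi pi') // => q qq; apply: h.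
by apply: leq_trans qq _; rewrite leq_add2l.
Qed.

Lemma cup_params_ext v pi pi' : row_strict n k ii v -> (forall q, (q < N)%N -> pi q = pi' q) ->
  cup_params n k ii v pi -> cup_params n k ii v pi'.
Proof.
move=> hv' h [[hp hF hd] hc hs]; split; [split|..].
- by move=> q qN; rewrite -h //; apply: hp.
- by move=> q qm; rewrite -h ?hF //; apply: leq_trans qm (leq_addr _ _).
- move=> q dq; have [d1 d2] := hd q dq; have [l hl [E1 E2]] := double_firstP hv h12 dq.
  have q1 : (q.+1 < N)%N by have := typ_le hv hl; lia.
  by rewrite -!h // ltnW.
- move=> i j jN c; have [ij _ _ _ _] := matchedP c.
  by rewrite -!h //; [apply: hc|apply: ltn_trans jN].
- by move=> i iS; have [iN _] := mem_bstack iS; rewrite -h //; apply: hs.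
Qed.

(** The ends of a cup have opposite parity. After passing to complements at odd positions, the
    projector is thus constant along the cups of both tableaux, and a circle imposes no condition on
    its value. *)
Lemma joint_params_edge pi (q r : 'I_N) : joint_params pi -> edge q r ->
  flip (odd q) (pi q) = flip (odd r) (pi r).
Proof.
move=> [[_ hc _] [_ hc' _]].
have H L i j : no_underflow L N -> cups_ok L N pi -> (j < N)%N -> matched L i j ->
    flip (odd i) (pi i) = flip (odd j) (pi j).
  move=> nuL hcL jN c; rewrite (hcL i j jN c) (matched_parity nuL jN c).
  by case: (odd i) => //=; rewrite subKr.
case/or4P => c.
- exact: (H lab).
- by symmetry; apply: (H lab).
- exact: (H lab').
- by symmetry; apply: (H lab').
Qed.

Lemma joint_params_connect pi (q r : 'I_N) : joint_params pi -> connect edge q r ->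
  pi q = flip (odd q (+) odd r) (pi r).
Proof.
move=> hpi c; have : flip (odd q) (pi q) = flip (odd r) (pi r).
  move: c => /connectP[p + ->]; elim: p q => //= a p IH q /andP[e /IH <-].
  exact: joint_params_edge.
by move=> /(congr1 (flip (odd q))); rewrite !flip_flip addbb.
Qed.

Lemma joint_params_fixed pi q : joint_params pi -> fxpos q -> pi q = Fm.
Proof.
move=> [[[hp hF hd] hc hs] [_ _ hs']] /or4P[].
- exact: hF.
- by move=> /hd[].
- exact: hs.
- exact: hs'.
Qed.

(** * Coordinates on the intersection relative to a known solution *)

Section Base.
Variable pi0 : nat -> 'M[K]_2.
Hypothesis hpi0 : joint_params pi0.

(** A circle through a fixed position carries the line of f there, up to complements everywhere; so
    all solutions agree with [pi0] on it. *)
Lemma joint_params_formula pi (q : 'I_N) : joint_params pi ->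
  pi q = if freec q then flip (odd q (+) odd (lead q)) (pi (lead q)) else pi0 q.
Proof.
move=> hpi; case: ifP => fq.
  by have [c _] := circle_minP lab lab' q; apply: joint_params_connect.
have [i [c fi]] : exists i : 'I_N, connect edge q i /\ fxpos i.
  apply: contrapT => h; move/negP: fq; apply; apply/forallP => i; apply/implyP => c.
  by apply/negP => fi; apply: h; exists i.
by rewrite (joint_params_connect hpi c) (joint_params_connect hpi0 c) !joint_params_fixed.
Qed.

(** On circles that are not free the values are copied from [pi0], so their consistency need not be
    checked; this is where the intersection has to be nonempty. *)
Definition build (t : nat -> 'M[K]_2) (q : nat) : 'M[K]_2 :=
  if insub q is Some a then
    if freec a then flip (odd a (+) odd (lead a)) (t (lead a)) else pi0 q
  else pi0 q.

Lemma buildE t (q : 'I_N) : build t q =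
  if freec q then flip (odd q (+) odd (lead q)) (t (lead q)) else pi0 q.
Proof. by rewrite /build valK. Qed.

Lemma build_fixed t (q : 'I_N) : fxpos q -> build t q = Fm.
Proof.
move=> fq; rewrite buildE; have -> : freec q = false; last exact: joint_params_fixed.
by apply/negP => /forallP /(_ q); rewrite connect0 fq.
Qed.

Lemma build_edge t (q r : 'I_N) : connect edge q r -> odd r = ~~ odd q ->
  pi0 r = 1%:M - pi0 q -> build t r = 1%:M - build t q.
Proof.
move=> c o Er; rewrite !buildE (free_circle_connect _ c) (circle_min_connect c); case: ifP => // _.
by rewrite o; case: (odd q); case: (odd _) => /=; rewrite ?subKr.
Qed.

Lemma build_cup_params (t : nat -> 'M[K]_2) v : row_strict n k ii v ->
  (forall i j, (j < N)%N -> matched (labw n k ii v) i j -> forall a b : 'I_N, a = i :> nat -> b = j :> nat -> edge a b) ->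
  (forall q, q \in bstack (labw n k ii v) N -> fxpos q) -> cup_params n k ii v pi0 ->
  (forall j : 'I_N, leading j -> prj (t j)) -> cup_params n k ii v (build t).
Proof.
move=> hv' he hf [[hp hF hd] hc hs] ht.
have nuv : no_underflow (labw n k ii v) N by apply: labw_no_underflow.
have cups : cups_ok (labw n k ii v) N (build t).
  move=> i j jN c; have [ij _ _ _ _] := matchedP c; have iN := ltn_trans ij jN.
  have e := he _ _ jN c (Ordinal iN) (Ordinal jN) erefl erefl.
  apply: (@build_edge t (Ordinal iN) (Ordinal jN)); first exact: connect1.
    exact: (matched_parity nuv jN c).
  exact: hc.
split=> //; [split|].
- move=> q qN; rewrite (buildE t (Ordinal qN)); case: ifP => fq; last exact: hp.
  by apply/flip_prj/ht/circle_min_leading.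
- move=> q qm; have qN : (q < N)%N by apply: leq_trans qm (leq_addr _ _).
  by rewrite (@build_fixed t (Ordinal qN)) // /fxpos /= qm.
- move=> q dq; have [l hl [E1 E2]] := double_firstP hv h12 dq.
  have q1 : (q.+1 < N)%N by have := typ_le hv hl; lia.
  have c := double_matched (double_first_lab hv h12 hv') dq.
  rewrite (cups _ _ q1 c) (@build_fixed t (Ordinal (ltnW q1))) // /fxpos /= dq orbT //.
- move=> q qS; have [qN _] := mem_bstack qS.
  by rewrite (@build_fixed t (Ordinal qN)) //; apply: hf.
Qed.

Lemma build_joint_params (t : nat -> 'M[K]_2) : (forall j : 'I_N, leading j -> prj (t j)) -> joint_params (build t).
Proof.
move=> ht; have [h1 h2] := hpi0; split; apply: build_cup_params => //.
- by move=> i j jN c a b Ea Eb; rewrite /circle_edge Ea Eb c.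
- by move=> q qS; rewrite /fxpos qS !orbT.
- by move=> i j jN c a b Ea Eb; rewrite /circle_edge Ea Eb c !orbT.
- by move=> q qS; rewrite /fxpos qS !orbT.
Qed.

Local Notation X := (Ytil R n k ii w `&` Ytil R n k ii w').

Lemma YcapP F : X F <->
  exists x pi, [/\ is_lift x, flagof x = F, joint_params pi & rep F pi].
Proof.
split=> [[]|[x [pi [xl E [h1 h2] hr]]]]; last first.
  by split; [apply/(YtilP hv hw hnk)|apply/(YtilP hv hw' hnk)]; exists x, pi.
move=> /(YtilP hv hw hnk)[x [pi [xl <- hpi hx]]] /(YtilP hv hw' hnk)[y [pi' [yl E hpi' hy]]].
exists x, pi; split=> //; split=> //.
have [g _ _] := hpi; have [g' _ _] := hpi'.
by apply: cup_params_ext hpi' => // q qN; rewrite (flag_rep_uniq hv h12 xl g g' hx hy qN).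
Qed.

Definition piof (F : flagsp R n ii) : nat -> 'M[K]_2 :=
  if pselect (exists pi, joint_params pi /\ rep F pi) is left h then sval (cid h) else pi0.

Lemma piofP F : X F -> joint_params (piof F) /\ rep F (piof F).
Proof.
move=> /YcapP[x [pi [_ _ h1 h2]]]; rewrite /piof; case: pselect => [h|[]].
  exact: svalP (cid h).
by exists pi.
Qed.

Lemma joint_params_good pi : joint_params pi -> goodpi pi. Proof. by case=> [[]]. Qed.

Lemma piof_uniq x pi : is_lift x -> X (flagof x) -> joint_params pi -> rep (flagof x) pi ->
  forall q, (q < N)%N -> piof (flagof x) q = pi q.
Proof.
move=> xl hX hpi hx q qN; have [h1 h2] := piofP hX.
exact: (flag_rep_uniq hv h12 xl (joint_params_good h1) (joint_params_good hpi) h2 hx).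
Qed.

Definition chof pi : nat -> 'I_2 :=
  if pselect (exists ch, validch n k pi ch) is left h then sval (cid h) else fun=> 0.

Lemma chofP pi : joint_params pi -> validch n k pi (chof pi).
Proof.
move=> /joint_params_good[hp _ _]; rewrite /chof; case: pselect => [h|[]]; last exact: validch_exists.
exact: svalP (cid h).
Qed.

Lemma joint_params_stiefel_lift pi ch : joint_params pi -> validch n k pi ch ->
  [/\ is_lift (liftx pi ch), rep (flagof (liftx pi ch)) pi & X (flagof (liftx pi ch))].
Proof.
move=> hpi hch; have [h1 h2 _] := cup_params_stiefel_lift hv hw hnk hpi.1 hch.
by split=> //; apply/YcapP; exists (liftx pi ch), pi.
Qed.

(** Induction on the position: prepended positions and doubles are constant, and elsewhere the
    projector is [herm] of the vector [b x], which depends continuously on the lift and on the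
    earlier projectors and stays nonzero near [x0]. *)
Lemma cvg_piof_lift x0 : is_lift x0 -> X (flagof x0) ->
  forall q, (q < N)%N ->
  cvgMx (within (@is_lift R n ii `&` @flagof R n ii @^-1` X) (nbhs x0))
    (fun x => piof (flagof x) q) (piof (flagof x0) q).
Proof.
move=> xl hX; set G := within _ _.
have FG : Filter G by apply: within_filter.
have hG : \forall x \near G, is_lift x /\ X (flagof x) by apply: withinT.
have [hp0 hr0] := piofP hX; have g0 := joint_params_good hp0; have [hpp hF0 hd0] := g0.
have cst q : (forall pi, joint_params pi -> pi q = piof (flagof x0) q) ->
    cvgMx G (fun x => piof (flagof x) q) (piof (flagof x0) q).
  move=> h; apply: (@cvgM_eq _ _ G _ _ _ (fun=> piof (flagof x0) q)); last exact: cvgM_cst.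
  by apply: filterS hG => x [xl' hX']; apply: h; have [] := piofP hX'.
elim/ltn_ind => q IH qN; case: (ltnP q m) => qm.
  by apply: cst => pi /joint_params_good[_ h _]; rewrite h // hF0.
have [l hl [Eq|[Eq E2]]] := pos_cases hv h12 qm qN; last first.
  have dq : dblpos (m + prv l) by rewrite double_first_prv // E2.
  apply: cst => pi /joint_params_good[_ _ h]; rewrite Eq addnS.
  by have [_ ->] := h _ dq; have [_ ->] := hd0 _ dq.
have [E|E] := h12 hl; last first.
  have dq : dblpos (m + prv l) by rewrite double_first_prv // E.
  apply: cst => pi /joint_params_good[_ _ h]; rewrite Eq.
  by have [-> _] := h _ dq; have [-> _] := hd0 _ dq.
pose lo := Ordinal hl.
have [a ha] := flag_rep_nontriv hv lo xl hF0 hr0.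
pose b (x : Lift) := lsteps (piof (flagof x)) q (emb (row a (cmat x lo))) 0%N.
have rs (x : Lift) : (row a (cmat x lo) <= cmat x lo)%MS by apply: row_sub.
have b0 : b x0 != 0.
  apply/eqP; rewrite /b Eq => h; apply: ha => -[|s] //; exact: (flag_rep_const hv h12 g0 hr0 (rs x0)).
have cb : cvgMx G b (b x0).
  apply: cvgM_lsteps => [r rq|s]; first by apply: IH => //; apply: ltn_trans qN.
  rewrite /embV; case: insubP => [c _ _|_]; last exact: cvgM_cst.
  apply: cvgM_scale.
  have hc := @cvg_cmat R n ii Lift G id x0 FG (cvg_within _) lo.
  exact: (@cvgM_row R Lift G n n _ _ a FG (hc (nbhs_filter x0)) 0 c).
rewrite Eq.
have bE x : is_lift x -> X (flagof x) -> b x != 0 -> piof (flagof x) (m + prv l)%N = herm (b x).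
  move=> xl' hX'; have [p1 p2] := piofP hX'; rewrite /b Eq.
  exact: (flag_rep_single hv (l := lo) (joint_params_good p1) p2 E (rs x)).
rewrite (bE x0 xl hX b0).
apply: (@cvgM_eq _ _ G _ _ _ (fun x => herm (b x))); last exact: cvgM_herm.
by apply: filterS2 hG (cvgM_near FG cb b0) => x [xl' hX'] bx; apply: bE.
Qed.

Lemma cvg_piof F0 : X F0 -> forall q, (q < N)%N ->
  cvgMx (within X (nbhs F0)) (fun F => piof F q) (piof F0 q).
Proof.
move=> hX q qN; have /YcapP[x0 [pi [xl Ex _ _]]] := hX.
rewrite -Ex in hX *; move=> a b; have [h1 h2] := cvg_piof_lift xl hX qN a b.
split.
  exact: (cvg_flagof (g := fun F => complex.Re (piof F q a b)) tn xl h1).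
exact: (cvg_flagof (g := fun F => complex.Im (piof F q a b)) tn xl h2).
Qed.

Definition leads : seq nat := [seq val q | q <- enum leading].

Lemma leads_uniq : uniq leads.
Proof. by rewrite map_inj_uniq ?enum_uniq //; apply: val_inj. Qed.

Lemma mem_leads (q : 'I_N) : (val q \in leads) = leading q.
Proof. by rewrite mem_map ?mem_enum //; apply: val_inj. Qed.

Lemma leadsP a : (a < size leads)%N -> exists2 q : 'I_N, leading q & nth 0%N leads a = q.
Proof.
move=> h; have /mapP[q qe E] : nth 0%N leads a \in leads by apply: mem_nth.
by exists q => //; rewrite mem_enum in qe.
Qed.

Definition toSeq (F : flagsp R n ii) : {ptws nat -> P1} := fun a =>
  if (a < size leads)%N then toCP (piof F (nth 0%N leads a)) else base R.
Definition seqpi (t : {ptws nat -> P1}) := build (fun j => ofCP (t (index j leads))).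
Definition ofSeq (t : {ptws nat -> P1}) : flagsp R n ii :=
  flagof (liftx (seqpi t) (chof (seqpi t))).

Lemma seqpi_joint_params t : CPn (size leads) t -> joint_params (seqpi t).
Proof.
move=> [h _]; apply: build_joint_params => j lj; apply: ofCP_prj; apply: h.
by rewrite index_mem mem_leads.
Qed.

(** The coordinates are the projectors at the least positions of the free circles. For the
    continuity of the inverse at [t0], the row selection [chof] may jump; near [t0] the one made at
    [t0] remains valid, and the resulting flag does not depend on the selection. *)
Lemma homeo_Ycap : homeo_on X (CPn (size leads)) toSeq.
Proof.
have inX F a : X F -> (a < size leads)%N -> prj (piof F (nth 0%N leads a)).
  move=> hX /leadsP[q lq ->]; have [/joint_params_good[hp _ _] _] := piofP hX; exact: hp.
exists ofSeq; split.
- move=> F hX; split=> a ha; rewrite /toSeq; last by rewrite ltnNge ha.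
  by rewrite ha; apply/toCP_CP1/inX.
- move=> t ht; have hP := seqpi_joint_params ht.
  by have [] := joint_params_stiefel_lift hP (chofP hP).
- move=> F hX; have [h1 h2] := piofP hX.
  have hin : CPn (size leads) (toSeq F).
    split=> a ha; rewrite /toSeq; last by rewrite ltnNge ha.
    by rewrite ha; apply/toCP_CP1/inX.
  have hP := seqpi_joint_params hin; have [l1 l2 _] := joint_params_stiefel_lift hP (chofP hP).
  have /YcapP[x [_ [xl Ex _ _]]] := hX.
  suff H : rep (flagof x) (seqpi (toSeq F)).
    by have := flag_rep_inj l2 H; rewrite Ex.
  rewrite Ex; apply: flag_rep_ext h2 => q qN.
  apply: etrans (joint_params_formula (Ordinal qN) h1) _.
  rewrite /seqpi (buildE _ (Ordinal qN)).
  case: ifP => // fq; congr flip.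
  have ll := circle_min_leading fq; have lm : val (lead (Ordinal qN)) \in leads by rewrite mem_leads.
  have [/joint_params_good[hp _ _] _] := piofP hX.
  by rewrite /toSeq index_mem lm nth_index // toCPK //; apply: hp.
- move=> t ht; have hP := seqpi_joint_params ht; have [l1 l2 l3] := joint_params_stiefel_lift hP (chofP hP).
  apply/funext => a; rewrite /toSeq; case: ltnP => ha; last by case: ht => _ ->.
  have [q lq Eq] := leadsP ha; rewrite Eq (piof_uniq l1 l3 hP l2) // /seqpi buildE.
  have /andP[fq /eqP lqq] := lq; rewrite fq lqq addbb /= -Eq index_uniq ?leads_uniq //.
  by rewrite ofCPK //; case: ht => h _; apply: h.
split; apply/subspace_continuousP.
  move=> F0 hX; apply: cvg_ptws => a.
  suff : (fun F => toSeq F a) @ within X (nbhs F0) --> toSeq F0 a by [].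
  case: (ltnP a (size leads)) => ha; last first.
    have -> : (fun F => toSeq F a) = (fun=> base R).
      by apply/funext => F; rewrite /toSeq ltnNge ha.
    by rewrite /toSeq ltnNge ha; apply: cvg_cst.
  have -> : (fun F => toSeq F a) = (fun F => toCP (piof F (nth 0%N leads a))).
    by apply/funext => F; rewrite /toSeq ha.
  rewrite /toSeq ha; have [q lq Eq] := leadsP ha.
  apply: cvg_toCP; first exact: inX.
    by apply: filterS (withinT _ _) => F hF; apply: inX.
  by rewrite Eq; apply: cvg_piof.
move=> t0 ht0; set G := within _ _.
have FG : Filter G by apply: within_filter.
have hP := seqpi_joint_params ht0; have hch := chofP hP; set ch := chof (seqpi t0) in hch *.
have hG : \forall t \near G, CPn (size leads) t by apply: withinT.
have cpi q : (q < N)%N -> cvgMx G (fun t => seqpi t q) (seqpi t0 q).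
  move=> qN; have E (t : {ptws nat -> P1}) : seqpi t q = if freec (Ordinal qN) then
      flip (odd (Ordinal qN) (+) odd (lead (Ordinal qN)))
        (ofCP (t (index (val (lead (Ordinal qN))) leads))) else pi0 q.
    exact: (buildE _ (Ordinal qN)).
  rewrite E; apply: (cvgM_eq FG (nearW _ E)).
  case: ifP => fq; last exact: cvgM_cst.
  have ll := circle_min_leading fq; set j := lead _ in ll *.
  have aj : (index (val j) leads < size leads)%N by rewrite index_mem mem_leads.
  have c : cvgMx G (fun t => ofCP (t (index (val j) leads))) (ofCP (t0 (index (val j) leads))).
    have H0 : CP1 R (t0 (index (val j) leads)) by case: ht0 => h _; apply: h.
    have hh : (fun t : {ptws nat -> P1} => t (index (val j) leads)) @ G -->
        within (CP1 R) (nbhs (t0 (index (val j) leads))).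
      move=> W; rewrite /within /= => hW.
      have hproj : (fun t : {ptws nat -> P1} => t (index (val j) leads)) @ G -->
          t0 (index (val j) leads).
        by apply: (cvg_ptws_proj (f := id)); apply: cvg_within.
      have h1 := hproj _ hW.
      by apply: filterS2 hG h1 => t [ht _]; apply; apply: ht.
    move=> a b; have [c1 c2] := cvg_ofCP H0 a b.
    by split; [apply: cvg_comp hh c1|apply: cvg_comp hh c2].
  case: (odd _ (+) odd _) => //=.
  apply: cvgM_add; first exact: cvgM_cst.
  exact: cvgM_opp.
have near_ch : \forall t \near G, validch n k (seqpi t) ch.
  have : \forall t \near G, forall a : 'I_n, row (ch a) (seqpi t (m + a)%N) != 0.
    apply: filter_forall => a; apply: (cvgM_near (A := row (ch a) (seqpi t0 (m + a)%N))).
      by apply: cvgM_row; apply: cpi; rewrite ltn_add2l.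
    exact: hch.
  by apply: filterS => t h a an; apply: (h (Ordinal an)).
have c1 : (fun t => flagof (liftx (seqpi t) ch)) @ G --> flagof (liftx (seqpi t0) ch).
  apply: flagof_cvg.
  - by have [] := joint_params_stiefel_lift hP hch.
  - by apply: filterS2 hG near_ch => t /seqpi_joint_params ht ct; have [] := joint_params_stiefel_lift ht ct.
  - by apply: cvg_Lift; apply: cvg_stiefel_lift.
rewrite /ofSeq -/ch; apply: cvg_trans c1; apply: near_eq_cvg.
apply: filterS2 hG near_ch => t /seqpi_joint_params ht ct.
have [_ r1 _] := joint_params_stiefel_lift ht ct; have [_ r2 _] := joint_params_stiefel_lift ht (chofP ht).
exact: flag_rep_inj r1 r2.
Qed.

End Base.

Lemma iter_bundle_Ycap : (Ytil R n k ii w `&` Ytil R n k ii w') !=set0 ->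
  iter_bundle R #|leading| (Ytil R n k ii w `&` Ytil R n k ii w').
Proof.
move=> [F hF].
have [pi0 hpi0] : exists pi0, joint_params pi0.
  case: (hF) => /(YtilP hv hw hnk)[x [pi [xl Ex hpi hx]]].
  move=> /(YtilP hv hw' hnk)[y [pi' [yl _ hpi' hy]]].
  rewrite -Ex in hx hy; exists pi; split=> //; have [g _ _] := hpi; have [g' _ _] := hpi'.
  by apply: cup_params_ext hpi' => // q qN; rewrite (flag_rep_uniq hv h12 xl g g' hx hy qN).
have := iter_bundle_of_homeo (homeo_Ycap hpi0).
by rewrite /leads size_map -cardE.
Qed.

End Homeo.

Local Close Scope ring_scope.

Theorem theorem8p2 (R : realType) (n k : nat) (ii : seq nat) (w w' : seq (bool * bool)) :
  (2 * k <= n)%N -> valid_type n ii ->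
  row_strict n k ii w -> row_strict n k ii w' ->
  (Ytil R n k ii w `&` Ytil R n k ii w' !=set0) ->
  iter_bundle R (n_indep n (Dgraph n k ii w)) (Ytil R n k ii w)
  /\ iter_bundle R (n_indep n (Dgraph2 n k ii w w')) (Ytil R n k ii w `&` Ytil R n k ii w').
Proof.
move=> hnk hv hw hw' hne; have h12 := typ12 hv hw; split.
  (* A single [Ytil] is treated as the intersection with itself. *)
  have HA a : a \in (Dgraph n k ii w).2 <-> cup_arc n k ii w a \/ cup_arc n k ii w a.
    by rewrite (arcP hv h12 hw); split=> [|[]] //; left.
  rewrite (n_indep_leading hv hw hw HA (@nodeP n k ii w)).
  rewrite -[X in iter_bundle _ _ X]setIid; apply: iter_bundle_Ycap => //.
  by have [F [hF _]] := hne; exists F.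
have HA a : a \in (Dgraph2 n k ii w w').2 <-> cup_arc n k ii w a \/ cup_arc n k ii w' a.
  rewrite mem_cat; split.
    by case/orP => [/(arcP hv h12 hw)|/(arcP hv h12 hw')]; [left|right].
  by case=> [/(arcP hv h12 hw)|/(arcP hv h12 hw')] ->; rewrite ?orbT.
have HN u : (0 < u)%R -> (u <= Posz n)%R -> u \in (Dgraph2 n k ii w w').1 = (u \in [seq Posz p | p <- ii]).
  by move=> u0 un; rewrite mem_undup mem_cat !nodeP // orbb.
rewrite (n_indep_leading hv hw hw' HA HN).
exact: iter_bundle_Ycap.
Qed.
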